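(* Let $d\ge2$, $\kappa_\Delta,\kappa_\Box\in\mathbb R$, and let $\Delta:=\Delta^d_{\ell_\Delta}(\kappa_\Delta)\subseteq\mathbb B^d(\kappa_\Delta)$ and $\Box:=\Box^d_{\ell_\Box}(\kappa_\Box)\subseteq\mathbb B^d(\kappa_\Box)$ be a (non-ideal) regular simplex and a (non-ideal) regular cube of geodesic edge lengths $\ell_\Delta$ and $\ell_\Box$. Put $C_\Delta:=C_{\kappa_\Delta}(\ell_\Delta)$ and $C_\Box:=C_{\kappa_\Box}(\ell_\Box)$, and suppose that $$C_\Box=1+2C_\Delta.$$ Then, for every $k\in\{0,\ldots,d-1\}$, the following assertions hold. (a) If $C_\Delta\ne0$, the Riemannian normal cones at any $k$-dimensional face of $\Delta$ and at any $k$-dimensional face of $\Box$ are isometric to $$C_{d-k}\left(-d-\tfrac1{C_\Delta};1,\ldots,1;1,\ldots,1\right).$$ If $C_\Delta=0$, all these normal cones are isometric to the $(d-k)$-dimensional orthant $[0,\infty)^{d-k}$. (b) If $C_\Delta\ne0$, the Riemannian tangent cones at any $k$-dimensional face of $\Delta$ and at any $k$-dimensional face of $\Box$ are isometric to $$\mathbb R^k\oplus C_{d-k}\left(k+\tfrac1{C_\Delta};1,\ldots,1;1,\ldots,1\right).$$ If $C_\Delta=0$, all these tangent cones are isometric to $\mathbb R^k\oplus[0,\infty)^{d-k}$. (c) Consequently, the external and internal angles at $k$-dimensional faces of $\Delta$ and $\Box$ coincide. Their common values are, respectively, $$\frac1{\sqrt{2\pi}}\int_{-\infty}^\infty\Ph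i\left(\sqrt{\frac{C_\Delta}{1+kC_\Delta}}\,y\right)^{d-k}e^{-y^2/2}\,dy\quad\text{and}\quad\frac1{\sqrt{2\pi}}\int_{-\infty}^\infty\Phi\left(\sqrt{-\frac{C_\Delta}{1+dC_\Delta}}\,y\right)^{d-k}e^{-y^2/2}\,dy.$$
   Context: $C_\kappa(\ell):=\cosh(\sqrt{-\kappa}\,\ell)$ if $\kappa<0$, $:=1$ if $\kappa=0$, $:=\cos(\sqrt\kappa\,\ell)$ if $\kappa>0$. Klein model. $\mathbb B^d(\kappa):=\mathbb R^d$ if $\kappa\ge0$ and $\mathbb B^d(\kappa):=\{x\in\mathbb R^d:\|x\|<1/\sqrt{-\kappa}\}$ if $\kappa<0$. The tangent space at $x\in\mathbb B^d(\kappa)$ is identified with $\mathbb R^d$ and carries the inner product $$g_x(u,v)=\frac{\langle u,v\rangle}{1+\kappa\|x\|^2}-\frac{\kappa\langle x,u\rangle\langle x,v\rangle}{(1+\kappa\|x\|^2)^2}.$$ The geodesic distance is $\rho_\kappa(x,y)=\|x-y\|$ for $\kappa=0$, and, with $q=\frac{1+\kappa\langle x,y\rangle}{\sqrt{(1+\kappa\|x\|^2)(1+\kappa\|y\|^2)}}$, it is $\frac1{\sqrt\kappa}\arccos q$ for $\kappa>0$ and $\frac1{\sqrt{-\kappa}}\operatorname{arcosh} q$ for $\kappa<0$. Regular polytopes. $\Delta_\ell^d(\kappa)\subseteq\mathbb B^d(\kappa)$ is a $d$-dimensional simplex whose vertices have pairwise geodesic distance $\ell$. $\Box_\ell^d(\kappa)=[-\tau,\tau]^d\subseteq\mathbb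 B^d(\kappa)$ is the cube (centred at the origin, $\tau>0$) whose adjacent vertices have geodesic distance $\ell$. Cones and angles. Let $P=\{y\in\mathbb R^d:\langle a_r,y\rangle\le b_r,\ r=1,\ldots,m\}\subseteq\mathbb B^d(\kappa)$ be a full-dimensional polytope with irredundant inequalities ($a_r\neq 0$), $F\ne P$ a (nonempty) face, $I(F)=\{r:\langle a_r,y\rangle=b_r\ \forall y\in F\}$. For $x\in\operatorname{relint}(F)$, the Riemannian tangent cone is $T_x(F,P)=\{u\in\mathbb R^d:\langle a_r,u\rangle\le0\ \forall r\in I(F)\}$ and the Riemannian normal cone is $N_x(F,P)=\{v\in\mathbb R^d: g_x(v,u)\le0\ \forall u\in T_x(F,P)\}$, both regarded as cones in $(\mathbb R^d,g_x)$; their isometry types do not depend on $x$. For a polyhedral cone $K$ in a finite-dimensional inner product space with linear hull $L$, its solid angle is the ratio of the $(\dim L)$-dimensional volumes of $K\cap B$ and $L\cap B$, $B$ the unit ball. The internal (external) angle at $F$ is the solid angle of $T_x(F,P)$ (of $N_x(F,P)$) with respect to $g_x$. Two cones in inner product spaces are isometric if a linear isometry between their linear hulls maps one onto the other; $\oplus$ denotes direct orthogonal sum. Orthocentric cones. For $m\in\mathbb N$, $\lambda_0,\ldots,\lambda_m\in\mathbb R\setminus\{0\}$ and $\varepsilon_1,\ldots,\varepsilon_m\in\{\pm1\}$, $C_m(\lambda_0;\lambda_1,\ldots,\lambda_m;\varepsilon_1,\ldots,\varepsilon_m)$ denotes any cone $\operatorname{pos}\{\varepsilon_1v_1,\ldots,\varepsilon_mv_m\}$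 (the set of nonnegative linear combinations) with linearly independent $v_1,\ldots,v_m\in\mathbb R^N$, $N\ge m$, satisfying $\langle v_i,v_j\rangle=\frac1{\lambda_0}+\frac{\delta_{ij}}{\lambda_i}$; it is unique up to isometry. $\Phi$ is the entire function $\Phi(z)=\frac12+\frac1{\sqrt{2\pi}}\int_0^z e^{-t^2/2}\,dt$. Convention: $\sqrt{-a}:=\mathrm i\sqrt a$ for $a>0$. *)

(* Defs.v *)
From HB Require Import structures.
From mathcomp Require Import all_boot all_order all_algebra.
From mathcomp Require Import all_classical all_reals all_analysis.
From mathcomp Require Import complex.

Set Implicit Arguments.
Unset Strict Implicit.
Unset Printing Implicit Defensive.

Import Order.TTheory GRing.Theory Num.Theory.
Import numFieldNormedType.Exports.

Local Open Scope classical_set_scope.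
Local Open Scope ring_scope.

Section Euclidean.
Variable R : realType.
Implicit Types n m k : nat.

Definition dotv n (u v : 'rV[R]_n) : R := \sum_i u 0 i * v 0 i.

(* The norm that the library puts on ['rV_n] is the sup norm. *)
Definition norm2 n (u : 'rV[R]_n) : R := Num.sqrt (dotv u u).

Definition lin_hull n (S : set 'rV[R]_n) : set 'rV[R]_n :=
  [set u | exists m (c : 'I_m -> R) (s : 'I_m -> 'rV[R]_n),
     (forall i, S (s i)) /\ u = \sum_i c i *: s i].

Definition aff_hull n (S : set 'rV[R]_n) : set 'rV[R]_n :=
  [set u | exists m (c : 'I_m -> R) (s : 'I_m -> 'rV[R]_n),
     [/\ forall i, S (s i), \sum_i c i = 1 & u = \sum_i c i *: s i]].

Definition conv_hull n m (w : 'I_m -> 'rV[R]_n) : set 'rV[R]_n :=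
  [set u | exists c : 'I_m -> R,
     [/\ forall i, 0 <= c i, \sum_i c i = 1 & u = \sum_i c i *: w i]].

Definition pos_hull n m (v : 'I_m -> 'rV[R]_n) : set 'rV[R]_n :=
  [set u | exists c : 'I_m -> R,
     (forall i, 0 <= c i) /\ u = \sum_i c i *: v i].

Definition lin_indep n m (v : 'I_m -> 'rV[R]_n) : Prop :=
  forall c : 'I_m -> R, \sum_i c i *: v i = 0 -> forall i, c i = 0.

Definition aff_indep n m (w : 'I_m -> 'rV[R]_n) : Prop :=
  forall c : 'I_m -> R, \sum_i c i = 0 -> \sum_i c i *: w i = 0 ->
    forall i, c i = 0.

(* [S] is nonempty and its affine hull has dimension [k]. *)
Definition has_dim n (S : set 'rV[R]_n) k : Prop :=
  exists p : 'I_k.+1 -> 'rV[R]_n,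
    [/\ aff_indep p, forall i, S (p i) & S `<=` aff_hull (range p)].

Definition relint n (S : set 'rV[R]_n) : set 'rV[R]_n :=
  [set x | S x /\ exists2 e : R, 0 < e &
     forall y, aff_hull S y -> norm2 (y - x) < e -> S y].

End Euclidean.

Section Polytopes.
Variable R : realType.
Implicit Types n m k : nat.

Definition irredundant_hrep n m (P : set 'rV[R]_n)
    (a : 'I_m -> 'rV[R]_n) (b : 'I_m -> R) : Prop :=
  [/\ has_dim P n,
      P = [set y | forall r, dotv (a r) y <= b r],
      forall r, a r != 0 &
      forall r, exists y, (forall s, s != r -> dotv (a s) y <= b s) /\
                          b r < dotv (a r) y].

Definition proper_face n (P F : set 'rV[R]_n) : Prop :=
  [/\ exists (c : 'rV[R]_n) (beta : R),
        (forall y, P y -> dotv c y <= beta) /\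
        F = P `&` [set y | dotv c y = beta],
      F !=set0 & F <> P].

Definition active n m (a : 'I_m -> 'rV[R]_n) (b : 'I_m -> R)
    (F : set 'rV[R]_n) : set 'I_m :=
  [set r | forall y, F y -> dotv (a r) y = b r].

Definition cube_vertex n (tau : R) (s : {ffun 'I_n -> bool}) : 'rV[R]_n :=
  \row_i (if s i then tau else - tau).

End Polytopes.

Section KleinModel.
Variable R : realType.
Implicit Types n : nat.

Definition cosh (x : R) : R := (expR x + expR (- x)) / 2.

Definition arcosh (q : R) : R := ln (q + Num.sqrt (q ^+ 2 - 1)).

Definition Ccurv (kappa l : R) : R :=
  if kappa < 0 then cosh (Num.sqrt (- kappa) * l)
  else if kappa == 0 then 1
  else cos (Num.sqrt kappa * l).

Definition klein_ball n (kappa : R) : set 'rV[R]_n :=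
  [set x | kappa < 0 -> norm2 x < (Num.sqrt (- kappa))^-1].

Definition klein_metric n (kappa : R) (x u v : 'rV[R]_n) : R :=
  dotv u v / (1 + kappa * dotv x x)
  - kappa * dotv x u * dotv x v / (1 + kappa * dotv x x) ^+ 2.

Definition klein_dist n (kappa : R) (x y : 'rV[R]_n) : R :=
  let q := (1 + kappa * dotv x y) /
           Num.sqrt ((1 + kappa * dotv x x) * (1 + kappa * dotv y y)) in
  if kappa == 0 then norm2 (x - y)
  else if 0 < kappa then (Num.sqrt kappa)^-1 * acos q
  else (Num.sqrt (- kappa))^-1 * arcosh q.

Definition regular_simplex n (kappa l : R) (P : set 'rV[R]_n) : Prop :=
  P `<=` klein_ball kappa /\
  exists w : 'I_n.+1 -> 'rV[R]_n,
    [/\ aff_indep w, P = conv_hull w &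
        forall i j, i != j -> klein_dist kappa (w i) (w j) = l].

Definition regular_cube n (kappa l : R) (P : set 'rV[R]_n) : Prop :=
  P `<=` klein_ball kappa /\
  exists tau : R,
    [/\ 0 < tau,
        P = [set y : 'rV[R]_n | forall i, - tau <= y 0 i <= tau] &
        forall s t : {ffun 'I_n -> bool}, #|[set i | s i != t i]%SET| = 1%N ->
          klein_dist kappa (cube_vertex tau s) (cube_vertex tau t) = l].

End KleinModel.

(* A cone together with its ambient inner product space, given in coordinates
   as ['rV_cdim] with the bilinear form [cform]. *)
Record icone (R : realType) := ICone {
  cdim : nat;
  cform : 'rV[R]_cdim -> 'rV[R]_cdim -> R;
  cset : set 'rV[R]_cdim }.

Arguments cform {R} i u v : rename.
Arguments cset {R} i _.

Section Cones.
Variable R : realType.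
Implicit Types n m k : nat.

Definition isometric (C D : icone R) : Prop :=
  exists f : {linear 'rV[R]_(cdim C) -> 'rV[R]_(cdim D)},
    [/\ forall u v, lin_hull (cset C) u -> lin_hull (cset C) v ->
          cform D (f u) (f v) = cform C u v,
        f @` lin_hull (cset C) = lin_hull (cset D) &
        f @` cset C = cset D].

Definition osum (C D : icone R) : icone R :=
  @ICone R (cdim C + cdim D)%N
    (fun u v =>
       cform C (lsubmx u) (lsubmx v) + cform D (rsubmx u) (rsubmx v))
    [set u | cset C (lsubmx u) /\ cset D (rsubmx u)].

Definition euclidean_cone n (K : set 'rV[R]_n) : icone R := ICone (@dotv R n) K.

Definition whole_space k : icone R := euclidean_cone [set: 'rV[R]_k].

Definition orthant n : icone R :=
  euclidean_cone [set u : 'rV[R]_n | forall i, 0 <= u 0 i].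

(* [C] is one of the (mutually isometric) cones denoted C_m(...). *)
Definition is_orthocentric_cone m (lam0 : R) (lam eps : 'I_m -> R)
    (C : icone R) : Prop :=
  [/\ lam0 != 0, forall i, lam i != 0, forall i, eps i = 1 \/ eps i = -1 &
    exists (N : nat) (v : 'I_m -> 'rV[R]_N),
      [/\ lin_indep v,
          forall i j, dotv (v i) (v j) = lam0^-1 + (i == j)%:R / lam i &
          C = euclidean_cone (pos_hull (fun i => eps i *: v i))]].

Definition tangent_cone n m (a : 'I_m -> 'rV[R]_n) (b : 'I_m -> R)
    (F : set 'rV[R]_n) : set 'rV[R]_n :=
  [set u | forall r, active a b F r -> dotv (a r) u <= 0].

Definition normal_cone n m (kappa : R) (a : 'I_m -> 'rV[R]_n) (b : 'I_m -> R)
    (F : set 'rV[R]_n) (x : 'rV[R]_n) : set 'rV[R]_n :=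
  [set v | forall u, tangent_cone a b F u -> klein_metric kappa x v u <= 0].

(* The cones at all relative interior points of all [k]-faces of [P], for all
   irredundant descriptions of [P] by linear inequalities. *)
Definition riem_tangent_cones n (kappa : R) (P : set 'rV[R]_n) k :
    set (icone R) :=
  [set K | exists m (a : 'I_m -> 'rV[R]_n) (b : 'I_m -> R)
                  (F : set 'rV[R]_n) (x : 'rV[R]_n),
     [/\ irredundant_hrep P a b, proper_face P F, has_dim F k, relint F x &
         K = ICone (klein_metric kappa x) (tangent_cone a b F)]].

Definition riem_normal_cones n (kappa : R) (P : set 'rV[R]_n) k :
    set (icone R) :=
  [set K | exists m (a : 'I_m -> 'rV[R]_n) (b : 'I_m -> R)
                  (F : set 'rV[R]_n) (x : 'rV[R]_n),
     [/\ irredundant_hrep P a b, proper_face P F, has_dim F k, relint F x &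
         K = ICone (klein_metric kappa x) (normal_cone kappa a b F x)]].

(* Lebesgue measure on ['rV_n], as the iterated product of [lebesgue_measure]:
   the recursive clause is the library's formula for the product measure,
   (m1 \x m2) A = \int[m1]_t m2 (xsection A t). *)
Fixpoint vol n : set 'rV[R]_n -> \bar R :=
  match n return set 'rV[R]_n -> \bar R with
  | 0 => fun A => (\1_A (0 : 'rV[R]_0))%:E
  | n'.+1 => fun A =>
      (\int[@lebesgue_measure R]_t
         vol [set y : 'rV[R]_n' | A (row_mx (t%:M : 'rV[R]_1) y)])%E
  end.

Definition orthonormal_basis n m (g : 'rV[R]_n -> 'rV[R]_n -> R)
    (L : set 'rV[R]_n) (E : 'M[R]_(m, n)) : Prop :=
  (forall i j, g (row i E) (row j E) = (i == j)%:R) /\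
  L = range (fun c : 'rV[R]_m => c *m E).

(* Volumes in the linear hull are computed in the coordinates of an orthonormal
   basis; the ratio does not depend on which one is selected by [get]. *)
Definition solid_angle (C : icone R) : R :=
  let L := lin_hull (cset C) in
  let B := [set u : 'rV[R]_(cdim C) | cform C u u <= 1] in
  get [set t : R | exists m (E : 'M[R]_(m, cdim C)),
    orthonormal_basis (cform C) L E /\
    t = fine (vol [set c : 'rV[R]_m | (cset C `&` B) (c *m E)]) /
        fine (vol [set c : 'rV[R]_m | (L `&` B) (c *m E)])].

End Cones.

Section ComplexIntegrals.
Local Open Scope complex_scope.
Variable R : realType.

Definition cexp (z : R[i]) : R[i] :=
  (expR (complex.Re z))%:C * (cos (complex.Im z) +i* sin (complex.Im z)).

Definition cintegrable (D : set R) (f : R -> R[i]) : Prop :=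
  (@lebesgue_measure R).-integrable D (EFin \o (fun x => complex.Re (f x))) /\
  (@lebesgue_measure R).-integrable D (EFin \o (fun x => complex.Im (f x))).

Definition cintegral (D : set R) (f : R -> R[i]) : R[i] :=
  Rintegral (@lebesgue_measure R) D (fun x => complex.Re (f x))
  +i* Rintegral (@lebesgue_measure R) D (fun x => complex.Im (f x)).

(* The integral from 0 to [z] is taken along the straight segment. *)
Definition Phi (z : R[i]) : R[i] :=
  2^-1 + ((Num.sqrt (2 * pi))^-1)%:C *
    cintegral `[0, 1] (fun s : R => z * cexp (- (s%:C * z) ^+ 2 / 2)).

Definition csqrt (a : R) : R[i] :=
  if 0 <= a then (Num.sqrt a)%:C else 0 +i* Num.sqrt (- a).

Definition angle_integrand (a : R) (n : nat) (y : R) : R[i] :=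
  Phi (csqrt a * y%:C) ^+ n * (expR (- y ^+ 2 / 2))%:C.

Definition angle_integral (a : R) (n : nat) : R[i] :=
  ((Num.sqrt (2 * pi))^-1)%:C * cintegral [set: R] (angle_integrand a n).

End ComplexIntegrals.

(* Main.v *)
(* Both polytopes have the same dual Gram data. If facets [h i y <= c i] are active at a
   point x of the relative interior of a k-face, the inverse Klein metric pairs their
   normals as (1 + kappa |x|^2) (<h i, h j> + kappa c i c j). For the cube this is read
   off directly, for the simplex it comes from inverting the Gram matrix of the lifted
   vertices; after scaling the normals one obtains I - b J in both cases, where J is the
   all-ones matrix and b = C / (1 + d C). Since the lineality space of the tangent cone
   has dimension k, exactly m = d - k facets are active, so with a symmetric root S of
   I - b J and an orthonormal frame of the metric the normal cone becomes pos (rows of S)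
   and the tangent cone R^k + pos (rows of S^-1), where S^-2 = I + a J and
   a = C / (1 + k C).

   For the angles, the volume of a cone in the unit ball is proportional to its Gaussian
   integral. The change of variables by S turns the cone into an orthant and the density
   into exp (-(|y|^2 - a' (y_1 + ... + y_m)^2) / 2). Writing exp (a' s^2 / 2) as the mean
   of exp (sqrt a' Y s) over a standard Gaussian Y (with sqrt a' imaginary if a' < 0) and
   exchanging the integrals factorizes the integrand, and each factor is a value of
   Phi. *)
From HB Require Import structures.
Require Import Defs.
From mathcomp Require Import all_boot all_order all_algebra.
From mathcomp Require Import all_classical all_reals all_analysis.
From mathcomp Require Import measurable_realfun complex.
From mathcomp Require Import ring lra.

Set Implicit Arguments.
Unset Strict Implicit.
Unset Printing Implicit Defensive.

Import Order.TTheory GRing.Theory Num.Theory.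
Import numFieldNormedType.Exports.
Local Open Scope classical_set_scope.
Local Open Scope ring_scope.

(** * Lebesgue measure on row vectors *)

(** The condition on the edge lengths says exactly that the two polytopes share the constant b. For
    the cube put t = kappa tau^2: the facet normals give I + t J, so b = - t, while adjacent
    vertices give (1 + (d - 2) t) / (1 + d t), which is 1 + 2 C for C = - t / (1 + d t). For a
    curved simplex the lifted and normalised vertices have Gram matrix (1 - C) I + C J, whose
    inverse is proportional to I - C / (1 + d C) J; flat simplices (C = 1) need a separate argument.
    Every later positivity condition, for the square roots as well as for the convergence of the
    Gaussian integrals, follows from 1 + d C > 0.

    The function [vol] is a bare iterated integral on all sets. Tonelli and substitution are
    therefore proved for a measure that agrees with it on measurable sets; the constants they
    produce cancel in quotients of volumes.

    No contour is ever moved to reach [Phi] at imaginary arguments: the Gaussian half-line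
    transforms of exp, cos and sin solve linear differential equations, and their solutions contain
    the real integrals to which [Phi] reduces on the two axes. *)

Definition rV_display : measure_display. Proof. exact: default_measure_display. Qed.

Section row_vector_measurable.
Variables (R : realType) (n : nat).

Let coord : 'I_n -> 'rV[R]_n -> measurableTypeR R := fun i x => x 0 i.

Let rV_set0 : g_sigma_preimage coord set0.
Proof. exact: sigma_algebra0. Qed.

Let rV_setC A : g_sigma_preimage coord A -> g_sigma_preimage coord (~` A).
Proof. exact: sigma_algebraC. Qed.

Let rV_bigcup (F : _^nat) : (forall i, g_sigma_preimage coord (F i)) ->
  g_sigma_preimage coord (\bigcup_i (F i)).
Proof. exact: sigma_algebra_bigcup. Qed.

(** The product sigma-algebra, generated by the coordinates: measurability of a map into rows can
    then be checked coordinate by coordinate. *)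
HB.instance Definition _ := @isMeasurable.Build rV_display
  'rV[R]_n (g_sigma_preimage coord) rV_set0 rV_setC rV_bigcup.

Lemma measurable_coord (i : 'I_n) :
  measurable_fun setT (fun x : 'rV[R]_n => x 0 i : measurableTypeR R).
Proof.
move=> _ Y mY; rewrite setTI; apply: sub_sigma_algebra => /=.
rewrite -bigcup_seq/=; exists i => /=; first by rewrite mem_index_enum.
by exists Y => //; rewrite setTI.
Qed.

Lemma measurable_fun_rV d (T : measurableType d) (f : T -> 'rV[R]_n) :
  (forall i, measurable_fun setT (fun t => f t 0 i : measurableTypeR R)) ->
  measurable_fun setT f.
Proof.
move=> mf.
suff h : g_sigma_preimage (fun i => coord i \o f) `<=` measurable.
  move=> _ A mA; apply: h.
  by rewrite g_sigma_preimage_comp; exists A.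
apply: smallest_sub; first exact: sigma_algebra_measurable.
move=> B; rewrite -bigcup_seq => -[i _ [A mA <-]].
exact: mf.
Qed.

End row_vector_measurable.

Section row_vector_measurable_theory.
Variable R : realType.

Lemma measurable_mulmx m n (M : 'M[R]_(m, n)) :
  measurable_fun setT (fun x : 'rV[R]_m => x *m M).
Proof.
apply: measurable_fun_rV => i.
under eq_fun do rewrite mxE.
apply: measurable_sum => j.
apply: measurable_funM => //.
exact: (measurable_coord j).
Qed.

(** The same row as in the recursive clause of [vol]. *)
Definition cons_row n (t : R) (y : 'rV[R]_n) : 'rV[R]_n.+1 :=
  row_mx (t%:M : 'rV_1) y.

Lemma cons_row0 n t (y : 'rV[R]_n) : cons_row t y 0 ord0 = t.
Proof.
have tE : (t%:M : 'rV[R]_1) 0 0 = t by rewrite mxE eqxx mulr1n.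
rewrite -[RHS]tE -(@row_mxEl R 1 1 n t%:M y 0 0).
by congr (cons_row _ _ _ _); exact: val_inj.
Qed.

Lemma cons_rowS n t (y : 'rV[R]_n) i : cons_row t y 0 (lift ord0 i) = y 0 i.
Proof.
have := @row_mxEr R 1 1 n t%:M y 0 i => <-.
by congr (cons_row _ _ _ _); exact: val_inj.
Qed.

Lemma cons_row_eta n (x : 'rV[R]_n.+1) :
  cons_row (x 0 ord0) (\row_i x 0 (lift ord0 i)) = x.
Proof.
apply/rowP => i; case: (unliftP ord0 i) => [j ->|->].
  by rewrite cons_rowS mxE.
by rewrite cons_row0.
Qed.

Lemma measurable_cons_row n :
  measurable_fun setT
    (fun p : measurableTypeR R * 'rV[R]_n => cons_row p.1 p.2).
Proof.
apply: measurable_fun_rV => i; case: (unliftP ord0 i) => [j ->|->].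
  under eq_fun do rewrite cons_rowS.
  exact: (measurableT_comp (measurable_coord j)).
by under eq_fun do rewrite cons_row0; exact: measurable_fst.
Qed.

End row_vector_measurable_theory.

Section lebesgue_row_vectors.
Variable R : realType.
Local Open Scope ereal_scope.

Definition uncons_row n (x : 'rV[R]_n.+1) : measurableTypeR R * 'rV[R]_n :=
  (x 0%R ord0, \row_i x 0%R (lift ord0 i)).

Definition cons_rowp n (p : measurableTypeR R * 'rV[R]_n) : 'rV[R]_n.+1 :=
  cons_row p.1 p.2.

Lemma measurable_uncons_row n : measurable_fun setT (@uncons_row n).
Proof.
apply: measurable_fun_pair; first exact: measurable_coord.
apply: measurable_fun_rV => i; under eq_fun do rewrite mxE.
exact: measurable_coord.
Qed.

Lemma cons_rowK n : cancel (@cons_rowp n) (@uncons_row n).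
Proof.
move=> [t y]; rewrite /uncons_row cons_row0; congr (_, _).
by apply/rowP => i; rewrite mxE cons_rowS.
Qed.

Section step.
Variables (n : nat) (m : {sigma_finite_measure set 'rV[R]_n -> \bar R}).

Definition lebesgue_row_step : set 'rV[R]_n.+1 -> \bar R :=
  pushforward (@lebesgue_measure R \x m) (@cons_rowp n).

Let measurable_preimage (A : set 'rV[R]_n.+1) : measurable A ->
  measurable (@cons_rowp n @^-1` A).
Proof.
by move=> mA; rewrite -[X in measurable X]setTI; exact: measurable_cons_row.
Qed.

Let step0 : lebesgue_row_step set0 = 0.
Proof. by rewrite /lebesgue_row_step /pushforward preimage_set0 measure0. Qed.

Let step_ge0 A : 0 <= lebesgue_row_step A.
Proof. exact: (measure_ge0 (@lebesgue_measure R \x m)). Qed.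

Let step_sigma_additive : semi_sigma_additive lebesgue_row_step.
Proof.
move=> F mF tF mUF; rewrite /lebesgue_row_step /pushforward preimage_bigcup.
apply: measure_semi_sigma_additive.
- by move=> i; exact: measurable_preimage.
- apply/trivIsetP => /= i j _ _ ij; rewrite -preimage_setI.
  by move/trivIsetP : tF => /(_ _ _ _ _ ij) ->//; rewrite preimage_set0.
- by rewrite -preimage_bigcup; exact: measurable_preimage.
Qed.

HB.instance Definition _ := isMeasure.Build _ _ _ lebesgue_row_step
  step0 step_ge0 step_sigma_additive.

(** Keeps the recursion going: the product with the Lebesgue measure and Tonelli's theorem ask for
    sigma-finiteness in each dimension. *)
Let step_sigma_finite : sigma_finite setT lebesgue_row_step.
Proof.
have /sigma_finiteP[F [FT ndF mF]] := sigma_finiteT (@lebesgue_measure R).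
have /sigma_finiteP[G [GT ndG mG]] := sigma_finiteT m.
exists (fun i => @uncons_row n @^-1` (F i `*` G i)).
  rewrite -preimage_bigcup -(preimage_setT (@uncons_row n)); congr (_ @^-1` _).
  rewrite -setXTT FT GT; apply/seteqP; split => [[x y]|[x y] [i _ [/= Fx Gy]]].
    move=> [/= [i _ Fx] [j _ Gy]]; exists (maxn i j) => //; split => /=.
    - by move: x Fx; exact/subsetPset/ndF/leq_maxl.
    - by move: y Gy; exact/subsetPset/ndG/leq_maxr.
  by split; exists i.
move=> i; have [mFi Foo] := mF i; have [mGi Goo] := mG i; split.
  rewrite -[X in measurable X]setTI; apply: measurable_uncons_row => //.
  exact: measurableX.
rewrite /lebesgue_row_step /pushforward -comp_preimage.
rewrite (_ : _ \o _ = idfun); last by apply/funext => p /=; rewrite cons_rowK.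
by rewrite preimage_id product_measure1E// lte_mul_pinfty// ge0_fin_numE.
Qed.

HB.instance Definition _ := Measure_isSigmaFinite.Build _ _ _
  lebesgue_row_step step_sigma_finite.

End step.

Fixpoint lebesgue_row n : {sigma_finite_measure set 'rV[R]_n -> \bar R} :=
  match n with
  | 0 => \d_ (0%R : 'rV[R]_0)
  | n'.+1 => lebesgue_row_step (lebesgue_row n')
  end.

Lemma measurable_slice n (A : set 'rV[R]_n.+1) t : measurable A ->
  measurable [set y | A (cons_row t y)].
Proof.
move=> mA; rewrite -[X in measurable X]setTI.
have mf : measurable_fun setT (@cons_rowp n \o pair t).
  by apply: measurableT_comp; [exact: measurable_cons_row|exact: pair1_measurable].
exact: mf.
Qed.

(** Ties [vol], a function on all sets with no additivity built in, to a measure that admits Tonelli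
    and substitution. Later arguments reach [vol] only through this equality. *)
Lemma lebesgue_rowE n (A : set 'rV[R]_n) : measurable A ->
  lebesgue_row n A = vol A.
Proof.
elim: n A => [|n IH] A mA //=.
rewrite /lebesgue_row_step /pushforward /product_measure1.
apply: eq_integral => t _ /=; rewrite -IH; last exact: measurable_slice.
by congr (lebesgue_row _ _); apply/seteqP; split => y; rewrite /xsection/= inE.
Qed.

End lebesgue_row_vectors.

(** * Affine substitutions on the real line *)

Section integral_lebesgue_affine.
Variable R : realType.
Local Open Scope ereal_scope.
Local Notation mu := (@lebesgue_measure R).

Let affine (a b : R) : measurableTypeR R -> measurableTypeR R :=
  fun t => (a * t + b)%R.

Let measurable_affine a b : measurable_fun setT (affine a b).
Proof. by apply: measurable_funD => //; exact: measurable_funM. Qed.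

Let affine_image (a b : R) : {measure set (measurableTypeR R) -> \bar R}.
Proof.
unshelve refine (pushforward mu (affine a b)); exact: measurable_affine.
Defined.

(** Lebesgue measure is determined by its values on half-open intervals, and there the scaling is a
    computation. *)
Let affine_measure (a b : R) (a0 : (0 < a)%R) A : measurable A ->
  mu A = mscale (NngNum (ltW a0)) (affine_image a b) A.
Proof.
move=> mA; apply: lebesgue_measure_unique => // _ [[x y]] _ <-; rewrite [RHS](_ : _ = a%:E * mu (affine a b @^-1` `]x, y]%classic))//.
rewrite (_ : affine a b @^-1` _ = `](x - b) / a, (y - b) / a]%classic)%R; last first.
  apply/seteqP; split => t /=; rewrite !in_itv/= ltr_pdivrMr// ler_pdivlMr//;
  by rewrite ltrBlDr lerBrDr mulrC.
rewrite /= !lebesgue_measure_itv/= !lte_fin ltr_pM2r ?invr_gt0// ltrD2r.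
case: ifPn => _; last by rewrite mule0.
rewrite -!EFinB -EFinM; congr EFin.
by rewrite -mulrBl mulrCA divff ?gt_eqF// mulr1 opprB addrA subrK.
Qed.

Lemma ge0_integral_affine (a b : R) (f : R -> \bar R) : (0 < a)%R ->
  measurable_fun [set: measurableTypeR R] f -> (forall t, 0 <= f t) ->
  \int[mu]_t f t = a%:E * \int[mu]_t f (a * t + b)%R.
Proof.
move=> a0 mf f0.
rewrite (@eq_measure_integral _ _ _ _
  (mscale (NngNum (ltW a0)) (affine_image a b))); last first.
  by move=> A mA _; exact: affine_measure.
rewrite ge0_integral_mscale// /affine_image /=.
by rewrite ge0_integral_pushforward.
Qed.

Lemma ge0_integral_opp (f : R -> \bar R) :
  measurable_fun [set: measurableTypeR R] f -> (forall t, 0 <= f t) ->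
  \int[mu]_t f t = \int[mu]_t f (- t)%R.
Proof.
move=> mf f0.
rewrite (@eq_measure_integral _ _ _ _
  (pushforward mu (-%R : _ -> measurableTypeR R))); last first.
  by move=> A mA _; exact/esym/lebesgue_measureN.
by rewrite ge0_integral_pushforward.
Qed.

Lemma ge0_integral_affine_neq0 (a b : R) (f : R -> \bar R) : a != 0%R ->
  measurable_fun [set: measurableTypeR R] f -> (forall t, 0 <= f t) ->
  \int[mu]_t f t = `|a|%:E * \int[mu]_t f (a * t + b)%R.
Proof.
move=> a0 mf f0; have [a_lt0|a_gt0|/eqP] := ltgtP a 0%R; last by rewrite (negbTE a0).
  rewrite (@ge0_integral_affine (- a)%R b)// ?oppr_gt0// ltr0_norm//.
  rewrite [in LHS]ge0_integral_opp//.
    by congr (_ * _); apply: eq_integral => t _; rewrite mulrNN.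
  apply: (@measurableT_comp _ _ _ _ _ _ f _ (affine (- a) b)) => //.
  exact: measurable_affine.
by rewrite (@ge0_integral_affine a b)// gtr0_norm.
Qed.

End integral_lebesgue_affine.

(** * Tonelli and translation invariance for row vectors *)

Section integral_rV.
Variable R : realType.
Local Open Scope ereal_scope.
Local Notation mu := (@lebesgue_measure R).

Lemma integral_rV0 (f : 'rV[R]_0 -> \bar R) : measurable_fun setT f ->
  \int[lebesgue_row R 0]_x f x = f 0%R.
Proof. by move=> mf; rewrite integral_dirac// diracT mul1e. Qed.

Lemma integral_rVS n (f : 'rV[R]_n.+1 -> \bar R) : measurable_fun setT f ->
  (forall x, 0 <= f x) ->
  \int[lebesgue_row R n.+1]_x f x =
  \int[mu]_t \int[lebesgue_row R n]_y f (cons_row t y).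
Proof.
move=> mf f0.
rewrite [LHS](_ : _ = \int[pushforward (mu \x lebesgue_row R n) (@cons_rowp R n)]_x f x)//.
rewrite ge0_integral_pushforward//; last exact: measurable_cons_row.
rewrite preimage_setT.
apply: (@fubini_tonelli1 _ _ _ _ _ mu (lebesgue_row R n)) => [|p]; last exact: f0.
by apply: measurableT_comp => //; exact: measurable_cons_row.
Qed.

(** The order with the first coordinate innermost serves the lower shears, which translate that
    coordinate by an amount depending on the others. *)
Lemma integral_rVS_swap n (f : 'rV[R]_n.+1 -> \bar R) : measurable_fun setT f ->
  (forall x, 0 <= f x) ->
  \int[lebesgue_row R n.+1]_x f x =
  \int[lebesgue_row R n]_y \int[mu]_t f (cons_row t y).
Proof.
move=> mf f0; rewrite integral_rVS//.
apply: (@fubini_tonelli _ _ _ _ _ mu (lebesgue_row R n) (f \o @cons_rowp R n)) => [|p]; last exact: f0.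
by apply: measurableT_comp => //; exact: measurable_cons_row.
Qed.

Lemma measurable_addrow n (v : 'rV[R]_n) : measurable_fun setT (fun x : 'rV[R]_n => x + v)%R.
Proof.
apply: measurable_fun_rV => i; under eq_fun do rewrite mxE.
by apply: measurable_funD => //; exact: measurable_coord.
Qed.

Lemma measurable_cons_row2 n t : measurable_fun setT (fun y : 'rV[R]_n => cons_row t y).
Proof.
rewrite (_ : (fun y => _) = @cons_rowp R n \o pair t)//.
by apply: measurableT_comp; [exact: measurable_cons_row|exact: pair1_measurable].
Qed.

Lemma measurable_cons_row1 n y : 
  measurable_fun setT (fun t : measurableTypeR R => cons_row t y : 'rV[R]_n.+1).
Proof.
rewrite (_ : (fun y => _) = @cons_rowp R n \o (fun t => (t, y)))//.
by apply: measurableT_comp; [exact: measurable_cons_row|exact: pair2_measurable].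
Qed.

Lemma cons_rowD n t s (y z : 'rV[R]_n) :
  cons_row (t + s)%R (y + z)%R = (cons_row t y + cons_row s z)%R.
Proof. by rewrite /cons_row raddfD -add_row_mx. Qed.

Lemma integral_rV_translate n (v : 'rV[R]_n) (f : 'rV[R]_n -> \bar R) :
  measurable_fun setT f -> (forall x, 0 <= f x) ->
  \int[lebesgue_row R n]_x f (x + v)%R = \int[lebesgue_row R n]_x f x.
Proof.
elim: n v f => [|n IH] v f mf f0.
  by apply: eq_integral => x _; rewrite (thinmx0 (x + v)%R) (thinmx0 x).
have mfv : measurable_fun setT (fun x : 'rV[R]_n.+1 => f (x + v)%R).
  by apply: measurableT_comp => //; exact: measurable_addrow.
pose v' : 'rV[R]_n := \row_i v 0%R (lift ord0 i); pose v0 := v 0%R ord0.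
rewrite !integral_rVS//.
transitivity (\int[mu]_t \int[lebesgue_row R n]_y f (cons_row (t + v0)%R y)).
  apply: eq_integral => t _.
  rewrite -[in RHS](IH v')//; last first.
    by apply: measurableT_comp => //; exact: measurable_cons_row2.
  by apply: eq_integral => y _; rewrite cons_rowD cons_row_eta.
rewrite [RHS](@ge0_integral_affine _ 1%R v0)//.
- by rewrite mul1e; apply: eq_integral => t _; rewrite mul1r.
- apply: (@measurable_fun_fubini_tonelli_F _ _ _ _ _ (lebesgue_row R n) (f \o @cons_rowp R n)) => [|p]; last exact: f0.
  by apply: measurableT_comp => //; exact: measurable_cons_row.
- by move=> t; exact: integral_ge0.
Qed.

End integral_rV.

(** * Linear changes of variables *)

Section linear_change_of_variables.
Variable R : realType.
Local Notation mu := (@lebesgue_measure R).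

(** The factor c is |det M|^-1, but determinants are avoided: apart from scalar matrices, existence
    and positivity of c suffice, since it cancels in quotients of volumes. *)
Definition scales_integral n (M : 'M[R]_n) (c : R) : Prop :=
  0 < c /\ forall f : 'rV[R]_n -> \bar R, measurable_fun setT f ->
    (forall x, (0 <= f x)%E) ->
    (\int[lebesgue_row R n]_x f (x *m M) =
     c%:E * \int[lebesgue_row R n]_x f x)%E.

Lemma scales_integral_mul n (M N : 'M[R]_n) a b :
  scales_integral M a -> scales_integral N b ->
  scales_integral (M *m N) (a * b).
Proof.
move=> [a0 Ma] [b0 Nb]; split; first exact: mulr_gt0.
move=> f mf f0; under eq_integral do rewrite mulmxA.
rewrite (Ma (fun x => f (x *m N)))//; last first.
  by apply: measurableT_comp => //; exact: measurable_mulmx.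
by rewrite Nb// EFinM muleA.
Qed.

Lemma cons_row_mul n t (y : 'rV[R]_n) a (v : 'rV[R]_n) (w : 'cV[R]_n) (M : 'M[R]_n) :
  cons_row t y *m (block_mx a%:M v w M : 'M[R]_(1 + n)) =
  cons_row (t * a + (y *m w) 0 0) (t *: v + y *m M).
Proof.
rewrite /cons_row (@mul_row_block _ 1 1 n 1 n); congr row_mx.
  by rewrite -scalar_mxM; apply/rowP => i; rewrite !ord1 !mxE eqxx !mulr1n.
by rewrite mul_scalar_mx.
Qed.

(** For a fixed first coordinate the shear is a translation of the remaining ones. *)
Lemma scales_integral_upper n (v : 'rV[R]_n) :
  scales_integral (block_mx 1 v 0 1%:M : 'M[R]_(1 + n)) 1.
Proof.
split => // f mf f0.
rewrite mul1e [RHS]integral_rVS// [LHS]integral_rVS//; last first.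
  by apply: measurableT_comp => //; exact: measurable_mulmx.
apply: eq_integral => t _.
rewrite -[RHS](integral_rV_translate (t *: v))//; last first.
  by apply: measurableT_comp => //; exact: measurable_cons_row2.
apply: eq_integral => y _.
by rewrite cons_row_mul mulr1 mulmx0 mxE addr0 mulmx1 addrC.
Qed.

Lemma scales_integral_lower n (w : 'cV[R]_n) :
  scales_integral (block_mx 1 0 w 1%:M : 'M[R]_(1 + n)) 1.
Proof.
split => // f mf f0.
rewrite mul1e [RHS]integral_rVS_swap// [LHS]integral_rVS_swap//; last first.
  by apply: measurableT_comp => //; exact: measurable_mulmx.
apply: eq_integral => y _.
rewrite [RHS](@ge0_integral_affine _ 1 ((y *m w) 0 0))//; last first.
  by apply: measurableT_comp => //; exact: measurable_cons_row1.
rewrite mul1e; apply: eq_integral => t _.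
by rewrite cons_row_mul mulr1 mul1r scaler0 add0r mulmx1.
Qed.

Lemma scales_integral_diag n (a : R) (M : 'M[R]_n) c : a != 0 ->
  scales_integral M c ->
  scales_integral (block_mx a%:M 0 0 M : 'M[R]_(1 + n)) (`|a|^-1 * c).
Proof.
move=> a0 [c0 Mc]; split; first by rewrite mulr_gt0// invr_gt0 normr_gt0.
move=> f mf f0.
rewrite [in RHS]integral_rVS// [LHS]integral_rVS//; last first.
  by apply: measurableT_comp => //; exact: measurable_mulmx.
pose F (t : measurableTypeR R) : \bar R :=
  (\int[lebesgue_row R n]_y f (cons_row t y))%E.
have mF : measurable_fun setT F.
  apply: (@measurable_fun_fubini_tonelli_F _ _ _ _ _ (lebesgue_row R n)
    (f \o @cons_rowp R n)) => [|p]; last exact: f0.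
  by apply: measurableT_comp => //; exact: measurable_cons_row.
have F0 t : (0 <= F t)%E by exact: integral_ge0.
pose g (t : measurableTypeR R) : measurableTypeR R := a * t + 0.
have mg : measurable_fun setT g.
  by apply: measurable_funD => //; exact: measurable_funM.
have mFg : measurable_fun setT (F \o g) by exact: measurableT_comp.
transitivity (\int[mu]_t (c%:E * (F \o g) t))%E.
  apply: eq_integral => t _.
  rewrite /F /g /= -(Mc (fun y => f (cons_row (a * t + 0) y)))//; last first.
    by apply: measurableT_comp => //; exact: measurable_cons_row2.
  apply: eq_integral => y _.
  by rewrite cons_row_mul mulmx0 mxE scaler0 add0r mulrC.
have gFg0 : (forall t, setT t -> 0 <= (F \o g) t)%E by move=> t _; exact: F0.
have c0' : (0 <= c%:E)%E by rewrite lee_fin ltW.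
rewrite (ge0_integralZl _ measurableT mFg gFg0 c0').
rewrite [in RHS](@ge0_integral_affine_neq0 _ a 0 F a0 mF F0).
by rewrite muleA -EFinM mulrAC mulVf ?mul1r// normr_eq0.
Qed.

(** Gaussian elimination: with a nonzero pivot, M is a lower shear times a block diagonal matrix
    times an upper shear, and the induction hypothesis applies to the Schur complement [M']. *)
Lemma unitmx_scales_integral n (M : 'M[R]_n) : M \in unitmx ->
  exists c, scales_integral M c.
Proof.
elim: n M => [|n IH] M Mu.
  exists 1; split=> // f mf f0; rewrite mul1e.
  by apply: eq_integral => x _; rewrite (thinmx0 (x *m M)) (thinmx0 x).
wlog M00 : M Mu / M 0 0 != 0.
  move=> H; have [M00|] := eqVneq (M 0 0) 0; last exact: H.
  (* a row operation brings a nonzero entry into the pivot position *)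
  have [i Mi0] : exists i, M (lift ord0 i) 0 != 0.
    apply: contrapT => /forallNP Mi.
    have : col 0 M = 0.
      apply/colP => i; rewrite !mxE; case: (unliftP ord0 i) => [j ->|->//].
      by apply/eqP; rewrite -[_ == _]negbK; apply/negP/Mi.
    move=> /(congr1 (mulmx (invmx M))); rewrite colE mulmxA mulVmx// mul1mx mulmx0.
    by move=> /colP/(_ 0) /eqP; rewrite !mxE eqxx oner_eq0.
  pose U : 'M[R]_n.+1 := block_mx 1 (delta_mx 0 i) 0 1%:M : 'M[R]_(1 + n).
  pose V : 'M[R]_n.+1 := block_mx 1 (- delta_mx 0 i) 0 1%:M : 'M[R]_(1 + n).
  have VU : V *m U = 1%:M.
    rewrite /V /U (@mulmx_block _ 1 n 1 n 1 n) !mul1mx !mulmx1 !mul0mx !mulmx0.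
    by rewrite !addr0 add0r subrr -scalar_mx_block.
  have UM00 : (U *m M) 0 0 != 0.
    suff -> : (U *m M) 0 0 = M (lift ord0 i) 0 by [].
    rewrite -[in LHS](@submxK _ 1 n 1 n M) /U (@mulmx_block _ 1 n 1 n 1 n).
    rewrite !mul1mx -rowE.
    set B := block_mx _ _ _ _; have -> : B 0 0 = B (lshift n 0) (lshift n 0).
      by congr (B _ _); exact: val_inj.
    rewrite block_mxEul !mxE.
    have -> : lshift n (0 : 'I_1) = 0 by exact: val_inj.
    rewrite M00 add0r (_ : rshift 1 i = lift ord0 i)//; exact: val_inj.
  have [c UMc] : exists c, scales_integral (U *m M) c.
    apply: H => //; rewrite unitmx_mul Mu andbT.
    by have := unitmx1 R n.+1; rewrite -VU unitmx_mul => /andP[].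
  exists (1 * c); rewrite -[M]mul1mx -VU -mulmxA.
  exact: scales_integral_mul (scales_integral_upper _) UMc.
pose a := M 0 0; pose v : 'rV[R]_n := @ursubmx _ 1 n 1 n M.
pose w : 'cV[R]_n := @dlsubmx _ 1 n 1 n M.
pose M' : 'M[R]_n := @drsubmx _ 1 n 1 n M - a^-1 *: (w *m v).
have ME : M = (block_mx 1 0 (a^-1 *: w) 1%:M : 'M[R]_(1 + n)) *m
   ((block_mx a%:M 0 0 M' : 'M[R]_(1 + n)) *m (block_mx 1 (a^-1 *: v) 0 1%:M : 'M[R]_(1 + n))).
  rewrite !(@mulmx_block _ 1 n 1 n 1 n).
  rewrite !(mul1mx, mulmx1, mul0mx, mulmx0, addr0, add0r).
  rewrite -[LHS](@submxK _ 1 n 1 n M).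
  have aE : @ulsubmx _ 1 n 1 n M = a%:M.
    apply/rowP => i; rewrite !ord1 [RHS]mxE eqxx mulr1n !mxE /a.
    by congr (M _ _); exact: val_inj.
  rewrite mul_scalar_mx scalerA divff// scale1r mul_mx_scalar scalerA divff// scale1r.
  rewrite /M' -scalemxAl addrCA subrr addr0 aE.
  by [].
have M'u : M' \in unitmx.
  move: Mu; rewrite {1}ME !unitmx_mul => /andP[_ /andP[+ _]].
  by rewrite unitmxE (@det_ublock _ 1 n) unitrM => /andP[_].
have [c M'c] := IH _ M'u.
exists (1 * ((`|a|^-1 * c) * 1)); rewrite ME.
apply: scales_integral_mul; first exact: scales_integral_lower.
apply: scales_integral_mul; last exact: scales_integral_upper.
exact: scales_integral_diag.
Qed.

End linear_change_of_variables.

(** * Half-line Gaussian transforms *)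

Section half_line_transforms.
Variable R : realType.
Local Notation mu := (@lebesgue_measure R).
Local Notation g := (fun x : R => expR (- x ^+ 2 / 2)).
Local Notation H := (`[0, +oo[%classic : set R).

Lemma is_derive_gauss (x : R) (c : R) :
  is_derive x 1 (fun x => expR (c * x ^+ 2)) (expR (c * x ^+ 2) * (c * (x + x))).
Proof.
apply: (is_derive1_comp (f := expR) (g := fun x => c * x ^+ 2)).
apply: is_derive_eq (is_deriveZ c (is_deriveM (is_derive_id x 1) (is_derive_id x 1))) _.
by rewrite /GRing.scale/= mulr1.
Qed.

Lemma is_derive_scale (f df : R -> R) (t x : R) :
  (forall y : R, is_derive y 1 f (df y)) ->
  is_derive x 1 (fun x => f (t * x)) (t * df (t * x)).
Proof.
move=> h; rewrite mulrC.
apply: (is_derive1_comp (f := f) (g := fun x => t * x)).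
apply: is_derive_eq (is_deriveZ t (is_derive_id x 1)) _.
by rewrite /GRing.scale/= mulr1.
Qed.

Lemma is_derive_continuousT (f df : R -> R) :
  (forall x : R, is_derive x 1 f (df x)) -> continuous f.
Proof.
by move=> h x; apply: differentiable_continuous; apply/derivable1_diffP; case: (h x).
Qed.

Lemma continuous_gauss (c : R) : continuous (fun x : R => expR (c * x ^+ 2)).
Proof. exact: is_derive_continuousT (fun x => is_derive_gauss x c). Qed.

Lemma measurable_gauss (c : R) : measurable_fun setT (fun x : R => expR (c * x ^+ 2)).
Proof. by apply: continuous_measurable_fun; exact: continuous_gauss. Qed.

Lemma halfNE (x : R) : - x ^+ 2 / 2 = - 2^-1 * x ^+ 2.
Proof. by rewrite mulNr mulrC mulNr. Qed.

Lemma integrable_gauss (c : R) : c < 0 ->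
  mu.-integrable setT (EFin \o (fun x : R => expR (c * x ^+ 2))).
Proof.
move=> c0; pose s := Num.sqrt (- c).
have s0 : 0 < s by rewrite sqrtr_gt0 oppr_gt0.
apply/integrableP; split; first by apply/measurable_EFinP; exact: measurable_gauss.
have gE (x : R) : expR (c * x ^+ 2) = gauss_fun (s * x + 0).
  by rewrite /gauss_fun addr0 exprMn sqr_sqrtr ?mulNr ?opprK// oppr_ge0 ltW.
have := @integralT_gauss R.
rewrite (@ge0_integral_affine R s 0 (EFin \o gauss_fun))//; last 2 first.
- by apply/measurable_EFinP; exact: measurable_gauss_fun.
- by move=> t; rewrite lee_fin gauss_fun_ge0.
under eq_integral do rewrite /= -gE.
under [in X in _ -> X]eq_integral do rewrite /= ger0_norm ?expR_ge0//.
case: (\int[_]_t _)%E => [r _| |]; first exact: ltry.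
  by rewrite gt0_muley.
by rewrite gt0_muleNy.
Qed.

(** By (|x| / 2 - T)^2 >= 0 the linear exponent costs only half of the Gaussian decay: the integrand
    is at most exp (T^2) exp (- x^2 / 4). *)
Lemma integrable_gauss_exp (T : R) :
  mu.-integrable setT (EFin \o (fun x : R => expR (- 2^-1 * x ^+ 2 + T * `|x|))).
Proof.
have := @integrable_gauss (- 4^-1).
rewrite oppr_lt0 invr_gt0 ltr0n => /(_ isT) h.
apply: (@le_integrable _ _ _ mu setT measurableT _
   (EFin \o (fun x : R => expR (T ^+ 2) * expR (- 4^-1 * x ^+ 2)))).
- apply/measurable_EFinP; apply: measurableT_comp => //; apply: measurable_funD.
    by apply: measurable_funM => //.
  by apply: measurable_funM => //; exact: measurableT_comp.
- move=> x _ /=; rewrite !lee_fin -expRD !(ger0_norm (expR_ge0 _)) ler_expR.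
  have : 0 <= (`|x| / 2 - T) ^+ 2 by exact: sqr_ge0.
  by rewrite -[x ^+ 2]real_normK ?num_real//; set a := `|x|; nra.
- have := @integrableZl _ _ _ mu setT measurableT (expR (T ^+ 2)) _ h.
  by apply: eq_integrable => // x _; rewrite /= EFinM.
Qed.

(** Since f may change sign, the passage from the segments [0, n + 1] to the half-line uses
    dominated convergence, with |f| as the bound. *)
Lemma Rintegral_FTC2y (F f : R -> R) (l : R) :
  (forall x : R, is_derive x 1 F (f x)) -> continuous f ->
  mu.-integrable H (EFin \o f) -> F x @[x --> +oo] --> l ->
  \int[mu]_(x in H) f x = l - F 0.
Proof.
move=> dF cf fi Fl.
have mH : measurable H by [].
pose f_ (n : nat) := (EFin \o f) \_ (`[0, n.+1%:R]%classic).
have If_ n : (\int[mu]_(x in H) f_ n x = (F n.+1%:R - F 0)%:E)%E.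
  rewrite /f_ -integral_mkcondr.
  rewrite (_ : H `&` _ = `[0, n.+1%:R]%classic); last first.
    apply/seteqP; split => x /=; rewrite !in_itv/= ?andbT; first by case.
    by move=> /andP[-> ->].
  rewrite (@continuous_FTC2 _ f F)//.
  - exact: continuous_subspaceT.
  - split; [by move=> x _; case: (dF x)| |].
    + by apply: cvg_at_right_filter; exact: (is_derive_continuousT dF).
    + by apply: cvg_at_left_filter; exact: (is_derive_continuousT dF).
  - by move=> x _; rewrite derive1E; case: (dF x).
have mf : measurable_fun H (EFin \o f).
  by apply/measurable_EFinP; apply: measurable_funTS; exact: continuous_measurable_fun.
have h1 n : measurable_fun H (f_ n).
  by apply/measurable_restrict => //; exact: measurable_funS mf.
have h2 : {ae mu, forall x, H x -> f_ ^~ x @ \oo --> (EFin \o f) x}.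
  apply: aeW => x Hx; apply: cvg_near_cst.
  near=> n; rewrite /f_ patchE mem_set//= in_itv/=.
  move: Hx; rewrite /= in_itv/= andbT => ->/=.
  rewrite (@le_trans _ _ n%:R) ?ler_nat//.
  by near: n; exact: nbhs_infty_ger.
have h3 : mu.-integrable H (abse \o (EFin \o f)) by exact: integrable_abse.
have h5 : {ae mu, forall x n, H x -> (`|f_ n x| <= (abse \o (EFin \o f)) x)%E}.
  apply: aeW => x n Hx; rewrite /f_ patchE; case: ifPn => // _.
  by rewrite abse0 abse_ge0.
have [_ _ fcvg] := @dominated_convergence _ _ _ mu H mH f_ _ _ h1 mf h2 h3 h5.
have {}fcvg : (F n.+1%:R - F 0)%:E @[n --> \oo] --> (\int[mu]_(x in H) (EFin \o f) x)%E.
  by move: fcvg; under eq_fun do rewrite If_.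
have Fcvg : (F n.+1%:R - F 0)%:E @[n --> \oo] --> (l - F 0)%:E.
  apply: cvg_EFin; first exact: nearW.
  apply: cvgB; last exact: cvg_cst.
  move/cvg_pinftyP : Fl => /(_ (fun n => n.+1%:R)); apply.
  by rewrite (cvg_shiftS (fun n => n%:R : R)); exact: cvgr_idn.
by rewrite /Rintegral (cvg_unique _ fcvg Fcvg).
Unshelve. all: by end_near. Qed.

(* [half_transform phi] solves the linear equation K' = psi 0 + s t K; taking s = 1 with
   exp, and s = -1 with cos and sin, handles real and imaginary arguments of [Phi] alike. *)
Variables (phi psi : R -> R) (s : R).
Hypothesis dphi : forall x : R, is_derive x 1 phi (psi x).
Hypothesis dpsi : forall x : R, is_derive x 1 psi (s * phi x).
Hypothesis phi_le : forall x, `|phi x| <= expR `|x|.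
Hypothesis psi_le : forall x, `|psi x| <= expR `|x|.

Definition half_transform (f : R -> R) (t : R) : R :=
  \int[mu]_(x in H) (expR (- 2^-1 * x ^+ 2) * f (t * x)).

Lemma integrable_gauss_le (f : R -> R) (T : R) (D : set R) : measurable D ->
  measurable_fun D f ->
  (forall x, D x -> `|f x| <= expR (- 2^-1 * x ^+ 2 + T * `|x|)) ->
  mu.-integrable D (EFin \o f).
Proof.
move=> mD mf fT.
apply: (@le_integrable _ _ _ mu D mD _
    (EFin \o (fun x : R => expR (- 2^-1 * x ^+ 2 + T * `|x|)))).
- exact/measurable_EFinP.
- by move=> x Dx /=; rewrite lee_fin (ger0_norm (expR_ge0 _)) fT.
- exact: integrableS (integrable_gauss_exp T).
Qed.

Let cphi : continuous phi. Proof. exact: is_derive_continuousT dphi. Qed.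
Let cpsi : continuous psi. Proof. exact: is_derive_continuousT dpsi. Qed.

Let continuous_scale (f : R -> R) (t : R) : continuous f ->
  continuous (fun x : R => f (t * x)).
Proof.
move=> cf x; apply: continuous_comp; last exact: cf.
by apply: cvgM => //; exact: cvg_cst.
Qed.

Lemma integrable_half_transform (f : R -> R) t : continuous f ->
  (forall x, `|f x| <= expR `|x|) ->
  mu.-integrable H (EFin \o (fun x => expR (- 2^-1 * x ^+ 2) * f (t * x))).
Proof.
move=> cf f_le; apply: (@integrable_gauss_le _ `|t|) => //.
- apply: measurable_funTS; apply: measurable_funM.
    exact: measurable_gauss.
  by apply: continuous_measurable_fun; exact: continuous_scale.
- move=> x _; rewrite normrM (ger0_norm (expR_ge0 _)) expRD ler_pM2l ?expR_gt0//.
  by rewrite -normrM f_le.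
Qed.

Lemma integrable_half_transformX (f : R -> R) t : continuous f ->
  (forall x, `|f x| <= expR `|x|) ->
  mu.-integrable H (EFin \o (fun x => expR (- 2^-1 * x ^+ 2) * (x * f (t * x)))).
Proof.
move=> cf f_le; apply: (@integrable_gauss_le _ (1 + `|t|)) => //.
- apply: measurable_funTS; apply: measurable_funM.
    exact: measurable_gauss.
  apply: measurable_funM => //.
  by apply: continuous_measurable_fun; exact: continuous_scale.
- move=> x _; rewrite normrM (ger0_norm (expR_ge0 _)) expRD ler_pM2l ?expR_gt0//.
  rewrite normrM mulrDl mul1r expRD ler_pM//.
    by apply: le_trans (expR_ge1Dx _); rewrite lerDr.
  by rewrite -normrM f_le.
Qed.

(** The function - exp (- x^2 / 2) psi (t x) is a primitive of the difference of the two integrands.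
    It tends to 0 at infinity, and its value at 0 is the source of [psi 0]. *)
Lemma half_transform_by_parts t :
  \int[mu]_(x in H) (expR (- 2^-1 * x ^+ 2) * (x * psi (t * x))) =
  psi 0 + s * t * half_transform phi t.
Proof.
pose F x := - (expR (- 2^-1 * x ^+ 2) * psi (t * x)).
pose f x := expR (- 2^-1 * x ^+ 2) * (x * psi (t * x)) -
  s * t * (expR (- 2^-1 * x ^+ 2) * phi (t * x)).
have dF x : is_derive x (1 : R) F (f x).
  apply: is_derive_eq (is_deriveN (is_deriveM (is_derive_gauss x (- 2^-1))
    (is_derive_scale t x dpsi))) _.
  by rewrite /f /GRing.scale/=; field.
have cf : continuous f.
  move=> x; apply: cvgB.
    apply: cvgM; first exact: continuous_gauss.
    by apply: cvgM => //; exact: continuous_scale.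
  apply: cvgM; first exact: cvg_cst.
  apply: cvgM; first exact: continuous_gauss.
  exact: continuous_scale.
have mH : measurable (H : set (measurableTypeR R)) by [].
have i1 := integrable_half_transformX t cpsi psi_le.
have i2 := integrable_half_transform t cphi phi_le.
have i3 : mu.-integrable H (EFin \o (fun x => s * t * (expR (- 2^-1 * x ^+ 2) * phi (t * x)))).
  have := @integrableZl _ _ _ mu H mH (s * t) _ i2.
  by apply: eq_integrable => // x _; rewrite /= -EFinM.
have fi : mu.-integrable H (EFin \o f).
  have := @integrableB _ _ _ mu H mH _ _ i1 i3.
  by apply: eq_integrable => // x _.
have Fl : F x @[x --> +oo] --> 0.
  (* From (x - (|t| + 1))^2 >= 0: for x >= 0 the Gaussian times exp (|t| x) is at most exp c exp (-
     x). *)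
  pose c := (`|t| + 1) ^+ 2 / 2.
  have e0 : expR c * expR (- x) @[x --> +oo] --> 0.
    by rewrite -[X in _ --> X](mulr0 (expR c)); apply: cvgM; [exact: cvg_cst|exact: cvgr_expR].
  apply: (@squeeze_cvgr _ _ _ _ (fun x => - (expR c * expR (- x))) (fun x => expR c * expR (- x))) => //.
    near=> x; rewrite -ler_norml normrN normrM (ger0_norm (expR_ge0 _)).
    apply: (@le_trans _ _ (expR (- 2^-1 * x ^+ 2) * expR `|t * x|)).
      by rewrite ler_pM2l ?expR_gt0.
    rewrite -!expRD ler_expR normrM.
    have x0 : 0 <= x by near: x; exact: nbhs_pinfty_ge.
    rewrite (ger0_norm x0) /c.
    have : 0 <= (x - (`|t| + 1)) ^+ 2 by exact: sqr_ge0.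
    by set a := `|t|; nra.
  by rewrite -oppr0; apply: cvgN.
have := Rintegral_FTC2y dF cf fi Fl.
rewrite /F expr0n mulr0 mulr0 expR0 mul1r opprK add0r.
rewrite /f RintegralB// RintegralZl// => <-.
by rewrite subrK.
Unshelve. all: by end_near. Qed.

(** Differentiating under the integral brings down a factor x, which integration by parts converts
    back into the transform itself. *)
Lemma is_derive_half_transform t :
  is_derive t (1 : R) (half_transform phi) (psi 0 + s * t * half_transform phi t).
Proof.
pose f (t x : R) := expR (- 2^-1 * x ^+ 2) * phi (t * x).
have df (r x : R) : is_derive r (1 : R) (f ^~ x) (expR (- 2^-1 * x ^+ 2) * (x * psi (r * x))).
  by apply: is_derive_eq; rewrite /GRing.scale/= mulr0 add0r mulr1; ring.
pose T := `|t| + 1.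
(* A bound uniform in |r - t| < 1: there |r| <= T, and the extra factor x is absorbed by |x| <= exp
   |x|. *)
pose G x := expR (- 2^-1 * x ^+ 2 + (1 + T) * `|x|).
have mH : measurable (H : set (measurableTypeR R)) by [].
have It : `]t - 1, t + 1[%classic t by rewrite /= in_itv/= ltrBlDr !ltrDl ltr01.
have intf r : `]t - 1, t + 1[%classic r -> mu.-integrable H (EFin \o f r).
  by move=> _; exact: integrable_half_transform.
have derf r x : `]t - 1, t + 1[%classic r -> H x -> derivable (f ^~ x) r 1.
  by move=> _ _; case: (df r x).
have partialE r x : partial1of2 f r x = expR (- 2^-1 * x ^+ 2) * (x * psi (r * x)).
  by rewrite partial1of2E; case: (df r x).
have G0 x : 0 <= G x by exact: expR_ge0.
have Gi : mu.-integrable H (EFin \o G) by exact: integrableS (integrable_gauss_exp _).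
have Gub r x : `]t - 1, t + 1[%classic r -> H x -> `|partial1of2 f r x| <= G x.
  rewrite /= !in_itv/= => /andP[r1 r2] _.
  rewrite partialE normrM (ger0_norm (expR_ge0 _)) /G expRD ler_pM2l ?expR_gt0//.
  rewrite normrM mulrDl mul1r expRD ler_pM//.
    by apply: le_trans (expR_ge1Dx _); rewrite lerDr.
  apply: le_trans (psi_le _) _; rewrite ler_expR normrM ler_wpM2r//.
  rewrite /T; have := ler_norm t; have := ler_norm (- t); rewrite normrN => t1 t2.
  by rewrite ler_norml; apply/andP; split; lra.
have dK := @derivable_under_integral R _ _ mu f H mH t (t - 1) (t + 1) It intf derf G G0 Gi Gub.
have eK := @differentiation_under_integral R _ _ mu f H mH t (t - 1) (t + 1) It intf derf G G0 Gi Gub.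
apply: DeriveDef; first exact: dK.
rewrite -derive1E eK -half_transform_by_parts.
by apply: eq_Rintegral => x _; exact: partialE.
Qed.

(** The integral of exp (c v^2) for v from 0 to t, over the fixed segment [0, 1] as in [Phi];
    negative t then needs no orientation convention. *)
Definition gauss_primitive (c t : R) : R :=
  \int[mu]_(u in `[0, 1]) (t * expR (c * (u * t) ^+ 2)).

Lemma gauss_primitive0 c : gauss_primitive c 0 = 0.
Proof.
rewrite /gauss_primitive; under eq_Rintegral do rewrite mul0r.
by rewrite Rintegral_cst// mul0r.
Qed.

Lemma continuous_gauss_scale c t : continuous (fun u : R => expR (c * (u * t) ^+ 2)).
Proof.
move=> u; apply: (@continuous_comp _ _ _ (fun u : R => u * t) (fun x : R => expR (c * x ^+ 2))).
  by apply: cvgM => //; exact: cvg_cst.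
exact: continuous_gauss.
Qed.

(** The t-derivative of the integrand is also the u-derivative of u exp (c (u t)^2), so after
    differentiation under the integral the fundamental theorem over [0, 1] gives the value. *)
Lemma is_derive_gauss_primitive c t :
  is_derive t (1 : R) (gauss_primitive c) (expR (c * t ^+ 2)).
Proof.
pose f (t u : R) := t * expR (c * (u * t) ^+ 2).
pose f' (t u : R) := expR (c * (u * t) ^+ 2) * (1 + 2 * c * (u * t) ^+ 2).
have dexp (r u : R) : is_derive r (1 : R) (fun r => expR (c * (u * r) ^+ 2))
    (u * (expR (c * (u * r) ^+ 2) * (c * (u * r + u * r)))).
  exact: (is_derive_scale u r (fun x => is_derive_gauss x c)).
have df (r u : R) : is_derive r (1 : R) (f ^~ u) (f' r u).
  apply: is_derive_eq (is_deriveM (is_derive_id r 1) (dexp r u)) _.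
  by rewrite /f' /GRing.scale/=; ring.
pose T := `|t| + 1.
pose M := expR (`|c| * T ^+ 2) * (1 + 2 * `|c| * T ^+ 2).
pose I01 := `[0, 1]%classic : set R.
have mI : measurable (I01 : set (measurableTypeR R)) by exact: measurable_itv.
have It : `]t - 1, t + 1[%classic t by rewrite /= in_itv/= ltrBlDr !ltrDl ltr01.
have cf r : continuous (f r).
  by move=> u; apply: cvgM; [exact: cvg_cst|exact: continuous_gauss_scale].
have cf' r : continuous (f' r).
  move=> u; apply: cvgM; first exact: continuous_gauss_scale.
  apply: cvgD; first exact: cvg_cst.
  apply: cvgM; first exact: cvg_cst.
  apply: (@continuous_comp _ _ _ (fun u : R => u * r) (fun x : R => x ^+ 2)).
    by apply: cvgM => //; exact: cvg_cst.
  exact: exprn_continuous.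
have intf r : `]t - 1, t + 1[%classic r -> mu.-integrable I01 (EFin \o f r).
  move=> _; apply: continuous_compact_integrable; first exact: segment_compact.
  exact: continuous_subspaceT.
have derf r u : `]t - 1, t + 1[%classic r -> I01 u -> derivable (f ^~ u) r 1.
  by move=> _ _; case: (df r u).
have partialE r u : partial1of2 f r u = f' r u.
  by rewrite partial1of2E; case: (df r u).
have T0 : 0 <= T by rewrite addr_ge0.
have M0 (u : R) : 0 <= (cst M) u.
  by rewrite mulr_ge0 ?expR_ge0// addr_ge0// !mulr_ge0// sqr_ge0.
have Mi : mu.-integrable I01 (EFin \o cst M).
  apply: continuous_compact_integrable; first exact: segment_compact.
  by apply: continuous_subspaceT; exact: cst_continuous.
have Mub r u : `]t - 1, t + 1[%classic r -> I01 u -> `|partial1of2 f r u| <= cst M u.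
  rewrite /I01 /= !in_itv/= => /andP[r1 r2] /andP[u0 u1].
  rewrite partialE normrM (ger0_norm (expR_ge0 _)) /M.
  have rT : `|r| <= T.
    rewrite /T; have := ler_norm t; have := ler_norm (- t); rewrite normrN => t1 t2.
    by rewrite ler_norml; apply/andP; split; lra.
  have ur2 : (u * r) ^+ 2 <= T ^+ 2.
    rewrite -real_normK ?num_real// lerXn2r ?nnegrE// normrM (ger0_norm u0).
    by apply: le_trans rT; rewrite ler_piMl.
  have cur : `|c * (u * r) ^+ 2| <= `|c| * T ^+ 2.
    by rewrite normrM (ger0_norm (sqr_ge0 _)) ler_wpM2l.
  rewrite ler_pM ?expR_ge0//.
    by rewrite ler_expR; apply: le_trans cur; exact: ler_norm.
  rewrite -!mulrA; apply: le_trans (ler_normD _ _) _.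
  by rewrite normr1 lerD2l normrM ger0_norm// ler_wpM2l.
have dK := @derivable_under_integral R _ _ mu f I01 mI t (t - 1) (t + 1) It intf derf _ M0 Mi Mub.
have eK := @differentiation_under_integral R _ _ mu f I01 mI t (t - 1) (t + 1) It intf derf _ M0 Mi Mub.
apply: DeriveDef; first exact: dK.
rewrite -derive1E eK.
pose F (u : R) := u * expR (c * (u * t) ^+ 2).
have dF (u : R) : is_derive u (1 : R) F (f' t u).
  have h : is_derive u (1 : R) (fun u => expR (c * (u * t) ^+ 2))
      (t * (expR (c * (t * u) ^+ 2) * (c * (t * u + t * u)))).
    have -> : (fun u => expR (c * (u * t) ^+ 2)) = (fun u => expR (c * (t * u) ^+ 2)).
      by apply/funext => y; rewrite [y * t]mulrC.
    exact: dexp.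
  apply: is_derive_eq (is_deriveM (is_derive_id u 1) h) _.
  by rewrite /f' /GRing.scale/= [t * u]mulrC; ring.
transitivity (\int[mu]_(u in I01) f' t u); first exact: eq_Rintegral.
rewrite /Rintegral (@continuous_FTC2 _ (f' t) F 0 1 ltr01)//.
- by rewrite /F mul1r mul0r /= subr0 mul1r.
- exact: continuous_subspaceT.
- split; [by move=> x _; case: (dF x)| |].
  + by apply: cvg_at_right_filter; exact: (is_derive_continuousT dF).
  + by apply: cvg_at_left_filter; exact: (is_derive_continuousT dF).
- by move=> x _; rewrite derive1E; case: (dF x).
Qed.

Lemma integral_half_gauss :
  (\int[mu]_(x in H) (expR (- 2^-1 * x ^+ 2))%:E = (Num.sqrt (2 * pi) / 2)%:E)%E.
Proof.
pose r : R := (Num.sqrt 2)^-1.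
have r0 : 0 < r by rewrite invr_gt0 sqrtr_gt0 ltr0n.
have mH : measurable (H : set (measurableTypeR R)) by [].
have mg : measurable_fun [set: measurableTypeR R] ((EFin \o gauss_fun) \_ H).
  apply/(measurable_restrictT _ mH); apply/measurable_EFinP.
  by apply: measurable_funTS; exact: measurable_gauss_fun.
have := @integral0y_gauss R.
rewrite integral_mkcond (@ge0_integral_affine R r 0)//; last first.
  by move=> t; rewrite erestrict_ge0// => x _; rewrite lee_fin gauss_fun_ge0.
rewrite (_ : (fun t => _) = (fun x => (expR (- 2^-1 * x ^+ 2))%:E) \_ H); last first.
  have inH (y : R) : (y \in H) = (0 <= y).
    by apply/idP/idP => [/set_mem|y0]; [|apply/mem_set]; rewrite /= in_itv/= andbT.
  apply/funext => x; rewrite /patch addr0 !inH /=.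
  rewrite (pmulr_rge0 _ r0) /gauss_fun exprMn /r exprVn sqr_sqrtr// mulNr.
  by case: ifP.
rewrite -integral_mkcond => h.
have : (r^-1%:E * (r%:E * \int[mu]_(x in H) (expR (- 2^-1 * x ^+ 2))%:E) =
   r^-1%:E * (Num.sqrt pi / 2)%:E)%E by rewrite h.
rewrite muleA -EFinM mulVf ?gt_eqF// mul1e => ->.
by rewrite /r invrK -EFinM mulrA -sqrtrM.
Qed.

(** Variation of constants: after multiplication by the integrating factor exp (- s t^2 / 2) and
    subtraction of the primitive of the inhomogeneous term, the derivative is 0. The value at t = 0
    is [phi 0] times half of the Gaussian mass. *)
Lemma half_transformE t : half_transform phi t =
  expR (s / 2 * t ^+ 2) *
  (phi 0 * (Num.sqrt (2 * pi) / 2) + psi 0 * gauss_primitive (- (s / 2)) t).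
Proof.
pose U t := half_transform phi t * expR (- (s / 2) * t ^+ 2) -
  psi 0 * gauss_primitive (- (s / 2)) t.
have dU (x : R) : is_derive x (1 : R) U 0.
  apply: is_derive_eq (is_deriveB (is_deriveM (is_derive_half_transform x)
    (is_derive_gauss x (- (s / 2)))) (is_deriveZ (psi 0) (is_derive_gauss_primitive (- (s / 2)) x))) _.
  by rewrite /GRing.scale/=; field.
have U0 : U 0 = phi 0 * (Num.sqrt (2 * pi) / 2).
  rewrite /U gauss_primitive0 mulr0 subr0 expr0n mulr0 expR0 mulr1 /half_transform.
  under eq_Rintegral do rewrite mul0r mulrC.
  rewrite RintegralZl//.
    by rewrite /Rintegral integral_half_gauss.
  have c0 : - 2^-1 < 0 :> R by rewrite oppr_lt0 invr_gt0 ltr0n.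
  exact: integrableS (integrable_gauss c0).
have := is_derive_0_is_cst t 0 dU; rewrite U0 /U => /eqP.
rewrite subr_eq => /eqP <-.
by rewrite mulrCA -expRD mulNr subrr expR0 mulr1.
Qed.

End half_line_transforms.

Section concrete_transforms.
Variable R : realType.

Lemma half_transform_expR (t : R) : half_transform expR t =
  expR (2^-1 * t ^+ 2) * (Num.sqrt (2 * pi) / 2 + gauss_primitive (- 2^-1) t).
Proof.
have d1 (x : R) : is_derive x (1 : R) expR (1 * expR x).
  by rewrite mul1r; exact: is_derive_expR.
have b (x : R) : `|expR x| <= expR `|x|.
  by rewrite ger0_norm ?expR_ge0// ler_expR ler_norm.
by rewrite (half_transformE (@is_derive_expR R) d1 b b) expR0 !mul1r.
Qed.

Let le1_expR (x y : R) : `|y| <= 1 -> `|y| <= expR `|x|.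
Proof. by move=> /le_trans; apply; rewrite -expR0 ler_expR. Qed.

Let cos_le (x : R) : `|cos x| <= expR `|x|.
Proof. by apply: le1_expR; rewrite ler_norml cos_geN1 cos_le1. Qed.

Let sin_le (x : R) : `|sin x| <= expR `|x|.
Proof. by apply: le1_expR; rewrite ler_norml sin_geN1 sin_le1. Qed.

Lemma half_transform_cos (t : R) :
  half_transform cos t = expR (- 2^-1 * t ^+ 2) * (Num.sqrt (2 * pi) / 2).
Proof.
have d1 (x : R) : is_derive x (1 : R) (fun x => - sin x) (- 1 * cos x).
  by rewrite mulN1r; exact: is_deriveN.
have b (x : R) : `|- sin x| <= expR `|x| by rewrite normrN; exact: sin_le.
rewrite (half_transformE (@is_derive_cos R) d1 cos_le b).
by rewrite cos0 sin0 oppr0 mul0r addr0 mul1r mulN1r.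
Qed.

Lemma half_transform_sin (t : R) :
  half_transform sin t = expR (- 2^-1 * t ^+ 2) * gauss_primitive 2^-1 t.
Proof.
have d1 (x : R) : is_derive x (1 : R) cos (- 1 * sin x).
  by rewrite mulN1r; exact: is_derive_cos.
rewrite (half_transformE (@is_derive_sin R) d1 sin_le cos_le).
by rewrite sin0 cos0 mul0r add0r mul1r mulN1r opprK.
Qed.

End concrete_transforms.

(** * Gaussian integrals over cones *)

Section real_product.
Context d1 d2 (T1 : measurableType d1) (T2 : measurableType d2) (R : realType).
Variable m1 : {sigma_finite_measure set T1 -> \bar R}.
Variable m2 : {sigma_finite_measure set T2 -> \bar R}.
Variables (u : T1 -> R) (v : T2 -> R).
Hypothesis ui : m1.-integrable setT (EFin \o u).
Hypothesis vi : m2.-integrable setT (EFin \o v).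

Lemma integrable_tensor :
  (m1 \x m2)%E.-integrable setT (EFin \o (fun p => u p.1 * v p.2)).
Proof.
have mu := measurable_int _ ui; have mv := measurable_int _ vi.
have muv : measurable_fun setT (EFin \o (fun p : T1 * T2 => u p.1 * v p.2)).
  apply/measurable_EFinP; apply: measurable_funM.
    by apply: (measurableT_comp _ measurable_fst); exact/measurable_EFinP.
  by apply: (measurableT_comp _ measurable_snd); exact/measurable_EFinP.
apply/(integrable12ltyP m1 m2 muv).
have [_ uoo] := (integrableP _ _ _ ui); have [_ voo] := (integrableP _ _ _ vi).
pose V := (\int[m2]_y `|(v y)%:E|)%E.
have Vfin : V \is a fin_num by rewrite ge0_fin_numE// integral_ge0.
rewrite [ltLHS](_ : _ = \int[m1]_x ((fine V)%:E * `|(u x)%:E|))%E; last first.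
  apply: eq_integral => x _; rewrite /= fineK// muleC.
  rewrite -ge0_integralZl//; last by apply: measurableT_comp.
  by apply: eq_integral => y _; rewrite /= normrM EFinM.
rewrite ge0_integralZl//.
- by rewrite fineK// lte_mul_pinfty// integral_ge0.
- exact: measurableT_comp.
- by rewrite fineK// integral_ge0.
Qed.

Lemma Rintegral_tensor :
  \int[(m1 \x m2)%E]_p (u p.1 * v p.2) = (\int[m1]_x u x) * (\int[m2]_y v y).
Proof.
rewrite {1}/Rintegral -(integral12_prod_meas1 integrable_tensor) /fubini_F /=.
have Ufin := integrable_fin_num measurableT ui.
have Vfin := integrable_fin_num measurableT vi.
rewrite (_ : (\int[m1]_x _)%E = (\int[m1]_x ((\int[m2]_y v y)%:E * (u x)%:E))%E); last first.
  apply: eq_integral => x _; under eq_integral do rewrite EFinM.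
  by rewrite integralZl// /Rintegral muleC fineK.
by rewrite integralZl// fineM//= mulrC.
Qed.

End real_product.

Section complex_integral.
Context d (T : measurableType d) (R : realType).
Variable m : {measure set T -> \bar R}.
Implicit Types f g : T -> R[i].

(** The counterpart of [cintegrable] on the full space for an arbitrary measure, needed for product
    measures and row vectors. *)
Definition cintegrableT f : Prop :=
  m.-integrable setT (EFin \o (fun x => complex.Re (f x))) /\
  m.-integrable setT (EFin \o (fun x => complex.Im (f x))).

Definition cintegralT f : R[i] :=
  ((\int[m]_x complex.Re (f x)) +i* (\int[m]_x complex.Im (f x)))%C.

End complex_integral.

Section complex_algebra.
Variable R : rcfType.
Implicit Types z w : R[i].

Lemma complex_ReM z w : complex.Re (z * w) =
  complex.Re z * complex.Re w - complex.Im z * complex.Im w.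
Proof. by case: z; case: w. Qed.

Lemma complex_ImM z w : complex.Im (z * w) =
  complex.Re z * complex.Im w + complex.Im z * complex.Re w.
Proof. by case: z => a b; case: w => c e /=; rewrite addrC [b * c]mulrC mulrC. Qed.

End complex_algebra.

Section complex_tensor.
Context d1 d2 (T1 : measurableType d1) (T2 : measurableType d2) (R : realType).
Variable m1 : {sigma_finite_measure set T1 -> \bar R}.
Variable m2 : {sigma_finite_measure set T2 -> \bar R}.
Variables (f : T1 -> R[i]) (g : T2 -> R[i]).
Hypothesis fi : cintegrableT m1 f.
Hypothesis gi : cintegrableT m2 g.

Lemma cintegrable_tensor : cintegrableT (m1 \x m2)%E (fun p => f p.1 * g p.2).
Proof.
have [[f1 f2] [g1 g2]] := (fi, gi); split.
- have := integrableB measurableT (integrable_tensor f1 g1) (integrable_tensor f2 g2).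
  by apply: eq_integrable => // p _; rewrite /= complex_ReM EFinB.
- have := integrableD measurableT (integrable_tensor f1 g2) (integrable_tensor f2 g1).
  by apply: eq_integrable => // p _; rewrite /= complex_ImM EFinD.
Qed.

Lemma cintegral_tensor :
  cintegralT (m1 \x m2)%E (fun p => f p.1 * g p.2) = cintegralT m1 f * cintegralT m2 g.
Proof.
have [[f1 f2] [g1 g2]] := (fi, gi).
apply/eqP; rewrite eq_complex complex_ReM complex_ImM /=; apply/andP; split; apply/eqP.
- rewrite -!Rintegral_tensor//.
  rewrite -(RintegralB measurableT (integrable_tensor f1 g1) (integrable_tensor f2 g2)).
  by apply: eq_Rintegral => p _; rewrite complex_ReM.
- rewrite -!Rintegral_tensor//.
  rewrite -(RintegralD measurableT (integrable_tensor f1 g2) (integrable_tensor f2 g1)).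
  by apply: eq_Rintegral => p _; rewrite complex_ImM.
Qed.

End complex_tensor.

Section row_vector_products.
Variable R : realType.
Local Notation mu := (@lebesgue_measure R).

Lemma integrable_rVS n (h : 'rV[R]_n.+1 -> R) : measurable_fun setT h ->
  (mu \x lebesgue_row R n)%E.-integrable setT (EFin \o h \o @cons_rowp R n) ->
  (lebesgue_row R n.+1).-integrable setT (EFin \o h) /\
  \int[lebesgue_row R n.+1]_x h x = \int[(mu \x lebesgue_row R n)%E]_p h (cons_rowp p).
Proof.
move=> mh hi; split.
- apply: (@integrable_pushforward _ _ _ _ R (@cons_rowp R n) _ (mu \x lebesgue_row R n)%E setT (EFin \o h)) => //.
    exact: measurable_cons_row.
  exact/measurable_EFinP.
- congr fine.
  apply: (@integral_pushforward _ _ _ _ R (@cons_rowp R n) _ (mu \x lebesgue_row R n)%E setT (EFin \o h)) => //.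
    exact: measurable_cons_row.
  exact/measurable_EFinP.
Qed.

Lemma measurable_complexM d (T : measurableType d) (f g : T -> R[i]) :
  measurable_fun setT (fun x => complex.Re (f x)) ->
  measurable_fun setT (fun x => complex.Im (f x)) ->
  measurable_fun setT (fun x => complex.Re (g x)) ->
  measurable_fun setT (fun x => complex.Im (g x)) ->
  measurable_fun setT (fun x => complex.Re (f x * g x)) /\
  measurable_fun setT (fun x => complex.Im (f x * g x)).
Proof.
move=> f1 f2 g1 g2; split.
- under eq_fun do rewrite complex_ReM.
  by apply: measurable_funB; exact: measurable_funM.
- under eq_fun do rewrite complex_ImM.
  by apply: measurable_funD; exact: measurable_funM.
Qed.

Lemma measurable_complex_prod d (T : measurableType d) n (f : 'I_n -> T -> R[i]) :
  (forall i, measurable_fun setT (fun x => complex.Re (f i x))) ->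
  (forall i, measurable_fun setT (fun x => complex.Im (f i x))) ->
  measurable_fun setT (fun x => complex.Re (\prod_i f i x)) /\
  measurable_fun setT (fun x => complex.Im (\prod_i f i x)).
Proof.
elim: n f => [|n IH] f f1 f2.
  by split; under eq_fun do rewrite big_ord0; exact: measurable_cst.
have [p1 p2] := IH (fun i => f (lift ord0 i)) (fun i => f1 _) (fun i => f2 _).
have [q1 q2] := measurable_complexM (f1 ord0) (f2 ord0) p1 p2.
by split; under eq_fun do rewrite big_ord_recl.
Qed.

Lemma cintegral_row_prod n (f : 'I_n -> R -> R[i]) :
  (forall i, cintegrableT mu (f i)) ->
  cintegrableT (lebesgue_row R n) (fun x => \prod_i f i (x 0 i)) /\
  cintegralT (lebesgue_row R n) (fun x => \prod_i f i (x 0 i)) =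
    \prod_i cintegralT mu (f i).
Proof.
elim: n f => [|n IH] f fi.
  split.
    split; under eq_fun do rewrite big_ord0.
      exact: (@finite_measure_integrable_cst _ _ _ (\d_ (0 : 'rV[R]_0)) setT 1).
    exact: (@finite_measure_integrable_cst _ _ _ (\d_ (0 : 'rV[R]_0)) setT 0).
  rewrite big_ord0 /cintegralT.
  by congr (_ +i* _)%C; rewrite /Rintegral integral_rV0 ?big_ord0//;
    apply/measurable_EFinP; under eq_fun do rewrite big_ord0; exact: measurable_cst.
pose g i := f (lift ord0 i).
have [gi gE] := IH g (fun i => fi _).
have ti := cintegrable_tensor (fi ord0) gi.
have tE := cintegral_tensor (fi ord0) gi.
have prodE (p : R * 'rV[R]_n) : \prod_i f i ((cons_rowp p) 0 i) =
    f ord0 p.1 * \prod_i g i (p.2 0 i).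
  rewrite big_ord_recl /cons_rowp cons_row0; congr (_ * _).
  by apply: eq_bigr => i _; rewrite cons_rowS.
have [mRe mIm] : measurable_fun setT (fun x : 'rV[R]_n.+1 => complex.Re (\prod_i f i (x 0 i))) /\
   measurable_fun setT (fun x : 'rV[R]_n.+1 => complex.Im (\prod_i f i (x 0 i))).
  apply: (measurable_complex_prod (f := fun i (x : 'rV[R]_n.+1) => f i (x 0 i))) => i.
    apply: (@measurableT_comp _ _ _ _ _ _ (fun t => complex.Re (f i t)) _ (fun x : 'rV[R]_n.+1 => x 0 i)).
      by apply/measurable_EFinP; have [/measurable_int] := fi i.
    exact: measurable_coord.
  apply: (@measurableT_comp _ _ _ _ _ _ (fun t => complex.Im (f i t)) _ (fun x : 'rV[R]_n.+1 => x 0 i)).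
    by apply/measurable_EFinP; have [_ /measurable_int] := fi i.
  exact: measurable_coord.
have hRe : (mu \x lebesgue_row R n)%E.-integrable setT
    (EFin \o (fun x : 'rV[R]_n.+1 => complex.Re (\prod_i f i (x 0 i))) \o @cons_rowp R n).
  by have [+ _] := ti; apply: eq_integrable => // p _; rewrite /= prodE.
have hIm : (mu \x lebesgue_row R n)%E.-integrable setT
    (EFin \o (fun x : 'rV[R]_n.+1 => complex.Im (\prod_i f i (x 0 i))) \o @cons_rowp R n).
  by have [_ +] := ti; apply: eq_integrable => // p _; rewrite /= prodE.
have [Rei ReE] := integrable_rVS mRe hRe.
have [Imi ImE] := integrable_rVS mIm hIm.
split; first by split.
rewrite big_ord_recl -[X in _ * X]gE -tE /cintegralT ReE ImE.
by congr (_ +i* _)%C; apply: eq_Rintegral => p _; rewrite prodE.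
Qed.

End row_vector_products.

(** * Volumes of cones in the unit ball and Gaussian integrals *)

Section gaussian_volume_of_cones.
Variable R : realType.
Local Notation mu := (@lebesgue_measure R).

(** Here the factor must be explicit: it makes a ball of radius r contribute [r ^+ n], independently
    of the cone. *)
Lemma scales_integral_scalar n (s : R) : s != 0 ->
  scales_integral (s%:M : 'M[R]_n) (`|s|^-1 ^+ n).
Proof.
move=> s0; elim: n => [|n IH].
  rewrite expr0; split => // f mf f0; rewrite mul1e.
  by apply: eq_integral => x _; rewrite (thinmx0 (x *m _)) (thinmx0 x).
rewrite exprS.
have -> : (s%:M : 'M[R]_n.+1) = (block_mx s%:M 0 0 s%:M : 'M[R]_(1 + n)).
  exact: (@scalar_mx_block _ 1 n s).
exact: scales_integral_diag.
Qed.

Lemma measurable_dotv n : measurable_fun setT (fun x : 'rV[R]_n => dotv x x).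
Proof.
rewrite /dotv; apply: measurable_sum => i.
by apply: measurable_funM; exact: (measurable_coord i).
Qed.

Lemma dotv_ge0 n (x : 'rV[R]_n) : 0 <= dotv x x.
Proof. by apply: sumr_ge0 => i _; rewrite -expr2 sqr_ge0. Qed.

Lemma dotvZ n (a : R) (x : 'rV[R]_n) : dotv (a *: x) (a *: x) = a ^+ 2 * dotv x x.
Proof. by rewrite /dotv mulr_sumr; apply: eq_bigr => i _; rewrite !mxE; ring. Qed.

Lemma integral_expRN (a : R) :
  (\int[mu]_(u in `[a, +oo[) (expR (- u))%:E = (expR (- a))%:E)%E.
Proof.
have dF (x : R) : is_derive x (1 : R) (fun u => - expR (- u)) (expR (- x)).
  by apply: is_derive_eq; rewrite /GRing.scale/=; ring.
rewrite (@ge0_continuous_FTC2y _ (fun u => expR (- u)) (fun u => - expR (- u)) a 0).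
- by rewrite -EFinB sub0r opprK.
- by move=> x _; exact: expR_ge0.
- apply: continuous_subspaceT => x.
  apply: (@continuous_comp _ _ _ (fun u : R => - u) expR); last exact: continuous_expR.
  exact: opp_continuous.
- by rewrite -oppr0; apply: cvgN; exact: cvgr_expR.
- by move=> x _; case: (dF x).
- by apply: cvg_at_right_filter; exact: (is_derive_continuousT dF).
- by move=> x _; rewrite derive1E; case: (dF x).
Qed.

Definition ball1 n : set 'rV[R]_n := [set x | dotv x x <= 1].

Lemma measurable_dotv_le n (a : R) : measurable [set x : 'rV[R]_n | dotv x x <= a].
Proof.
rewrite -[X in measurable X]setTI.
have := @measurable_dotv n measurableT `]-oo, a]%classic (measurable_itv _).
by congr measurable; apply/seteqP; split => x /=; rewrite in_itv.
Qed.

(* Layer cake: the Gaussian weight is a mixture of indicator functions of balls. *)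
Lemma gauss_integral_cone n : exists2 K : \bar R, (0 <= K)%E &
  forall A : set 'rV[R]_n, measurable A ->
    (forall s x, 0 < s -> A x -> A (s *: x)) ->
    (\int[lebesgue_row R n]_x (\1_A x * expR (- 2^-1 * dotv x x))%:E =
     K * lebesgue_row R n (A `&` @ball1 n))%E.
Proof.
(* exp (- q / 2) is the integral of exp (- u) over u >= q / 2, so with q = |x|^2 the level u sees
   the ball of radius sqrt (2 u). Its volume inside a cone is sqrt (2 u)^n times that of the unit
   ball. *)
pose w (u : R) := \1_[set u | 0 < u] u * (expR (- u) * Num.sqrt (2 * u) ^+ n).
have w0 u : 0 <= w u by rewrite mulr_ge0// ?mulr_ge0 ?expR_ge0 ?exprn_ge0 ?sqrtr_ge0.
have mpos : measurable ([set u | 0 < u] : set (measurableTypeR R)).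
  have := @measurable_itv R `]0, +oo[; congr measurable.
  by apply/seteqP; split => x /=; rewrite in_itv/= andbT.
have msqrt : measurable_fun setT (fun u : R => Num.sqrt (2 * u)).
  apply: continuous_measurable_fun => x.
  apply: (@continuous_comp _ _ _ (fun u : R => 2 * u) Num.sqrt).
    by apply: cvgM => //; exact: cvg_cst.
  exact: sqrt_continuous.
have mexp : measurable_fun setT (fun u : R => expR (- u)).
  exact: measurableT_comp.
have mw : measurable_fun setT w.
  apply: measurable_funM; first exact: measurable_indic.
  by apply: measurable_funM => //; exact: measurable_funX.
exists (\int[mu]_u (w u)%:E)%E; first by apply: integral_ge0 => u _; rewrite lee_fin.
move=> A mA coneA.
pose E : set (measurableTypeR R * 'rV[R]_n) :=
  [set p | [/\ A p.2, 0 < p.1 & dotv p.2 p.2 <= 2 * p.1]].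
have mE : measurable E.
  have m1 : measurable (snd @^-1` A : set (measurableTypeR R * 'rV[R]_n)).
    by rewrite -[X in measurable X]setTI; exact: measurable_snd.
  have m2 : measurable (fst @^-1` [set u | 0 < u] : set (measurableTypeR R * 'rV[R]_n)).
    by rewrite -[X in measurable X]setTI; exact: measurable_fst.
  have mf : measurable_fun setT (fun p : measurableTypeR R * 'rV[R]_n =>
      dotv p.2 p.2 - 2 * p.1).
    apply: measurable_funB; last by apply: measurable_funM.
    exact: (measurableT_comp (@measurable_dotv n) measurable_snd).
  have m3 := mf measurableT `]-oo, 0]%classic (measurable_itv _).
  have := measurableI _ _ (measurableI _ _ m1 m2) m3; congr measurable.
  rewrite setTI; apply/seteqP; split => p; rewrite /E /= in_itv/= subr_le0.
    by move=> [[]].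
  by move=> [].
pose h (p : measurableTypeR R * 'rV[R]_n) : \bar R := (\1_E p * expR (- p.1))%:E.
have mh : measurable_fun setT h.
  apply/measurable_EFinP; apply: measurable_funM; first exact: measurable_indic.
  exact: (measurableT_comp mexp measurable_fst).
have h0 p : (0 <= h p)%E by rewrite lee_fin mulr_ge0// expR_ge0.
have inner_u x : (\int[mu]_u h (u, x) = (\1_A x * expR (- 2^-1 * dotv x x))%:E)%E.
  rewrite /h; have [Ax|Ax] := boolP (x \in A); last first.
    rewrite (eq_integral (cst 0%E)); last first.
      move=> u _; rewrite indicE (_ : _ \in E = false) ?mul0r//.
      by apply/negP => /set_mem[/= Ax' _ _]; move/negP : Ax; apply; exact/mem_set.
    by rewrite integral0 indicE (negbTE Ax) mul0r.
  have := dotv_ge0 x; rewrite indicE Ax mul1r mulNr mulrC; set q := dotv x x => q0.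
  rewrite -[RHS]integral_expRN.
  transitivity (\int[mu]_(u in `]0%R, +oo[ `&` `[(q / 2)%R, +oo[) (expR (- u))%:E)%E.
    rewrite [RHS]integral_mkcond; apply: eq_integral => u _ /=.
    rewrite patchE indicE.
    rewrite (_ : (_ \in E) = (u \in `]0%R, +oo[ `&` `[(q / 2)%R, +oo[)).
      by case: ifP; rewrite ?mul1r ?mul0r.
    apply/idP/idP => /set_mem H; apply/mem_set; move: H.
      move=> [/= _ u0 qu]; split; rewrite /= in_itv/= andbT//.
      by rewrite ler_pdivrMr// mulrC.
    move=> [/=]; rewrite !in_itv/= !andbT => u0 qu; split => //=; first exact/set_mem.
    by rewrite mulrC -ler_pdivrMr.
  (* Levels are restricted to u > 0 so that the radius is positive; for q = 0 this removes the
     endpoint 0, a null set. *)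
  have [q_gt0|] := ltrP 0 q.
    congr integral; apply/seteqP; split => u /=; rewrite !in_itv/= !andbT; first by case.
    by move=> qu; split => //; apply: lt_le_trans qu; exact: divr_gt0.
  move=> q_le0; have -> : q = 0 by apply/eqP; rewrite eq_le q_le0.
  rewrite mul0r -integral_itv_obnd_cbnd.
    congr integral; apply/seteqP; split => u /=; rewrite !in_itv/= !andbT; first by case.
    by move=> u0; split => //; exact: ltW.
  by apply/measurable_EFinP; exact: measurable_funTS.
have inner_x u : (\int[lebesgue_row R n]_x h (u, x) =
    (w u)%:E * lebesgue_row R n (A `&` @ball1 n))%E.
  rewrite /h /w indicE; have [|] := boolP (u \in _); last first.
    move=> u0; rewrite mul0r mul0e (eq_integral (cst 0%E)) ?integral0//.
    move=> x _; rewrite indicE (_ : _ \in E = false) ?mul0r//.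
    by apply/negP => /set_mem[/= _ u0' _]; move/negP : u0; apply; exact/mem_set.
  move=> /set_mem/= u0; rewrite mul1r.
  pose r := Num.sqrt (2 * u).
  have r0 : 0 < r by rewrite sqrtr_gt0 mulr_gt0.
  have rV0 : r^-1 != 0 by rewrite invr_eq0 gt_eqF.
  have mAB : measurable (A `&` @ball1 n).
    by apply: measurableI => //; exact: measurable_dotv_le.
  transitivity (\int[lebesgue_row R n]_x ((expR (- u))%:E *
      (\1_(A `&` @ball1 n) (x *m r^-1%:M))%:E))%E.
    apply: eq_integral => x _; rewrite -EFinM mulrC !indicE; congr (_ * _%:R)%:E.
    rewrite mul_mx_scalar; congr nat_of_bool.
    have dE : (dotv (r^-1 *: x) (r^-1 *: x) <= 1) = (dotv x x <= 2 * u).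
      have r2 : r ^+ 2 = 2 * u by rewrite sqr_sqrtr// mulr_ge0// ltW.
      by rewrite dotvZ exprVn r2 ler_pdivrMl ?mulr_gt0// mulr1.
    apply/idP/idP => /set_mem H; apply/mem_set; move: H.
      move=> [/= Ax _ xu]; split; first by apply: coneA; rewrite ?invr_gt0.
      by rewrite /ball1 /= dE.
    move=> [/= Ax]; rewrite /ball1 /= dE => xu; split => //=.
    have rN0 : r != 0 by rewrite gt_eqF.
    by rewrite -[x](scalerKV rN0); apply: coneA.
  have mi : measurable_fun setT (fun x : 'rV[R]_n => (\1_(A `&` @ball1 n) x)%:E : \bar R).
    by apply/measurable_EFinP; exact: measurable_indic.
  rewrite ge0_integralZl ?lee_fin ?expR_ge0//; last first.
    by apply: (measurableT_comp mi); exact: measurable_mulmx.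
  have [_ sc] := scales_integral_scalar n rV0.
  rewrite (sc _ mi); last by move=> x; rewrite lee_fin.
  rewrite integral_indic// setIT muleA -EFinM; congr (_%:E * _)%E.
  by rewrite gtr0_norm ?invr_gt0// invrK.
under eq_integral do rewrite -inner_u.
rewrite -(@fubini_tonelli _ _ _ _ _ mu (lebesgue_row R n) h mh h0).
under eq_integral do rewrite inner_x muleC.
rewrite muleC ge0_integralZl//.
- exact/measurable_EFinP.
- by move=> u _; rewrite lee_fin.
Qed.

End gaussian_volume_of_cones.

(** * The function Phi at real and imaginary arguments *)

Section signed_affine.
Variable R : realType.
Local Notation mu := (@lebesgue_measure R).

Let measurable_aff (a b : R) : measurable_fun setT (fun t : measurableTypeR R => a * t + b).
Proof. by apply: measurable_funD => //; exact: measurable_funM. Qed.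

Lemma integrable_affine (a b : R) (f : R -> R) : a != 0 ->
  mu.-integrable setT (EFin \o f) ->
  mu.-integrable setT (EFin \o (fun t => f (a * t + b))) /\
  \int[mu]_t f t = `|a| * \int[mu]_t f (a * t + b).
Proof.
move=> a0 fi; have mf : measurable_fun [set: measurableTypeR R] (EFin \o f).
  exact: measurable_int fi.
have mfa : measurable_fun [set: measurableTypeR R] (EFin \o (fun t => f (a * t + b))).
  exact: (measurableT_comp mf (measurable_aff a b)).
have fai : mu.-integrable setT (EFin \o (fun t => f (a * t + b))).
  apply/integrableP; split => //.
  have /integrableP[_] := fi.
  have mabs : measurable_fun [set: measurableTypeR R] (fun t => `|(EFin \o f) t|)%E.
    exact: measurableT_comp.
  rewrite (ge0_integral_affine_neq0 b a0 mabs)//=.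
  case: (\int[_]_t _)%E => [r _| |]; first exact: ltry.
    by rewrite gt0_muley// lte_fin normr_gt0.
  by rewrite gt0_muleNy// lte_fin normr_gt0.
split => //.
pose fa := (EFin \o f) \o (fun t => a * t + b).
have Ep := ge0_integral_affine_neq0 b a0 (measurable_funepos mf) (funepos_ge0 _).
have En := ge0_integral_affine_neq0 b a0 (measurable_funeneg mf) (funeneg_ge0 _).
have fai' : mu.-integrable setT fa by exact: fai.
have := integrable_fin_num measurableT (integrable_funepos measurableT fai').
have := integrable_fin_num measurableT (integrable_funeneg measurableT fai').
rewrite funepos_comp funeneg_comp => /fineK nE /fineK pE.
have E : (\int[mu]_t fa t = \int[mu]_t (EFin \o f)^\+ (a * t + b)%R -
   \int[mu]_t (EFin \o f)^\- (a * t + b)%R)%E.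
  by rewrite integralE funepos_comp funeneg_comp.
suff : (\int[mu]_t (EFin \o f) t = `|a|%:E * \int[mu]_t fa t)%E.
  rewrite /Rintegral => ->.
  by rewrite fineM//; exact: integrable_fin_num fai'.
rewrite E [LHS]integralE Ep En.
by rewrite -nE -pE -!EFinM -!EFinB mulrBr.
Qed.

Lemma Rintegral_half_lines (f : R -> R) : mu.-integrable setT (EFin \o f) ->
  \int[mu]_x f x =
  \int[mu]_(x in `[0, +oo[) f x + \int[mu]_(x in `[0, +oo[) f (- x).
Proof.
move=> fi.
have mH : measurable (`[0%R, +oo[%classic : set (measurableTypeR R)) by [].
have mN : measurable (`]-oo, 0%R[%classic : set (measurableTypeR R)) by [].
have UE : [set: R] = `[0, +oo[%classic `|` `]-oo, 0[%classic.
  apply/seteqP; split => x //= _; rewrite !in_itv/= andbT.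
  by have [|] := leP 0 x; [left|right].
have fiN : mu.-integrable setT (EFin \o (f \_ `]-oo, 0[)).
  rewrite -restrict_EFin; apply/(integrable_restrict _ mN measurableT); rewrite setTI.
  exact: integrableS fi.
rewrite [in LHS]UE Rintegral_setU//; last 2 first.
- by rewrite -UE.
- apply/disj_setPS => x [] /=; rewrite !in_itv/= andbT => x0 x1.
  by move: (lt_le_trans x1 x0); rewrite ltxx.
congr (_ + _).
have N1 : (- 1 : R) != 0 by rewrite oppr_eq0 oner_eq0.
rewrite Rintegral_mkcond (integrable_affine 0 N1 fiN).2 normrN1 mul1r.
rewrite -Rintegral_itv_obnd_cbnd; last first.
  have : mu.-integrable `]0, +oo[ (EFin \o (fun t => f (- 1 * t + 0))).
    exact: integrableS (integrable_affine 0 N1 fi).1.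
  by apply: eq_integrable => // x _; rewrite /= mulN1r addr0.
rewrite [RHS]Rintegral_mkcond; apply: eq_Rintegral => x _.
rewrite /patch mulN1r addr0; congr (if _ then _ else _).
by apply/idP/idP => /set_mem/=; rewrite in_itv/= ?andbT => h; apply/mem_set;
  rewrite /= in_itv/= ?andbT; move: h; rewrite oppr_lt0.
Qed.

End signed_affine.

(** * Gaussian integrals with a complex linear exponent *)

Section complex_gauss_kernel.
Variable R : realType.
Local Notation mu := (@lebesgue_measure R).
Local Notation H := (`[0, +oo[%classic : set R).
Local Open Scope complex_scope.

(** Integrand of a Gaussian Laplace transform over D. On the half-line, a real z gives the integrand
    of [half_transform expR], an imaginary z those for cos and sin. *)
Definition gauss_kernel (D : set R) (z : R[i]) (x : R) : R[i] :=
  (\1_D x * expR (- 2^-1 * x ^+ 2))%:C * cexp (z * x%:C).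

Arguments gauss_kernel : simpl never.

Lemma complex_ext (z w : R[i]) : complex.Re z = complex.Re w ->
  complex.Im z = complex.Im w -> z = w.
Proof. by case: z; case: w => ? ? ? ? /= -> ->. Qed.

Lemma cexp_real (r : R) : cexp r%:C = (expR r)%:C.
Proof. by rewrite /cexp /= cos0 sin0; apply/eqP; rewrite eq_complex /= !mulr1 !mul0r subr0 addr0 mulr0 !eqxx. Qed.

Lemma Re_gauss_kernel D z x : complex.Re (gauss_kernel D z x) =
  \1_D x * expR (- 2^-1 * x ^+ 2) * (expR (complex.Re z * x) * cos (complex.Im z * x)).
Proof. by rewrite /gauss_kernel /cexp !complex_ReM !complex_ImM /= !mulr0 !mul0r !subr0 ?addr0 ?add0r. Qed.

Lemma Im_gauss_kernel D z x : complex.Im (gauss_kernel D z x) =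
  \1_D x * expR (- 2^-1 * x ^+ 2) * (expR (complex.Re z * x) * sin (complex.Im z * x)).
Proof. by rewrite /gauss_kernel /cexp !complex_ReM !complex_ImM /= !mulr0 !mul0r !subr0 ?addr0 ?add0r. Qed.

Lemma gauss_kernel_real D (r x : R) : gauss_kernel D r%:C x =
  (\1_D x * expR (- 2^-1 * x ^+ 2) * expR (r * x))%:C.
Proof.
apply: complex_ext; rewrite ?Re_gauss_kernel ?Im_gauss_kernel [complex.Re r%:C]/= [complex.Im r%:C]/=.
  by rewrite mul0r cos0 mulr1.
by rewrite mul0r sin0 !mulr0.
Qed.

Lemma gauss_kernel_imag D (r x : R) : gauss_kernel D (0 +i* r) x =
  (\1_D x * expR (- 2^-1 * x ^+ 2) * cos (r * x)) +i*
  (\1_D x * expR (- 2^-1 * x ^+ 2) * sin (r * x)).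
Proof.
by apply: complex_ext; rewrite ?Re_gauss_kernel ?Im_gauss_kernel
  [complex.Re (0 +i* r)]/= [complex.Im (0 +i* r)]/= mul0r expR0 mul1r.
Qed.

Lemma measurable_sinT : measurable_fun setT (@sin R).
Proof. by apply: continuous_measurable_fun; exact: continuous_sin. Qed.

Lemma measurable_cosT : measurable_fun setT (@cos R).
Proof. by apply: continuous_measurable_fun; exact: continuous_cos. Qed.

Lemma cintegrable_gauss_kernel (D : set (measurableTypeR R)) z : measurable D ->
  cintegrableT mu (gauss_kernel D z).
Proof.
move=> mD.
have mM (c : R) : measurable_fun setT (fun x : R => c * x) by exact: measurable_funM.
have mexpM : measurable_fun setT (fun x : R => expR (complex.Re z * x)).
  exact: (measurableT_comp _ (mM _)).
have bound x (e : R) : `|e| <= 1 ->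
   `|\1_D x * expR (- 2^-1 * x ^+ 2) * (expR (complex.Re z * x) * e)| <=
   expR (- 2^-1 * x ^+ 2 + `|complex.Re z| * `|x|).
  move=> e1; rewrite expRD !normrM ler_pM ?mulr_ge0//.
    rewrite (ger0_norm (expR_ge0 _)) ler_piMl ?expR_ge0//.
    by rewrite indicE; case: (_ \in _); rewrite ?normr0 ?normr1.
  rewrite (ger0_norm (expR_ge0 _)) -[leRHS]mulr1 ler_pM ?expR_ge0//.
  by rewrite ler_expR -normrM ler_norm.
split.
- under eq_fun do rewrite Re_gauss_kernel.
  apply: (@integrable_gauss_le _ _ (`|complex.Re z|)) => //.
    apply: measurable_funM.
      by apply: measurable_funM; [exact: measurable_indic|exact: measurable_gauss].
    apply: measurable_funM => //.
    exact: (measurableT_comp measurable_cosT (mM _)).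
  by move=> x _; apply: bound; rewrite ler_norml cos_geN1 cos_le1.
- under eq_fun do rewrite Im_gauss_kernel.
  apply: (@integrable_gauss_le _ _ (`|complex.Re z|)) => //.
    apply: measurable_funM.
      by apply: measurable_funM; [exact: measurable_indic|exact: measurable_gauss].
    apply: measurable_funM => //.
    exact: (measurableT_comp measurable_sinT (mM _)).
  by move=> x _; apply: bound; rewrite ler_norml sin_geN1 sin_le1.
Qed.

Lemma Rintegral_indic_half (f : R -> R) :
  \int[mu]_x (\1_H x * f x) = \int[mu]_(x in H) f x.
Proof.
rewrite [RHS]Rintegral_mkcond; apply: eq_Rintegral => x _.
by rewrite /patch indicE; case: ifP; rewrite ?mul1r ?mul0r.
Qed.

Lemma cintegral_complex (D : set R) (f : R -> R[i]) (u v : R -> R) :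
  (forall x, f x = u x +i* v x) ->
  cintegral D f = (\int[mu]_(x in D) u x) +i* (\int[mu]_(x in D) v x).
Proof. by move=> fE; congr (_ +i* _); apply: eq_Rintegral => x _; rewrite fE. Qed.

Lemma cintegral_real (D : set R) (f : R -> R[i]) (u : R -> R) :
  (forall x, f x = (u x)%:C) -> cintegral D f = (\int[mu]_(x in D) u x)%:C.
Proof.
move=> /cintegral_complex ->; congr (_ +i* _).
by rewrite /Rintegral integral0.
Qed.

Lemma cintegral_half_real (r : R) :
  cintegral setT (gauss_kernel H r%:C) = (half_transform expR r)%:C.
Proof.
rewrite (cintegral_real _ (gauss_kernel_real _ _)) /half_transform -Rintegral_indic_half.
by congr _%:C; apply: eq_Rintegral => x _; rewrite -mulrA.
Qed.

Lemma cintegral_half_imag (r : R) : cintegral setT (gauss_kernel H (0 +i* r)) =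
  half_transform cos r +i* half_transform sin r.
Proof.
rewrite (cintegral_complex _ (gauss_kernel_imag _ _)) /half_transform -!Rintegral_indic_half.
by congr (_ +i* _); apply: eq_Rintegral => x _; rewrite -mulrA.
Qed.

Let rt2pi : R := Num.sqrt (2 * pi).

Let rt2pi_neq0 : rt2pi != 0.
Proof. by rewrite sqrtr_eq0 -ltNge mulr_gt0// pi_gt0. Qed.

Lemma Phi_real (r : R) :
  Phi r%:C = (2^-1 + gauss_primitive (- 2^-1) r / rt2pi)%:C.
Proof.
have E (s : R) : r%:C * cexp (- (s%:C * r%:C) ^+ 2 / 2) = (r * expR (- 2^-1 * (s * r) ^+ 2))%:C.
  have -> : - (s%:C * r%:C) ^+ 2 / 2 = (- 2^-1 * (s * r) ^+ 2)%:C.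
    by rewrite rmorphM rmorphXn rmorphM rmorphN fmorphV rmorph_nat mulNr mulrC mulNr.
  by rewrite cexp_real rmorphM.
rewrite /Phi (_ : cintegral _ _ = (gauss_primitive (- 2^-1) r)%:C).
  have -> : 2^-1 = (2^-1)%:C :> R[i] by rewrite fmorphV rmorph_nat.
  by apply: complex_ext => /=; rewrite -/rt2pi; field.
by rewrite (cintegral_real _ E).
Qed.

(** Squaring the imaginary argument reverses the sign in the exponent, hence the primitive with
    constant [2^-1] instead of [- 2^-1]. *)
Lemma Phi_imag (r : R) :
  Phi (0 +i* r) = 2^-1 +i* (gauss_primitive 2^-1 r / rt2pi).
Proof.
have E (s : R) : (0 +i* r) * cexp (- (s%:C * (0 +i* r)) ^+ 2 / 2) =
    0 +i* (r * expR (2^-1 * (s * r) ^+ 2)).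
  have -> : - (s%:C * (0 +i* r)) ^+ 2 / 2 = (2^-1 * (s * r) ^+ 2)%:C.
    rewrite rmorphM fmorphV rmorph_nat mulrC; congr (_ * _).
    by apply: complex_ext => /=; ring.
  by rewrite cexp_real; apply/eqP; rewrite eq_complex /=; apply/andP; split; apply/eqP; ring.
rewrite /Phi (_ : cintegral _ _ = 0 +i* (gauss_primitive 2^-1 r)).
  have -> : 2^-1 = (2^-1)%:C :> R[i] by rewrite fmorphV rmorph_nat.
  by apply: complex_ext => /=; rewrite -/rt2pi; field.
rewrite (cintegral_complex _ E); congr (_ +i* _).
by rewrite /Rintegral integral0.
Qed.

Lemma csqrt_scale (al y : R) : csqrt al * y%:C =
  if 0 <= al then (Num.sqrt al * y)%:C else 0 +i* (Num.sqrt (- al) * y).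
Proof.
rewrite /csqrt; case: ifP => _; first by rewrite rmorphM.
by apply: complex_ext => /=; ring.
Qed.

(** Completion of the square, carried out separately for real and imaginary [csqrt al]; the formula
    itself no longer depends on the sign of al. *)
Lemma cintegral_half_gauss_kernel (al y : R) :
  cintegral setT (gauss_kernel H (csqrt al * y%:C)) =
  (rt2pi * expR (2^-1 * (al * y ^+ 2)))%:C * Phi (csqrt al * y%:C).
Proof.
rewrite csqrt_scale; case: ifPn => al0.
  rewrite cintegral_half_real half_transform_expR Phi_real -rmorphM; congr _%:C.
  by rewrite exprMn sqr_sqrtr// -/rt2pi; field.
rewrite -ltNge in al0.
have al0' : 0 <= - al by rewrite oppr_ge0 ltW.
rewrite cintegral_half_imag half_transform_cos half_transform_sin Phi_imag.
have -> : - 2^-1 * (Num.sqrt (- al) * y) ^+ 2 = 2^-1 * (al * y ^+ 2).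
  by rewrite exprMn sqr_sqrtr//; ring.
by apply: complex_ext => /=; rewrite -/rt2pi; field.
Qed.

Lemma gauss_primitiveN (c t : R) : gauss_primitive c (- t) = - gauss_primitive c t.
Proof.
rewrite /gauss_primitive -[RHS]mulN1r -RintegralZl//.
  by apply: eq_Rintegral => u _; rewrite mulrN sqrrN mulN1r mulNr.
apply: continuous_compact_integrable; first exact: segment_compact.
apply: continuous_subspaceT => u.
by apply: cvgM; [exact: cvg_cst|exact: continuous_gauss_scale].
Qed.

Lemma half_transform_split (f : R -> R) (t : R) :
  mu.-integrable setT (EFin \o (fun x => expR (- 2^-1 * x ^+ 2) * f (t * x))) ->
  \int[mu]_x (expR (- 2^-1 * x ^+ 2) * f (t * x)) =
  half_transform f t + half_transform f (- t).
Proof.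
move=> fi; rewrite Rintegral_half_lines//; congr (_ + _).
rewrite /half_transform; apply: eq_Rintegral => x _.
by rewrite sqrrN [t * - x]mulrN [- t * x]mulNr.
Qed.

(** The two half-lines contribute the transforms at r and - r; the terms with the primitive are odd
    in r and cancel. *)
Lemma cintegral_gauss_kernel (al y : R) :
  cintegral setT (gauss_kernel setT (csqrt al * y%:C)) =
  (rt2pi * expR (2^-1 * (al * y ^+ 2)))%:C.
Proof.
have mT : measurable (setT : set (measurableTypeR R)) by [].
have Wmul1 (w : R -> R) (x : R) : \1_[set: R] x * expR (- 2^-1 * x ^+ 2) * w x =
    expR (- 2^-1 * x ^+ 2) * w x by rewrite indicT mul1r.
rewrite csqrt_scale; case: ifPn => al0.
  set r := Num.sqrt al * y.
  have r2 : r ^+ 2 = al * y ^+ 2 by rewrite exprMn sqr_sqrtr.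
  have [ri _] := cintegrable_gauss_kernel r%:C mT.
  rewrite (cintegral_real _ (gauss_kernel_real _ _)); congr _%:C.
  under eq_Rintegral do rewrite (Wmul1 (fun x => expR (r * x))).
  rewrite half_transform_split; last first.
    move: ri; apply: eq_integrable => // x _; rewrite /comp gauss_kernel_real.
    by rewrite (Wmul1 (fun x => expR (r * x))).
  rewrite !half_transform_expR gauss_primitiveN sqrrN r2 -/rt2pi.
  by field.
rewrite -ltNge in al0.
have al0' : 0 <= - al by rewrite oppr_ge0 ltW.
set r := Num.sqrt (- al) * y.
have r2 : - 2^-1 * r ^+ 2 = 2^-1 * (al * y ^+ 2) by rewrite exprMn sqr_sqrtr//; ring.
have [ri ii] := cintegrable_gauss_kernel (0 +i* r) mT.
rewrite (cintegral_complex _ (gauss_kernel_imag _ _)); congr (_ +i* _).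
  under eq_Rintegral do rewrite (Wmul1 (fun x => cos (r * x))).
  rewrite half_transform_split; last first.
    move: ri; apply: eq_integrable => // x _; rewrite /comp gauss_kernel_imag.
    by rewrite [complex.Re _]/= (Wmul1 (fun x => cos (r * x))).
  rewrite !half_transform_cos sqrrN r2 -/rt2pi.
  by field.
under eq_Rintegral do rewrite (Wmul1 (fun x => sin (r * x))).
rewrite half_transform_split; last first.
  move: ii; apply: eq_integrable => // x _; rewrite /comp gauss_kernel_imag.
  by rewrite [complex.Im _]/= (Wmul1 (fun x => sin (r * x))).
by rewrite !half_transform_sin gauss_primitiveN sqrrN mulrN subrr.
Qed.

End complex_gauss_kernel.

(** * Solid angles of cones with a rank-one Gram matrix *)

Section complex_exponential.
Variable R : realType.
Local Open Scope complex_scope.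
Implicit Types z w : R[i].

Lemma cexpD z w : cexp (z + w) = cexp z * cexp w.
Proof.
case: z => a b; case: w => c d; rewrite /cexp /= expRD cosD sinD.
by apply: complex_ext => /=; ring.
Qed.

Lemma cexp0 : cexp (0 : R[i]) = 1.
Proof. by rewrite /cexp /= expR0 cos0 sin0 mul1r. Qed.

Lemma cexp_sum n (z : 'I_n -> R[i]) : cexp (\sum_i z i) = \prod_i cexp (z i).
Proof. exact: (big_morph _ cexpD cexp0). Qed.

(** Being multiplicative, the squared modulus bounds the real and imaginary parts of a product of
    complex factors without expanding the product. *)
Definition sqmod z : R := complex.Re z ^+ 2 + complex.Im z ^+ 2.

Lemma sqmodM z w : sqmod (z * w) = sqmod z * sqmod w.
Proof. by rewrite /sqmod complex_ReM complex_ImM; ring. Qed.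

Lemma sqmod_prod n (z : 'I_n -> R[i]) : sqmod (\prod_i z i) = \prod_i sqmod (z i).
Proof.
by apply: (big_morph _ sqmodM); rewrite /sqmod /= expr1n expr0n addr0.
Qed.

Lemma sqmod_ge0 z : 0 <= sqmod z.
Proof. by rewrite addr_ge0 ?sqr_ge0. Qed.

Lemma sqmod_cexp z : sqmod (cexp z) = expR (complex.Re z) ^+ 2.
Proof.
case: z => a b; rewrite /sqmod /cexp /=.
by rewrite !mul0r subr0 addr0 !exprMn -mulrDr cos2Dsin2 mulr1.
Qed.

Lemma sqmod_real (a : R) : sqmod a%:C = a ^+ 2.
Proof. by rewrite /sqmod /= expr0n addr0. Qed.

Lemma Re_le_sqmod z (b : R) : 0 <= b -> sqmod z <= b ^+ 2 -> `|complex.Re z| <= b.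
Proof.
move=> b0 zb; rewrite -(ler_pXn2r (n := 2))// ?nnegrE// real_normK ?num_real//.
by apply: le_trans zb; rewrite lerDl sqr_ge0.
Qed.

Lemma Im_le_sqmod z (b : R) : 0 <= b -> sqmod z <= b ^+ 2 -> `|complex.Im z| <= b.
Proof.
move=> b0 zb; rewrite -(ler_pXn2r (n := 2))// ?nnegrE// real_normK ?num_real//.
by apply: le_trans zb; rewrite lerDr sqr_ge0.
Qed.

Lemma sqmod_gauss_kernel_le (D : set R) z (x : R) :
  sqmod (gauss_kernel D z x) <= (expR (- 2^-1 * x ^+ 2) * expR (complex.Re z * x)) ^+ 2.
Proof.
rewrite /gauss_kernel sqmodM sqmod_real sqmod_cexp complex_ReM /= mulr0 subr0.
rewrite !exprMn ler_wpM2r ?sqr_ge0// ler_piMl ?sqr_ge0//.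
Qed.

Lemma Re_realM (a : R) z : complex.Re (a%:C * z) = a * complex.Re z.
Proof. by rewrite complex_ReM /= mul0r subr0. Qed.

Lemma Im_realM (a : R) z : complex.Im (a%:C * z) = a * complex.Im z.
Proof. by rewrite complex_ImM /= mul0r addr0. Qed.

End complex_exponential.

(** * Linearisation by an auxiliary Gaussian variable *)

Section gaussian_linearisation.
Variables (R : realType) (k m : nat).
Local Notation mu := (@lebesgue_measure R).
Local Notation nu := (lebesgue_row R (k + m)).
Local Notation rt2pi := (Num.sqrt (2 * pi) : R).
Local Open Scope complex_scope.
Implicit Types (al Y : R) (x : 'rV[R]_(k + m)) (P : set R) (i : 'I_(k + m)).

(* [expR (al * last_sum x ^+ 2 / 2)] is the mean of [cexp (csqrt al * Y * last_sum x)] over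
   a standard Gaussian Y; for fixed Y this weight is a product over the coordinates of x. *)
Definition last_sum x : R := \sum_(j < m) x 0 (rshift k j).

(** P is the half-line for the cone and the whole line for the normalising integral. *)
Definition last_in P x : R := \prod_(j < m) \1_P (x 0 (rshift k j)).

Lemma last_in_ge0 P x : 0 <= last_in P x.
Proof. exact: prodr_ge0. Qed.

(** Only the last m coordinates are coupled to Y and constrained to P. The first k are free Gaussian
    variables; they account for the lineality space of a tangent cone. *)
Let e i : R := (k <= i)%:R.
Let D P i : set R := if (k <= i)%N then P else setT.

Let elshift (j : 'I_k) : e (lshift m j) = 0.
Proof. by rewrite /e /= leqNgt ltn_ord. Qed.
Let ershift (j : 'I_m) : e (rshift k j) = 1.
Proof. by rewrite /e /= leq_addr. Qed.
Let Dlshift P (j : 'I_k) : D P (lshift m j) = setT.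
Proof. by rewrite /D /= leqNgt ltn_ord. Qed.
Let Drshift P (j : 'I_m) : D P (rshift k j) = P.
Proof. by rewrite /D /= leq_addr. Qed.

Definition linear_factor al P Y i : R -> R[i] :=
  gauss_kernel (D P i) (csqrt al * (e i * Y)%:C).

Definition linear_kernel al P (p : R * 'rV[R]_(k + m)) : R[i] :=
  (expR (- 2^-1 * p.1 ^+ 2))%:C * \prod_i linear_factor al P p.1 i (p.2 0 i).

Let measurable_D P i : measurable (P : set (measurableTypeR R)) ->
  measurable (D P i : set (measurableTypeR R)).
Proof. by rewrite /D; case: ifP. Qed.

Lemma measurable_linear_kernel al P : measurable (P : set (measurableTypeR R)) ->
  measurable_fun setT (fun p : measurableTypeR R * 'rV[R]_(k + m) => complex.Re (linear_kernel al P p)) /\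
  measurable_fun setT (fun p : measurableTypeR R * 'rV[R]_(k + m) => complex.Im (linear_kernel al P p)).
Proof.
move=> mP.
have mc i : measurable_fun setT (fun p : measurableTypeR R * 'rV[R]_(k + m) => p.2 0 i : measurableTypeR R).
  exact: (measurableT_comp (measurable_coord i) measurable_snd).
have mdamp i : measurable_fun setT (fun p : measurableTypeR R * 'rV[R]_(k + m) =>
    \1_(D P i) (p.2 0 i) * expR (- 2^-1 * (p.2 0 i) ^+ 2) : R).
  apply: measurable_funM.
    by apply: (measurableT_comp _ (mc i)); apply: measurable_indic; exact: measurable_D.
  exact: (measurableT_comp (measurable_gauss (- 2^-1)) (mc i)).
have mlin (c : R) i : measurable_fun setT (fun p : measurableTypeR R * 'rV[R]_(k + m) =>
    c * (e i * p.1) * p.2 0 i : R).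
  apply: measurable_funM; last exact: mc.
  by apply: measurable_funM => //; apply: measurable_funM.
have Reprod (z : R[i]) (a : R) : complex.Re (z * a%:C) = complex.Re z * a.
  by rewrite mulrC Re_realM mulrC.
have Improd (z : R[i]) (a : R) : complex.Im (z * a%:C) = complex.Im z * a.
  by rewrite mulrC Im_realM mulrC.
have h1 i : measurable_fun setT (fun p : measurableTypeR R * 'rV[R]_(k + m) =>
    complex.Re (linear_factor al P p.1 i (p.2 0 i))).
  under eq_fun do rewrite /linear_factor Re_gauss_kernel Reprod Improd.
  apply: measurable_funM => //; apply: measurable_funM.
    exact: (measurableT_comp (@measurable_expR R) (mlin _ i)).
  exact: (measurableT_comp (@measurable_cosT R) (mlin _ i)).
have h2 i : measurable_fun setT (fun p : measurableTypeR R * 'rV[R]_(k + m) =>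
    complex.Im (linear_factor al P p.1 i (p.2 0 i))).
  under eq_fun do rewrite /linear_factor Im_gauss_kernel Reprod Improd.
  apply: measurable_funM => //; apply: measurable_funM.
    exact: (measurableT_comp (@measurable_expR R) (mlin _ i)).
  exact: (measurableT_comp (@measurable_sinT R) (mlin _ i)).
have [m1 m2] := measurable_complex_prod h1 h2.
have mg : measurable_fun setT (fun p : measurableTypeR R * 'rV[R]_(k + m) =>
    expR (- 2^-1 * p.1 ^+ 2) : R).
  exact: (measurableT_comp (measurable_gauss (- 2^-1)) measurable_fst).
split.
- under eq_fun do rewrite /linear_kernel Re_realM.
  by apply: measurable_funM => //; exact: m1.
- under eq_fun do rewrite /linear_kernel Im_realM.
  by apply: measurable_funM => //; exact: m2.
Qed.

Lemma Re_linear_kernel al P Y x : complex.Re (linear_kernel al P (Y, x)) =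
  expR (- 2^-1 * Y ^+ 2) * complex.Re (\prod_i linear_factor al P Y i (x 0 i)).
Proof. exact: Re_realM. Qed.

Lemma Im_linear_kernel al P Y x : complex.Im (linear_kernel al P (Y, x)) =
  expR (- 2^-1 * Y ^+ 2) * complex.Im (\prod_i linear_factor al P Y i (x 0 i)).
Proof. exact: Im_realM. Qed.

Lemma cintegral_linear_factor_setT al Y i :
  cintegral setT (linear_factor al setT Y i) =
  (rt2pi * expR (2^-1 * (al * (e i * Y) ^+ 2)))%:C.
Proof.
rewrite /linear_factor (_ : D setT i = setT) ?cintegral_gauss_kernel//.
by rewrite /D if_same.
Qed.

Lemma prod_e (al Y : R) :
  \prod_i (rt2pi * expR (2^-1 * (al * (e i * Y) ^+ 2))) =
  rt2pi ^+ (k + m) * expR (2^-1 * (m%:R * al) * Y ^+ 2).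
Proof.
rewrite big_split /= prodr_const card_ord; congr (_ * _).
rewrite big_split_ord /= big1 => [|j _]; last first.
  by rewrite elshift mul0r expr0n !mulr0 expR0.
rewrite mul1r.
under eq_bigr do rewrite ershift mul1r.
by rewrite prodr_const card_ord -expRM_natl; congr expR; ring.
Qed.

(** For al >= 0 the kernel is nonnegative, and its integral over x is a constant times exp (- (1 - m
    al) Y^2 / 2); the condition on [m * al] makes this integrable in Y. *)
Lemma integrable_linear_kernel_real al : 0 <= al -> m%:R * al < 1 ->
  (mu \x nu)%E.-integrable setT (EFin \o (fun p => complex.Re (linear_kernel al setT p))).
Proof.
move=> al0 mal.
have mT : measurable (setT : set (measurableTypeR R)) by [].
have [mRe _] := measurable_linear_kernel al mT.
have mK : measurable_fun setT (EFin \o (fun p => complex.Re (linear_kernel al setT p)) : _ -> \bar R).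
  exact/measurable_EFinP.
apply/(integrable12ltyP mu nu mK).
have kE (p : R * 'rV[R]_(k + m)) : linear_kernel al setT p =
    (expR (- 2^-1 * p.1 ^+ 2) * \prod_i (expR (- 2^-1 * p.2 0 i ^+ 2) *
      expR (Num.sqrt al * (e i * p.1) * p.2 0 i)))%:C.
  rewrite /linear_kernel rmorphM rmorph_prod; congr (_ * _); apply: eq_bigr => i _.
  rewrite /linear_factor csqrt_scale al0 gauss_kernel_real.
  by rewrite /D if_same indicT mul1r.
have k0 (p : R * 'rV[R]_(k + m)) : 0 <= complex.Re (linear_kernel al setT p).
  by rewrite kE /= mulr_ge0 ?expR_ge0//; apply: prodr_ge0 => i _; rewrite mulr_ge0 ?expR_ge0.
have [gi gE] : (forall Y, cintegrableT nu (fun x => \prod_i linear_factor al setT Y i (x 0 i))) /\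
   (forall Y, cintegralT nu (fun x => \prod_i linear_factor al setT Y i (x 0 i)) =
      \prod_i cintegralT mu (linear_factor al setT Y i)).
  split=> Y; have [//] := @cintegral_row_prod R (k + m) (linear_factor al setT Y)
    (fun i => cintegrable_gauss_kernel _ (measurable_D i mT)).
have inner Y : (\int[nu]_x `|(complex.Re (linear_kernel al setT (Y, x)))%:E| =
    (rt2pi ^+ (k + m) * expR (- 2^-1 * (1 - m%:R * al) * Y ^+ 2))%:E)%E.
  under eq_integral do rewrite gee0_abs ?lee_fin// Re_linear_kernel EFinM.
  have [ri _] := gi Y.
  rewrite integralZl//= -(fineK (integrable_fin_num measurableT ri)) -EFinM; congr EFin.
  have := congr1 (@complex.Re R) (gE Y); rewrite /= /Rintegral => ->.
  rewrite (eq_bigr (fun i => (rt2pi * expR (2^-1 * (al * (e i * Y) ^+ 2)))%:C)); last first.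
    by move=> i _; exact: cintegral_linear_factor_setT.
  rewrite -rmorph_prod /= prod_e mulrCA -expRD; congr (_ * expR _); ring.
under eq_integral do rewrite inner.
have c0 : - 2^-1 * (1 - m%:R * al) < 0 :> R.
  by rewrite mulNr oppr_lt0 mulr_gt0// ?invr_gt0// subr_gt0.
have gint := @integrableZl _ _ _ mu setT measurableT (rt2pi ^+ (k + m)) _ (integrable_gauss c0).
have /integrableP[_] := gint; congr (_ < _)%E; apply: eq_integral => Y _.
by rewrite /= ger0_norm// mulr_ge0 ?expR_ge0 ?exprn_ge0 ?sqrtr_ge0.
Qed.

(** Domination by the real kernel with parameter [be], which is al for al >= 0 and 0 otherwise: an
    imaginary coefficient contributes only a phase. *)
Lemma cintegrable_linear_kernel al P : measurable (P : set (measurableTypeR R)) ->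
  m%:R * al < 1 -> cintegrableT (mu \x nu)%E (linear_kernel al P).
Proof.
move=> mP mal.
pose r := complex.Re (csqrt al); pose be := r ^+ 2.
have r0 : 0 <= r by rewrite /r /csqrt; case: ifP => //= _; exact: sqrtr_ge0.
have rE : Num.sqrt be = r by rewrite /be sqrtr_sqr ger0_norm.
have be0 : 0 <= be by exact: sqr_ge0.
have mbe : m%:R * be < 1.
  rewrite /be /r /csqrt; case: ifP => [al0|_] /=; last by rewrite expr0n mulr0.
  by rewrite sqr_sqrtr.
have bi := integrable_linear_kernel_real be0 mbe.
have [mRe mIm] := measurable_linear_kernel al mP.
pose b i (p : R * 'rV[R]_(k + m)) := expR (- 2^-1 * p.2 0 i ^+ 2) * expR (r * (e i * p.1) * p.2 0 i).
pose B (p : R * 'rV[R]_(k + m)) := expR (- 2^-1 * p.1 ^+ 2) * \prod_i b i p.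
have B0 p : 0 <= B p.
  by rewrite mulr_ge0 ?expR_ge0//; apply: prodr_ge0 => i _; rewrite mulr_ge0 ?expR_ge0.
have BE p : complex.Re (linear_kernel be setT p) = B p.
  rewrite /linear_kernel Re_realM; congr (_ * _).
  rewrite (eq_bigr (fun i => (b i p)%:C)) => [|i _]; first by rewrite -rmorph_prod.
  rewrite /linear_factor csqrt_scale be0 gauss_kernel_real rE.
  by rewrite /D if_same indicT mul1r.
have kB p : sqmod (linear_kernel al P p) <= B p ^+ 2.
  rewrite /linear_kernel sqmodM sqmod_real sqmod_prod exprMn -prodrXl.
  rewrite ler_wpM2l ?sqr_ge0//; apply: ler_prod => i _; rewrite sqmod_ge0/=.
  apply: le_trans (sqmod_gauss_kernel_le _ _ _) _.
  by rewrite /b [csqrt _ * _]mulrC Re_realM -/r [_ * r]mulrC.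
split.
- apply: le_integrable bi => //; first exact/measurable_EFinP.
  move=> p _ /=; rewrite lee_fin BE (ger0_norm (B0 _)).
  exact: Re_le_sqmod.
- apply: le_integrable bi => //; first exact/measurable_EFinP.
  move=> p _ /=; rewrite lee_fin BE (ger0_norm (B0 _)).
  exact: Im_le_sqmod.
Qed.

(** The exponent depends on Y and [last_sum x] only through their product, so for fixed x the kernel
    is again a [gauss_kernel], now in the variable Y on the whole line. *)
Lemma linear_kernelE al P Y x : linear_kernel al P (Y, x) =
  (last_in P x * expR (- 2^-1 * dotv x x))%:C *
  gauss_kernel setT (csqrt al * (last_sum x)%:C) Y.
Proof.
rewrite /linear_kernel /linear_factor /gauss_kernel indicT mul1r.
rewrite big_split /= -cexp_sum -rmorph_prod/=.
have -> : \prod_i (\1_(D P i) (x 0 i) * expR (- 2^-1 * x 0 i ^+ 2)) =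
    last_in P x * expR (- 2^-1 * dotv x x).
  rewrite big_split /= -expR_sum -mulr_sumr; congr (_ * expR (_ * _)).
  rewrite big_split_ord /= big1 ?mul1r => [|j _]; last by rewrite Dlshift indicT.
  by apply: eq_bigr => j _; rewrite Drshift.
have -> : \sum_i csqrt al * (e i * Y)%:C * (x 0 i)%:C = csqrt al * (last_sum x)%:C * Y%:C.
  rewrite big_split_ord /= big1 ?add0r => [|j _]; last first.
    by rewrite elshift mul0r mulr0 mul0r.
  rewrite /last_sum rmorph_sum mulr_sumr mulr_suml; apply: eq_bigr => j _.
  by rewrite ershift mul1r -!mulrA [Y%:C * _]mulrC.
exact: mulrCA.
Qed.

Section linearisation.
Variables (al : R) (P : set R) (psi : R -> R[i]).
Hypotheses (mP : measurable (P : set (measurableTypeR R))) (mal : m%:R * al < 1).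
Hypothesis psiE : forall Y, cintegral setT (gauss_kernel P (csqrt al * Y%:C)) =
  (rt2pi * expR (2^-1 * (al * Y ^+ 2)))%:C * psi Y.

Let G Y : R[i] := (rt2pi ^+ (k + m))%:C *
  ((expR (- 2^-1 * (1 - m%:R * al) * Y ^+ 2))%:C * psi Y ^+ m).

Let prod_cintegral Y : (expR (- 2^-1 * Y ^+ 2))%:C *
  \prod_i cintegralT mu (linear_factor al P Y i) = G Y.
Proof.
have fE i : cintegralT mu (linear_factor al P Y i) =
    (rt2pi * expR (2^-1 * (al * (e i * Y) ^+ 2)))%:C * (if (k <= i)%N then psi Y else 1).
  rewrite /linear_factor /D /e; case: ifP => _; first by rewrite mul1r; exact: psiE.
  by rewrite mul0r mulr1; exact: cintegral_gauss_kernel.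
under eq_bigr do rewrite fE.
rewrite big_split /= -rmorph_prod /= prod_e /G.
have -> : \prod_(i < k + m) (if (k <= i)%N then psi Y else 1) = psi Y ^+ m.
  rewrite big_split_ord /= big1 ?mul1r => [|j _]; last by rewrite leqNgt ltn_ord.
  by under eq_bigr do rewrite leq_addr; rewrite prodr_const card_ord.
rewrite !mulrA; congr (_ * _); rewrite -!rmorphM; congr _%:C.
by rewrite mulrCA -expRD; congr (_ * expR _); ring.
Qed.

Let inner_x Y :
  (\int[nu]_x (complex.Re (linear_kernel al P (Y, x)))%:E = (complex.Re (G Y))%:E)%E /\
  (\int[nu]_x (complex.Im (linear_kernel al P (Y, x)))%:E = (complex.Im (G Y))%:E)%E.
Proof.
have [[ri ii] gE] := @cintegral_row_prod R (k + m) (linear_factor al P Y)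
    (fun i => cintegrable_gauss_kernel _ (measurable_D i mP)).
split.
- under eq_integral do rewrite Re_linear_kernel EFinM.
  rewrite integralZl// -(fineK (integrable_fin_num measurableT ri)) -EFinM; congr EFin.
  have := congr1 (@complex.Re R) gE; rewrite [X in X = _ -> _]/= /Rintegral => ->.
  by rewrite -prod_cintegral Re_realM.
- under eq_integral do rewrite Im_linear_kernel EFinM.
  rewrite integralZl// -(fineK (integrable_fin_num measurableT ii)) -EFinM; congr EFin.
  have := congr1 (@complex.Im R) gE; rewrite [X in X = _ -> _]/= /Rintegral => ->.
  by rewrite -prod_cintegral Im_realM.
Qed.

Let inner_Y x :
  (\int[mu]_Y (complex.Re (linear_kernel al P (Y, x)))%:E =
    (rt2pi * (last_in P x * expR (- 2^-1 * (dotv x x - al * last_sum x ^+ 2))))%:E)%E /\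
  (\int[mu]_Y (complex.Im (linear_kernel al P (Y, x)))%:E = 0)%E.
Proof.
have mT : measurable (setT : set (measurableTypeR R)) by [].
have [ri ii] := cintegrable_gauss_kernel (csqrt al * (last_sum x)%:C) mT.
have gE := cintegral_gauss_kernel al (last_sum x).
split.
- under eq_integral do rewrite linear_kernelE Re_realM EFinM.
  rewrite integralZl// -(fineK (integrable_fin_num measurableT ri)) -EFinM; congr EFin.
  have := congr1 (@complex.Re R) gE; rewrite [X in X = _ -> _]/= /Rintegral => ->.
  rewrite [complex.Re _]/= mulrCA -mulrA -expRD; congr (_ * (_ * expR _)); ring.
- under eq_integral do rewrite linear_kernelE Im_realM EFinM.
  rewrite integralZl// -(fineK (integrable_fin_num measurableT ii)) -EFinM; congr EFin.
  have := congr1 (@complex.Im R) gE; rewrite [X in X = _ -> _]/= /Rintegral => ->.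
  by rewrite [complex.Im _]/= mulr0.
Qed.

(** Fubini for [linear_kernel]: integrating x first produces the power of psi, integrating Y first
    produces the quadratic weight. An abstract psi covers both the half-line, with [Phi], and the
    whole line, with the constant 1. *)
Lemma gaussian_linearisation :
  [/\ nu.-integrable setT
       (EFin \o (fun x => last_in P x * expR (- 2^-1 * (dotv x x - al * last_sum x ^+ 2)))),
  cintegrable setT (fun Y => (rt2pi ^+ (k + m))%:C *
     ((expR (- 2^-1 * (1 - m%:R * al) * Y ^+ 2))%:C * psi Y ^+ m)) &
  cintegral setT (fun Y => (rt2pi ^+ (k + m))%:C *
     ((expR (- 2^-1 * (1 - m%:R * al) * Y ^+ 2))%:C * psi Y ^+ m)) =
  (rt2pi * \int[nu]_x (last_in P x * expR (- 2^-1 * (dotv x x - al * last_sum x ^+ 2))))%:C].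
Proof.
have [Ri Ii] := cintegrable_linear_kernel mP mal.
have FR := Fubini Ri; have FI := Fubini Ii.
have GR : mu.-integrable setT (EFin \o (fun Y => complex.Re (G Y))).
  have := integrable_fubini_F Ri; apply: eq_integrable => // Y _.
  by rewrite /fubini_F; have [-> _] := inner_x Y.
have GI : mu.-integrable setT (EFin \o (fun Y => complex.Im (G Y))).
  have := integrable_fubini_F Ii; apply: eq_integrable => // Y _.
  by rewrite /fubini_F; have [_ ->] := inner_x Y.
have ER : (\int[mu]_Y (complex.Re (G Y))%:E =
   \int[nu]_x (rt2pi * (last_in P x * expR (- 2^-1 * (dotv x x - al * last_sum x ^+ 2))))%:E)%E.
  transitivity (\int[mu]_Y \int[nu]_x (complex.Re (linear_kernel al P (Y, x)))%:E)%E.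
    by apply: eq_integral => Y _; have [-> _] := inner_x Y.
  by rewrite FR; apply: eq_integral => x _; have [-> _] := inner_Y x.
have EI : (\int[mu]_Y (complex.Im (G Y))%:E = 0)%E.
  transitivity (\int[mu]_Y \int[nu]_x (complex.Im (linear_kernel al P (Y, x)))%:E)%E.
    by apply: eq_integral => Y _; have [_ ->] := inner_x Y.
  rewrite FI (eq_integral (cst 0%E)) ?integral0// => x _.
  by have [_ ->] := inner_Y x.
have wi : nu.-integrable setT (EFin \o (fun x => last_in P x * expR (- 2^-1 * (dotv x x - al * last_sum x ^+ 2)))).
  have mw : measurable_fun setT (fun x => (rt2pi * (last_in P x * expR (- 2^-1 * (dotv x x - al * last_sum x ^+ 2))))%:E : \bar R).
    have := measurable_fubini_G Ri; apply: eq_measurable_fun => x _.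
    by rewrite /fubini_G; have [-> _] := inner_Y x.
  have rwi : nu.-integrable setT (fun x => (rt2pi * (last_in P x * expR (- 2^-1 * (dotv x x - al * last_sum x ^+ 2))))%:E).
    apply/integrableP; split => //.
    under eq_integral do rewrite gee0_abs ?lee_fin ?mulr_ge0 ?expR_ge0 ?sqrtr_ge0 ?last_in_ge0//.
    by rewrite -ER ltey_eq (integrable_fin_num measurableT GR).
  have := @integrableZl _ _ _ nu setT measurableT rt2pi^-1 _ rwi.
  apply: eq_integrable => // x _.
  by rewrite -EFinM mulKf// sqrtr_eq0 -ltNge mulr_gt0// pi_gt0.
split; [exact: wi|by split|].
apply: complex_ext; rewrite [RHS]/=.
- rewrite -RintegralZl//.
  have := congr1 fine ER; exact.
- have := congr1 fine EI; exact.
Qed.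

End linearisation.

End gaussian_linearisation.

(** * The solid angle of a cone with rank-one Gram perturbation *)

Section cone_probability.
Variables (R : realType) (k m : nat) (c : R).
Hypothesis c1 : 0 < 1 + m%:R * c.
Local Notation mu := (@lebesgue_measure R).
Local Notation nu := (lebesgue_row R (k + m)).
Local Notation rt2pi := (Num.sqrt (2 * pi) : R).
Local Notation H := (`[0, +oo[%classic : set R).
Local Open Scope complex_scope.

(** Chosen so that (I + c J) (I - al J) = I. With s^2 = 1 + m c one has s^2 al = c and 1 - m al = 1
    / s^2, so the substitution Y = s y replaces al by c inside [Phi] and makes the outer Gaussian
    standard. *)
Let al := c / (1 + m%:R * c).
Let s := Num.sqrt (1 + m%:R * c).

Let s_gt0 : 0 < s. Proof. by rewrite sqrtr_gt0. Qed.
Let s2 : s ^+ 2 = 1 + m%:R * c. Proof. by rewrite sqr_sqrtr// ltW. Qed.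

Let rt2pi_gt0 : 0 < rt2pi. Proof. by rewrite sqrtr_gt0 mulr_gt0// pi_gt0. Qed.

Let one_al : 1 - m%:R * al = (s ^+ 2)^-1.
Proof. by rewrite s2 /al; field; rewrite gt_eqF. Qed.

Let m_al : m%:R * al < 1.
Proof. by rewrite -subr_gt0 one_al invr_gt0 exprn_gt0. Qed.

Let csqrt_s (y : R) : csqrt al * (s * y)%:C = csqrt c * y%:C.
Proof.
rewrite !csqrt_scale /al pmulr_lge0 ?invr_gt0//; case: ifP => [c0|/negbT]; last rewrite -ltNge => c0.
  by rewrite mulrA -sqrtrM ?mulfVK ?gt_eqF// divr_ge0// ltW.
by rewrite mulrA -mulNr -sqrtrM ?mulfVK ?gt_eqF// divr_ge0 ?oppr_ge0 ?ltW.
Qed.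

Lemma cintegralZ (a : R) (f : R -> R[i]) : cintegrable setT f ->
  cintegrable setT (fun y => a%:C * f y) /\
  cintegral setT (fun y => a%:C * f y) = a%:C * cintegral setT f.
Proof.
move=> [f1 f2]; split.
  split.
    have := @integrableZl _ _ _ mu setT measurableT a _ f1.
    by apply: eq_integrable => // y _; rewrite /= Re_realM EFinM.
  have := @integrableZl _ _ _ mu setT measurableT a _ f2.
  by apply: eq_integrable => // y _; rewrite /= Im_realM EFinM.
apply: complex_ext; rewrite ?Re_realM ?Im_realM /cintegral [LHS]/=.
- by rewrite -RintegralZl//; apply: eq_Rintegral => y _; rewrite Re_realM.
- by rewrite -RintegralZl//; apply: eq_Rintegral => y _; rewrite Im_realM.
Qed.

Lemma cintegral_scale (a : R) (f : R -> R[i]) : 0 < a -> cintegrable setT f ->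
  cintegrable setT (fun y => f (a * y)) /\
  cintegral setT f = a%:C * cintegral setT (fun y => f (a * y)).
Proof.
move=> a0 [f1 f2]; have an0 : a != 0 by rewrite gt_eqF.
have [r1 r2] := integrable_affine 0 an0 f1; have [i1 i2] := integrable_affine 0 an0 f2.
split.
  by split; [move: r1|move: i1]; apply: eq_integrable => // y _; rewrite /= addr0.
apply: complex_ext; rewrite ?Re_realM ?Im_realM /cintegral [LHS]/=.
- rewrite r2 gtr0_norm//; congr (_ * _); by apply: eq_Rintegral => y _; rewrite addr0.
- rewrite i2 gtr0_norm//; congr (_ * _); by apply: eq_Rintegral => y _; rewrite addr0.
Qed.

Let weight P (x : 'rV[R]_(k + m)) : R :=
  last_in P x * expR (- 2^-1 * (dotv x x - al * last_sum x ^+ 2)).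

Let scaled_linearisation (P : set R) (psi : R -> R[i]) :
  measurable (P : set (measurableTypeR R)) ->
  (forall Y, cintegral setT (gauss_kernel P (csqrt al * Y%:C)) =
    (rt2pi * expR (2^-1 * (al * Y ^+ 2)))%:C * psi Y) ->
  [/\ nu.-integrable setT (EFin \o weight P),
      cintegrable setT (fun y => psi (s * y) ^+ m * (expR (- y ^+ 2 / 2))%:C) &
      (\int[nu]_x weight P x)%:C = (rt2pi ^+ (k + m) * s)%:C *
        ((rt2pi^-1)%:C * cintegral setT (fun y => psi (s * y) ^+ m * (expR (- y ^+ 2 / 2))%:C))].
Proof.
move=> mP psiE; have [wi Fi FE] := gaussian_linearisation k mP m_al psiE.
pose K := rt2pi ^+ (k + m); have K0 : 0 < K by rewrite exprn_gt0.
have [Gi GE] := cintegral_scale s_gt0 Fi.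
have fE y : K%:C^-1 * (K%:C * ((expR (- 2^-1 * (1 - m%:R * al) * (s * y) ^+ 2))%:C * psi (s * y) ^+ m)) =
    psi (s * y) ^+ m * (expR (- y ^+ 2 / 2))%:C.
  rewrite mulKf; last by rewrite fmorph_eq0 gt_eqF.
  rewrite mulrC one_al; congr (_ * (expR _)%:C); field; by rewrite gt_eqF.
have [Hi HE] := cintegralZ K^-1 Gi.
have fE' : (fun y => (K^-1)%:C * (K%:C * ((expR (- 2^-1 * (1 - m%:R * al) * (s * y) ^+ 2))%:C * psi (s * y) ^+ m))) =
    (fun y => psi (s * y) ^+ m * (expR (- y ^+ 2 / 2))%:C).
  by apply/funext => y; rewrite fmorphV fE.
rewrite fE' in Hi HE; split => //.
have rt0 : rt2pi%:C != 0 by rewrite fmorph_eq0 gt_eqF.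
have {}FE : cintegral setT _ = (rt2pi * \int[nu]_x weight P x)%:C := FE.
have L : rt2pi%:C * (\int[nu]_x weight P x)%:C = (rt2pi * \int[nu]_x weight P x)%:C.
  by rewrite -rmorphM.
apply: (mulfI rt0); rewrite L -FE GE -/K HE.
have Kc0 : K%:C != 0 by rewrite fmorph_eq0 gt_eqF.
by rewrite rmorphM !fmorphV; field; rewrite Kc0 rt0.
Qed.

Lemma weighted_orthant : [/\ nu.-integrable setT (EFin \o weight H),
  cintegrable setT (angle_integrand c m) &
  (\int[nu]_x weight H x)%:C = (rt2pi ^+ (k + m) * s)%:C * angle_integral c m].
Proof.
have mH : measurable (H : set (measurableTypeR R)) by [].
have [wi ai aE] := scaled_linearisation mH (fun Y => cintegral_half_gauss_kernel al Y).
have E : (fun y : R => Phi (csqrt al * (s * y)%:C) ^+ m * (expR (- y ^+ 2 / 2))%:C) = angle_integrand c m.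
  by apply/funext => y; rewrite csqrt_s.
by rewrite E in ai aE; split.
Qed.

(** The normalising mass comes from the same identity with psi = 1, which avoids computing a
    determinant. *)
Lemma weighted_total : nu.-integrable setT (EFin \o weight setT) /\
  \int[nu]_x weight setT x = rt2pi ^+ (k + m) * s.
Proof.
have mT : measurable (setT : set (measurableTypeR R)) by [].
have [|wi _ aE] := @scaled_linearisation setT (cst 1) mT.
  by move=> Y; rewrite mulr1 cintegral_gauss_kernel.
split => //.
have c0 : - 2^-1 < 0 :> R by rewrite oppr_lt0 invr_gt0 ltr0n.
have gE : \int[mu]_y expR (- 2^-1 * y ^+ 2) = rt2pi.
  rewrite Rintegral_half_lines; last exact: integrable_gauss.
  under [X in _ + X]eq_Rintegral do rewrite sqrrN.
  by rewrite /Rintegral integral_half_gauss /= -splitr.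
have E y : cst 1 (s * y) ^+ m * (expR (- y ^+ 2 / 2))%:C = (expR (- 2^-1 * y ^+ 2))%:C.
  by rewrite /= expr1n mul1r halfNE.
move: aE; rewrite (cintegral_real _ E) gE -!rmorphM /= mulVf ?gt_eqF// mulr1.
by move=> /(congr1 (@complex.Re R)).
Qed.

Variable S : 'M[R]_m.
Hypotheses (ST : S^T = S) (SS : S *m S = 1%:M + c *: const_mx 1).

Let J : 'M[R]_m := const_mx 1.

Let JJ : J *m J = m%:R *: J.
Proof.
apply/matrixP => i j; rewrite !mxE (eq_bigr (fun=> 1)); last by move=> l _; rewrite !mxE mulr1.
by rewrite sumr_const card_ord mulr1.
Qed.

Let SSJ : S *m (S *m (1%:M - al *: J)) = 1%:M.
Proof.
rewrite mulmxA SS mulmxBr mulmx1 mulmxDl mul1mx -!scalemxAl -!scalemxAr JJ -/J !scalerA.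
rewrite -addrA -[RHS]addr0; congr (_ + _).
rewrite opprD addrA -scalerBl -scalerBl (_ : _ - _ = 0) ?scale0r//.
by rewrite /al; field; rewrite gt_eqF.
Qed.

Let Su : S \in unitmx. Proof. by have [] := mulmx1_unit SSJ. Qed.

Let SJS : S *m (1%:M - al *: J) *m S = 1%:M.
Proof. by have := mulmx1C SSJ. Qed.

Lemma dotvE n (u v : 'rV[R]_n) : dotv u v = (u *m v^T) 0 0.
Proof. by rewrite mxE; apply: eq_bigr => i _; rewrite mxE. Qed.

Let M : 'M[R]_(k + m) := block_mx 1%:M 0 0 S.

Let xM (x : 'rV[R]_(k + m)) : x *m M = row_mx (lsubmx x) (rsubmx x *m S).
Proof. by rewrite -{1}[x]hsubmxK mul_row_block !mulmx0 mulmx1 addr0 add0r. Qed.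

Lemma dotv_row_mx n1 n2 (a : 'rV[R]_n1) (b : 'rV[R]_n2) a' b' :
  dotv (row_mx a b) (row_mx a' b') = dotv a a' + dotv b b'.
Proof. by rewrite !dotvE tr_row_mx mul_row_col mxE. Qed.

(** Amounts to S (I - al J) S = I on the last block, so the substitution by [M] turns the weight
    into the standard Gaussian. *)
Let quadratic_form x : dotv (x *m M) (x *m M) - al * last_sum (x *m M) ^+ 2 = dotv x x.
Proof.
rewrite -[in RHS](hsubmxK x) xM !dotv_row_mx -addrA; congr (_ + _).
set y := rsubmx x.
have -> : last_sum (row_mx (lsubmx x) (y *m S)) = (y *m S *m (const_mx 1 : 'cV_m)) 0 0.
  rewrite mxE; apply: eq_bigr => j _; by rewrite row_mxEr [const_mx _ _ _]mxE mulr1.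
set u : 'cV[R]_m := const_mx 1.
have uu : u *m u^T = J by apply/matrixP => i j; rewrite !mxE big_ord1 !mxE mulr1.
have -> : ((y *m S *m u) 0 0) ^+ 2 = (y *m S *m J *m S *m y^T) 0 0.
  have <- : y *m S *m u *m (y *m S *m u)^T = y *m S *m J *m S *m y^T.
    by rewrite -uu !trmx_mul ST !mulmxA.
  by rewrite [RHS]mxE big_ord1 [_^T _ _]mxE expr2.
rewrite !dotvE trmx_mul ST.
transitivity ((y *m (S *m (1%:M - al *: J) *m S) *m y^T) 0 0); last by rewrite SJS mulmx1.
rewrite mulmxBr mulmx1 mulmxBl -scalemxAr -scalemxAl mulmxBr mulmxBl -scalemxAr -scalemxAl.
have entryB (A B : 'M[R]_1) : (A - al *: B) 0 0 = A 0 0 - al * B 0 0 by rewrite !mxE.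
by rewrite entryB !mulmxA.
Qed.

(** For invertible S this is R^k times the cone spanned by the rows of the inverse of S. Written
    with inequalities it is visibly measurable. *)
Definition last_cone : set 'rV[R]_(k + m) := [set x | forall j, 0 <= (rsubmx x *m S) 0 j].

Lemma measurable_last_cone : measurable last_cone.
Proof.
have -> : last_cone = \bigcap_(j in [set: 'I_m]) [set x : 'rV[R]_(k + m) | 0 <= (x *m M) 0 (rshift k j)].
  apply/seteqP; split => x; first by move=> xK j _ /=; rewrite xM row_mxEr.
  by move=> xK j; have := xK j Logic.I; rewrite /= xM row_mxEr.
apply: fin_bigcap_measurable => // j _.
have mf : measurable_fun setT (fun x : 'rV[R]_(k + m) => (x *m M) 0 (rshift k j)).
  exact: (measurableT_comp (measurable_coord (rshift k j)) (measurable_mulmx M)).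
rewrite -[X in measurable X]setTI.
have := mf measurableT `[0, +oo[%classic (measurable_itv _).
by congr measurable; apply/seteqP; split => x /=; rewrite in_itv/= andbT.
Qed.

Let last_cone_indic x : last_in H (x *m M) = \1_last_cone x.
Proof.
rewrite indicE; have [/set_mem xK|xK] := boolP (x \in last_cone).
  rewrite /last_in big1// => j _; rewrite indicE mem_set//= in_itv/= andbT.
  by rewrite xM row_mxEr.
have [j xj] : exists j, ~ 0 <= (rsubmx x *m S) 0 j.
  by apply/existsNP => h; move/negP : xK; apply; exact/mem_set.
rewrite /last_in (bigD1 j)//= indicE memNset ?mul0r//=.
by rewrite in_itv/= andbT xM row_mxEr.
Qed.

(** Both for the cone and for the whole space, K times the volume in the unit ball equals [cM] times
    a weighted integral; the two unknown constants cancel in the quotient. *)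
Lemma cone_solid_angle : [/\
   (0 < fine (nu (@ball1 R (k + m))))%R, (nu (@ball1 R (k + m)) < +oo)%E &
   (fine (nu (last_cone `&` @ball1 R (k + m))) / fine (nu (@ball1 R (k + m))))%:C =
   angle_integral c m].
Proof.
have [wH _ EH] := weighted_orthant; have [wT ET] := weighted_total.
have Mu : M \in unitmx by rewrite unitmxE /M det_ublock det1 mul1r -unitmxE.
have [cM [cM0 scaleM]] := unitmx_scales_integral Mu.
have w0 P x : 0 <= weight P x by rewrite mulr_ge0 ?expR_ge0// last_in_ge0.
have mw P : nu.-integrable setT (EFin \o weight P) -> measurable_fun setT (EFin \o weight P).
  exact: measurable_int.
pose D := rt2pi ^+ (k + m) * s.
have D0 : 0 < D by rewrite mulr_gt0// exprn_gt0.
pose N := \int[nu]_x weight H x.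
have EHM : (\int[nu]_x (\1_last_cone x * expR (- 2^-1 * dotv x x))%:E = (cM * N)%:E)%E.
  transitivity (\int[nu]_x (EFin \o weight H) (x *m M))%E.
    by apply: eq_integral => x _; rewrite /= /weight quadratic_form last_cone_indic.
  rewrite (scaleM _ (mw _ wH)); last by move=> x; rewrite /= lee_fin.
  by rewrite EFinM /N /Rintegral fineK//; exact: integrable_fin_num wH.
have ETM : (\int[nu]_x (\1_setT x * expR (- 2^-1 * dotv x x))%:E = (cM * D)%:E)%E.
  transitivity (\int[nu]_x (EFin \o weight setT) (x *m M))%E.
    apply: eq_integral => x _; rewrite /= /weight quadratic_form indicT.
    by rewrite /last_in big1 ?mul1r// => j _; rewrite indicT.
  rewrite (scaleM _ (mw _ wT)); last by move=> x; rewrite /= lee_fin.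
  by rewrite EFinM /D -ET /Rintegral fineK//; exact: integrable_fin_num wT.
have [K K0 KE] := gauss_integral_cone R (k + m).
have mB := @measurable_dotv_le R (k + m) 1.
have mK := measurable_last_cone.
have coneE : (K * nu (last_cone `&` @ball1 R (k + m)) = (cM * N)%:E)%E.
  rewrite -EHM KE// => r x r0 xK j.
  by rewrite linearZ /= -scalemxAl mxE mulr_ge0// ?xK// ltW.
have ballE : (K * nu (@ball1 R (k + m)) = (cM * D)%:E)%E.
  by rewrite -ETM KE// setTI.
have nuK : (nu (last_cone `&` @ball1 R (k + m)) <= nu (@ball1 R (k + m)))%E.
  by apply: le_measure; rewrite ?inE//; exact: measurableI.
have : (0 <= nu (@ball1 R (k + m)))%E by [].
have : (0 <= nu (last_cone `&` @ball1 R (k + m)))%E by [].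
have cMD : 0 < cM * D by exact: mulr_gt0.
move: coneE ballE nuK K0.
move: (nu (last_cone `&` @ball1 R (k + m))) (nu (@ball1 R (k + m))) => a b.
(* A priori K may be 0 or infinite. Its product with the volume of the ball is the positive real
   [cM * D], which excludes both and also shows that the ball has positive finite volume. *)
case: K {KE} => [r| |]//; last first.
  move=> _ + _ _ _; case: b => [b| |]//.
  move=> bE; rewrite lee_fin le_eqVlt => /orP[/eqP b0|b_gt0].
    by move: bE; rewrite -b0 mule0 => -[cE]; rewrite -cE ltxx in cMD.
  by move: bE; rewrite gt0_mulye// lte_fin.
move=> aE bE ab r0 a0 b0.
have r_gt0 : 0 < r.
  rewrite lt_neqAle -lee_fin r0 andbT eq_sym; apply/eqP => rE; move: bE; rewrite rE mul0e => -[] cE.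
  by rewrite cE ltxx in cMD.
case: b bE ab b0 => [b| |]//; last by rewrite gt0_muley// lte_fin.
case: a aE a0 => [a| |]//.
move=> [aE] a0 [bE] ab b0 /=.
have b_gt0 : 0 < b by rewrite -(pmulr_rgt0 _ r_gt0) bE.
split; [by []|exact: ltry|].
have Dc0 : D%:C != 0 by rewrite fmorph_eq0 gt_eqF.
have -> : a / b = N / D.
  have rn0 : r != 0 by rewrite gt_eqF.
  have cn0 : cM != 0 by rewrite gt_eqF.
  have -> : a = r^-1 * (cM * N) by rewrite -aE mulKf.
  have -> : b = r^-1 * (cM * D) by rewrite -bE mulKf.
  by field; rewrite !gt_eqF.
have EHN : N%:C = D%:C * angle_integral c m by exact: EH.
have -> : (N / D)%:C = N%:C / D%:C by rewrite rmorphM fmorphV.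
by rewrite EHN mulrAC mulfV// mul1r.
Qed.

End cone_probability.

(** * Isometries of polyhedral cones *)

Section solid_angles.
Variable R : realType.
Implicit Types n m : nat.

Lemma vol_preimage_mul n (Q : 'M[R]_n) : Q \in unitmx ->
  exists2 c : R, 0 < c & forall A : set 'rV[R]_n, measurable A ->
    vol [set x | A (x *m Q)] = (c%:E * lebesgue_row R n A)%E.
Proof.
move=> /unitmx_scales_integral[c [c0 cE]]; exists c => // A mA.
have mAQ : measurable [set x : 'rV[R]_n | A (x *m Q)].
  by rewrite -[X in measurable X]setTI; exact: measurable_mulmx.
have mi : measurable_fun setT (fun x : 'rV[R]_n => (\1_A x)%:E : \bar R).
  by apply/measurable_EFinP; exact: measurable_indic.
rewrite -lebesgue_rowE// -[X in lebesgue_row R n X]setIT -integral_indic//.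
rewrite -[in RHS](setIT A) -[in RHS]integral_indic// -cE//.
Qed.

Lemma lin_hull_sum n (S : set 'rV[R]_n) p (c : 'I_p -> R) (u : 'I_p -> 'rV[R]_n) :
  (forall i, lin_hull S (u i)) -> lin_hull S (\sum_i c i *: u i).
Proof.
have hull0 : lin_hull S 0.
  by exists 0%N, (fun=> 0), (fun=> 0); split => [[]//|]; rewrite big_ord0.
have hullD x y : lin_hull S x -> lin_hull S y -> lin_hull S (x + y).
  move=> [n1 [c1 [s1 [h1 ->]]]] [n2 [c2 [s2 [h2 ->]]]].
  exists (n1 + n2)%N,
    (fun i : 'I_(n1 + n2) => match fintype.split i with inl j => c1 j | inr j => c2 j end),
    (fun i : 'I_(n1 + n2) => match fintype.split i with inl j => s1 j | inr j => s2 j end).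
  split; first by move=> i; case: (fintype.split i).
  rewrite big_split_ord /=; congr (_ + _); apply: eq_bigr => i _.
    by rewrite (unsplitK (inl i)).
  by rewrite (unsplitK (inr i)).
have hullZ a x : lin_hull S x -> lin_hull S (a *: x).
  move=> [n1 [c1 [s1 [h1 ->]]]]; exists n1, (fun i => a * c1 i), s1; split => //.
  by rewrite scaler_sumr; apply: eq_bigr => i _; rewrite scalerA.
by move=> h; elim/big_ind : _ => // i _; exact: hullZ.
Qed.

Lemma sub_lin_hull n (S : set 'rV[R]_n) u : S u -> lin_hull S u.
Proof.
move=> Su; exists 1%N, (fun=> 1), (fun=> u); split => //.
by rewrite big_ord1 scale1r.
Qed.

Lemma lin_hullB n (S : set 'rV[R]_n) u v :
  lin_hull S u -> lin_hull S v -> lin_hull S (u - v).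
Proof.
move=> Su Sv.
have := @lin_hull_sum n S 2 (fun i => if i == 0 then 1 else -1) (fun i => if i == 0 then u else v).
rewrite big_ord_recl big_ord1 /= scale1r scaleN1r; apply.
by move=> i; case: ifP.
Qed.

Lemma dotv_delta n (i j : 'I_n) :
  dotv (delta_mx 0 i : 'rV[R]_n) (delta_mx 0 j) = (i == j)%:R.
Proof.
rewrite /dotv (bigD1 i)//= big1 => [|l li]; last by rewrite mxE (negbTE li) andbF mul0r.
by rewrite !mxE !eqxx mul1r addr0.
Qed.

Lemma dotv0l n (u : 'rV[R]_n) : dotv 0 u = 0.
Proof. by rewrite /dotv big1// => i _; rewrite mxE mul0r. Qed.

Lemma dotv_eq0 n (u : 'rV[R]_n) : dotv u u = 0 -> u = 0.
Proof.
move=> /eqP; rewrite psumr_eq0 => [/allP u0|i _]; last by rewrite -expr2 sqr_ge0.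
apply/rowP => i; rewrite mxE; apply/eqP.
by have := u0 i (mem_index_enum _); rewrite /= mulf_eq0 orbb.
Qed.

Lemma mulmx_tr_dotv n p q (A : 'M[R]_(p, n)) (B : 'M[R]_(q, n)) i j :
  (A *m B^T) i j = dotv (row i A) (row j B).
Proof. by rewrite mxE; apply: eq_bigr => l _; rewrite !mxE. Qed.

(** Because [solid_angle] selects its value by [get], every orthonormal basis of the hull must give
    v ([valueE]) and at least one must exist. The isometry carries such a basis to an orthogonal
    matrix Q, whose volume factor cancels; definiteness of the form makes f injective on the
    hull. *)
Lemma solid_angle_isometric (C : icone R) n (K : set 'rV[R]_n) :
  (forall u, cform C u u = 0 -> u = 0) ->
  lin_hull K = setT -> measurable K ->
  0 < fine (lebesgue_row R n (@ball1 R n)) ->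
  (lebesgue_row R n (@ball1 R n) < +oo)%E ->
  isometric C (euclidean_cone K) ->
  solid_angle C = fine (lebesgue_row R n (K `&` @ball1 R n)) /
                  fine (lebesgue_row R n (@ball1 R n)).
Proof.
move=> Cdef Kfull mK B0 Boo [f [fform fhull fcone]].
rewrite /= in f fform fhull fcone; rewrite Kfull in fhull.
set v := RHS; set L := lin_hull (cset C).
have inj u w : L u -> L w -> f u = f w -> u = w.
  move=> Lu Lw fuw; apply/eqP; rewrite -subr_eq0; apply/eqP; apply: Cdef.
  have Luw : L (u - w) by exact: lin_hullB.
  by rewrite -fform// linearB /= fuw subrr dotv0l.
have nuK : (lebesgue_row R n (K `&` @ball1 R n) <= lebesgue_row R n (@ball1 R n))%E.
  by apply: le_measure; rewrite ?inE//; [apply: measurableI => //|]; exact: measurable_dotv_le.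
have valueE p (E : 'M[R]_(p, cdim C)) : orthonormal_basis (cform C) L E ->
    fine (vol [set c : 'rV[R]_p | (cset C `&` [set u | cform C u u <= 1]) (c *m E)]) /
    fine (vol [set c : 'rV[R]_p | (L `&` [set u | cform C u u <= 1]) (c *m E)]) = v.
  move=> [orthE LE].
  have LcE (c : 'rV[R]_p) : L (c *m E) by rewrite LE; exists c.
  pose Q := E *m lin1_mx f.
  have fE (c : 'rV[R]_p) : f (c *m E) = c *m Q by rewrite /Q mulmxA mul_rV_lin1.
  have QQ : Q *m Q^T = 1%:M.
    apply/matrixP => i j; rewrite [RHS]mxE -orthE -fform//; last 2 first.
    - by rewrite rowE; exact: LcE.
    - by rewrite rowE; exact: LcE.
    by rewrite !rowE !fE -!rowE mulmx_tr_dotv.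
  have Qsurj y : exists c : 'rV[R]_p, c *m Q = y.
    have : setT y by []; rewrite -fhull => -[u Lu <-].
    by move: Lu; rewrite -/L LE => -[c _ <-]; exists c; rewrite fE.
  (* Surjectivity of f on the hull gives Z with Z Q = 1. Together with Q Q^T = 1 this forces p =
     n. *)
  have [Z ZQ] : exists Z : 'M[R]_(n, p), Z *m Q = 1%:M.
    exists (\matrix_i xget 0 [set c : 'rV[R]_p | c *m Q = row i 1%:M]).
    apply/row_matrixP => i; rewrite row_mul rowK.
    by case: xgetP => [c _ -> //|/(_ _)]; have [c cE] := Qsurj (row i 1%:M); move=> /(_ c).
  have pn : p = n.
    by apply/eqP; rewrite eqn_leq (mulmx1_min QQ) (mulmx1_min ZQ).
  subst p.
  have Qu : Q \in unitmx by have [] := mulmx1_unit QQ.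
  have [c c0 cE] := vol_preimage_mul Qu.
  have formE (y : 'rV[R]_n) : cform C (y *m E) (y *m E) = dotv (y *m Q) (y *m Q).
    by rewrite -fE (fform _ _ (LcE y) (LcE y)).
  have coneE (y : 'rV[R]_n) : cset C (y *m E) <-> K (y *m Q).
    rewrite -fE -fcone; split; first by exists (y *m E).
    move=> [w Cw fw].
    by rewrite -(inj _ _ (sub_lin_hull Cw) (LcE y) fw).
  have -> : [set y : 'rV[R]_n | (cset C `&` [set u | cform C u u <= 1]) (y *m E)] =
      [set y | (K `&` @ball1 R n) (y *m Q)].
    by apply/seteqP; split=> y [] /= /coneE Ky; rewrite formE.
  have -> : [set y : 'rV[R]_n | (L `&` [set u | cform C u u <= 1]) (y *m E)] =
      [set y | (@ball1 R n) (y *m Q)].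
    apply/seteqP; split=> y; first by move=> [_ /=]; rewrite formE.
    by move=> yQ; split; [exact: LcE|rewrite /= formE].
  have mB := @measurable_dotv_le R n 1.
  rewrite !cE//; last exact: measurableI.
  have Bfin : lebesgue_row R n (@ball1 R n) \is a fin_num by rewrite ge0_fin_numE.
  have Kfin : lebesgue_row R n (K `&` @ball1 R n) \is a fin_num.
    by rewrite ge0_fin_numE//; exact: le_lt_trans nuK Boo.
  rewrite !fineM//= /v.
  by field; rewrite !gt_eqF.
have [E [orthE LE]] : exists E : 'M[R]_(n, cdim C), orthonormal_basis (cform C) L E.
  have pre i : exists u, L u /\ f u = delta_mx 0 i.
    have : setT (delta_mx 0 i : 'rV[R]_n) by []; rewrite -fhull => -[u Lu uE].
    by exists u.
  pose e i := xget 0 [set u | L u /\ f u = delta_mx 0 i].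
  have eP i : L (e i) /\ f (e i) = delta_mx 0 i.
    rewrite /e; case: xgetP => [u _ //|/(_ _) h]; have [u uP] := pre i.
    by have := h u.
  pose E := \matrix_i e i.
  have cEE (c : 'rV[R]_n) : c *m E = \sum_i c 0 i *: e i.
    by rewrite mulmx_sum_row; apply: eq_bigr => i _; rewrite rowK.
  have LcE (c : 'rV[R]_n) : L (c *m E).
    by rewrite cEE; apply: lin_hull_sum => i; have [] := eP i.
  exists E; split.
    move=> i j; rewrite !rowK; have [Li fi] := eP i; have [Lj fj] := eP j.
    by rewrite -fform// fi fj dotv_delta.
  apply/seteqP; split => u; last by move=> [c _ <-].
  move=> Lu; exists (f u) => //; apply/esym/inj => //.
  rewrite cEE linear_sum /=.
  rewrite [LHS]row_sum_delta; apply: eq_bigr => i _.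
  by have [_ fi] := eP i; rewrite linearZ /= fi.
rewrite /solid_angle -/L.
set T := [set t | _].
have TE t : T t -> t = v by move=> [p [F [orthF ->]]]; exact: valueE.
have Tv : T v by exists n, E; split => //; rewrite valueE.
exact: TE (getI Tv).
Qed.

End solid_angles.

(** * Square roots and inverses of I + c J *)

Section rank_one_square_root.
Variables (R : realType) (m : nat).

Let J : 'M[R]_m := const_mx 1.

Lemma mul_rank_one (x y : R) :
  (1%:M + x *: J) *m (1%:M + y *: J) = 1%:M + (x + y + m%:R * x * y) *: J.
Proof.
have JJ : J *m J = m%:R *: J.
  apply/matrixP => i j; rewrite !mxE (eq_bigr (fun=> 1)); last by move=> l _; rewrite !mxE mulr1.
  by rewrite sumr_const card_ord mulr1.
rewrite mulmxDl mul1mx !mulmxDr mulmx1 -!scalemxAl -!scalemxAr JJ !scalerA -!addrA.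
by congr (_ + _); rewrite addrA -!scalerDl; congr (_ *: _); ring.
Qed.

Lemma inv_rank_one_sqrt (S : 'M[R]_m) (x y : R) : S \in unitmx ->
  S *m S = 1%:M + x *: J -> x + y + m%:R * x * y = 0 ->
  invmx S *m invmx S = 1%:M + y *: J.
Proof.
move=> Su SS xy0.
have E : S *m S *m (1%:M + y *: J) = 1%:M by rewrite SS mul_rank_one xy0 scale0r addr0.
rewrite -[RHS](mulKmx Su) -[S *m _](mulKmx Su) [S *m (S *m _)]mulmxA E.
by rewrite mulmx1.
Qed.

Lemma rank_one_sqrt (c : R) : 0 < 1 + m%:R * c ->
  exists S : 'M[R]_m, [/\ S^T = S, S *m S = 1%:M + c *: const_mx 1 & S \in unitmx].
Proof.
move=> c1.
have JT : J^T = J by apply/matrixP => i j; rewrite !mxE.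
pose r := Num.sqrt (1 + m%:R * c).
have r2 : r ^+ 2 = 1 + m%:R * c by rewrite sqr_sqrtr// ltW.
have r0 : 0 < r by rewrite sqrtr_gt0.
(* The root is sought as I + t J, which acts as 1 + m t on the all-ones vector; hence 1 + m t =
   r. *)
pose t := (r - 1) / m%:R.
have [m0|m0] := eqVneq m 0%N.
  exists 1%:M; split; [exact: trmx1| |exact: unitmx1].
  by apply/matrixP => i; exfalso; case: i; rewrite m0.
have mn0 : m%:R != 0 :> R by rewrite pnatr_eq0.
have mt : m%:R * t = r - 1 by rewrite /t mulrC divfK.
exists (1%:M + t *: J); split.
- by rewrite linearD /= linearZ /= trmx1 JT.
- rewrite mul_rank_one; congr (_ + _ *: _); apply: (mulfI mn0).
  have -> : m%:R * (t + t + m%:R * t * t) = (m%:R * t + 1) ^+ 2 - 1 by ring.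
  by rewrite mt subrK r2 addrC addKr.
- pose u := - (t / r).
  have : (1%:M + t *: J) *m (1%:M + u *: J) = 1%:M.
    rewrite mul_rank_one (_ : t + u + m%:R * t * u = 0) ?scale0r ?addr0//.
    by rewrite mt /u; field; rewrite gt_eqF.
  by case/mulmx1_unit.
Qed.

End rank_one_square_root.

(** * Orthonormal frames of a positive definite form *)

Section frames.
Variables (R : realType) (d : nat) (G : 'M[R]_d).
Hypotheses (GT : G^T = G) (Gpos : forall u : 'rV[R]_d, u != 0 -> 0 < (u *m G *m u^T) 0 0).

Lemma orthogonal_sym m k (A : 'M[R]_(m, d)) (B : 'M[R]_(k, d)) :
  A *m G *m B^T = 0 -> B *m G *m A^T = 0.
Proof.
move=> AB; apply: trmx_inj.
by rewrite trmx0 !trmx_mul trmxK GT mulmxA AB.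
Qed.

Lemma orthonormal_col_mx m k (A : 'M[R]_(m, d)) (B : 'M[R]_(k, d)) :
  A *m G *m A^T = 1%:M -> B *m G *m B^T = 1%:M -> A *m G *m B^T = 0 ->
  col_mx A B *m G *m (col_mx A B)^T = 1%:M.
Proof.
move=> AA BB AB.
by rewrite tr_col_mx mul_col_mx mul_col_row AA BB AB (orthogonal_sym AB) -scalar_mx_block.
Qed.

(** One vector at a time: by a dimension count some nonzero u is orthogonal to all rows found so
    far, and its normalisation is added. *)
Lemma orthonormal_extension m k (E : 'M[R]_(m, d)) : (k + m <= d)%N ->
  E *m G *m E^T = 1%:M ->
  exists2 Q : 'M[R]_(k, d), Q *m G *m Q^T = 1%:M & Q *m G *m E^T = 0.
Proof.
move=> km EE; elim: k km => [|k IH] km.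
  by exists 0; [apply/matrixP => -[]|rewrite !mul0mx].
have [Q QQ QE] := IH (leq_trans (leqnSn _) km).
pose W := G *m (col_mx Q E)^T.
have : kermx W != 0.
  rewrite kermx_eq0 /row_free neq_ltn; apply/orP; left.
  exact: leq_ltn_trans (rank_leq_col W) km.
rewrite -nz_row_eq0; set u := nz_row _ => u0.
have uW : u *m W = 0 by apply/sub_kermxP; exact: nz_row_sub.
have uQE : u *m G *m Q^T = 0 /\ u *m G *m E^T = 0.
  move: uW; rewrite /W tr_col_mx mulmxA mul_mx_row -[0]row_mx0.
  by move=> /eq_row_mx.
pose r := Num.sqrt ((u *m G *m u^T) 0 0).
have r0 : 0 < r by rewrite sqrtr_gt0 Gpos.
have r2 : r ^+ 2 = (u *m G *m u^T) 0 0 by rewrite sqr_sqrtr// ltW// Gpos.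
pose u' := r^-1 *: u.
have u'Q : u' *m G *m Q^T = 0 by rewrite -!scalemxAl uQE.1 scaler0.
have uu' : u' *m G *m u'^T = 1%:M.
  apply/rowP => i; rewrite ord1 linearZ /= -scalemxAr -!scalemxAl scalerA.
  by rewrite mxE -r2 mxE eqxx -invfM -expr2 mulVf// expf_neq0// gt_eqF.
exists (col_mx u' Q : 'M[R]_(1 + k, d)).
  by apply: (@orthonormal_col_mx 1 k) => //.
by rewrite !(@mul_col_mx _ 1 k) QE -!scalemxAl uQE.2 scaler0 (@col_mx0 _ 1 k).
Qed.

End frames.

Section isometry_lemmas.
Variable R : realType.

Lemma lin_hull_image n p (f : {linear 'rV[R]_n -> 'rV[R]_p}) (A : set 'rV[R]_n) :
  f @` lin_hull A = lin_hull (f @` A).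
Proof.
apply/seteqP; split => y.
  move=> [_ [q [c [s [sA ->]]]] <-]; rewrite linear_sum.
  rewrite (eq_bigr (fun i => c i *: f (s i))) => [|i _]; last by rewrite linearZ.
  by apply: lin_hull_sum => i; apply: sub_lin_hull; exists (s i).
move=> [q [c [s [sA ->]]]].
have sE i : exists x, A x /\ f x = s i by have [x Ax xE] := sA i; exists x.
pose t i := xget 0 [set x | A x /\ f x = s i].
have tP i : A (t i) /\ f (t i) = s i by exact: (xgetPex 0 (sE i)).
exists (\sum_i c i *: t i).
  by exists q, c, t; split => // i; have [] := tP i.
by rewrite linear_sum; apply: eq_bigr => i _; rewrite linearZ /= (tP i).2.
Qed.

Lemma isometric_mulmx (C D : icone R) (P : 'M[R]_(cdim C, cdim D)) :
  (forall u v, lin_hull (cset C) u -> lin_hull (cset C) v ->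
     cform D (u *m P) (v *m P) = cform C u v) ->
  (forall u, cset C u -> cset D (u *m P)) ->
  (forall y, cset D y -> exists2 u, cset C u & u *m P = y) ->
  isometric C D.
Proof.
move=> formP CD DC.
have imP : mulmxr P @` cset C = cset D.
  by apply/seteqP; split => y; [move=> [u Cu <-]; exact: CD|move=> /DC[u Cu uE]; exists u].
by exists (mulmxr P); split => //; rewrite lin_hull_image imP.
Qed.

Lemma pos_hull_rows m (A : 'M[R]_m) y : A \in unitmx ->
  pos_hull (fun i => 1 *: row i A) y <-> forall j, 0 <= (y *m invmx A) 0 j.
Proof.
move=> Au; split.
  move=> [c [c0 ->]] j.
  rewrite (_ : \sum_i _ = (\row_i c i) *m A).
    by rewrite mulmxK// mxE.
  by rewrite mulmx_sum_row; apply: eq_bigr => i _; rewrite scale1r mxE.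
move=> y0; exists (fun i => (y *m invmx A) 0 i); split => //.
rewrite -[LHS](mulmxKV Au) mulmx_sum_row.
by apply: eq_bigr => i _; rewrite scale1r.
Qed.

(** The factor [1 *:] is the sign [eps i] of the definition, kept so that the cones agree
    literally. *)
Lemma orthocentric_rows m (A : 'M[R]_m) (lam0 : R) : lam0 != 0 -> A \in unitmx ->
  A *m A^T = 1%:M + lam0^-1 *: const_mx 1 ->
  is_orthocentric_cone lam0 (fun _ : 'I_m => 1) (fun _ => 1)
    (euclidean_cone (pos_hull (fun i => 1 *: row i A))).
Proof.
move=> l0 Au AA; split => //; first by move=> i; left.
exists m, (fun i => row i A); split => //.
- move=> c; rewrite (_ : \sum_i _ = (\row_i c i) *m A); last first.
    by rewrite mulmx_sum_row; apply: eq_bigr => i _; rewrite mxE.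
  move=> cA; have : (\row_i c i) = 0 by rewrite -[LHS](mulmxK Au) cA mul0mx.
  by move=> /rowP c0 i; have := c0 i; rewrite !mxE.
- by move=> i j; rewrite -mulmx_tr_dotv AA !mxE mulr1 divr1 addrC.
Qed.

End isometry_lemmas.

(** * Euclidean coordinates for a cone and its dual *)

Section dual_pair_of_cones.
Variables (R : realType) (k m : nat) (G : 'M[R]_(k + m)) (H : 'M[R]_(m, k + m)) (S : 'M[R]_m).
Hypotheses (GT : G^T = G)
  (Gpos : forall u : 'rV[R]_(k + m), u != 0 -> 0 < (u *m G *m u^T) 0 0)
  (ST : S^T = S) (Su : S \in unitmx) (HGH : H *m invmx G *m H^T = S *m S).

Let g (u v : 'rV[R]_(k + m)) : R := (u *m G *m v^T) 0 0.
Let T : set 'rV[R]_(k + m) := [set u | forall i, (u *m H^T) 0 i <= 0].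
Let N : set 'rV[R]_(k + m) := [set v | forall u, T u -> g v u <= 0].

Lemma posdef_unitmx : G \in unitmx.
Proof.
rewrite -row_free_unit -kermx_eq0; apply/eqP/row_matrixP => i; rewrite row0.
apply/eqP; apply: contraT => /Gpos.
have /sub_kermxP -> : (row i (kermx G) <= kermx G)%MS by exact: row_sub.
by rewrite mul0mx mxE ltxx.
Qed.

Let SiT : (invmx S)^T = invmx S. Proof. by rewrite trmx_inv ST. Qed.
Let GiT : (invmx G)^T = invmx G. Proof. by rewrite trmx_inv GT. Qed.

(** The rows of S^-1 H G^-1 are G-orthonormal because H G^-1 H^T = S^2. Completing them by k vectors
    gives coordinates in which the metric is Euclidean and the functionals in H see only the last m
    coordinates, through S. *)
Lemma cone_frame : exists2 X : 'M[R]_(k + m), X \in unitmx &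
  (forall u v : 'rV[R]_(k + m), dotv (u *m X) (v *m X) = g u v) /\
  (forall u : 'rV[R]_(k + m), rsubmx (u *m X) *m S = u *m H^T).
Proof.
have Gu := posdef_unitmx.
pose E := invmx S *m H *m invmx G.
have EE : E *m G *m E^T = 1%:M.
  rewrite /E mulmxKV// !trmx_mul GiT SiT !mulmxA -(mulmxA _ H) -(mulmxA _ (H *m _)) HGH.
  by rewrite mulmxA mulVmx// mul1mx mulmxV.
have [Q QQ QE] := orthonormal_extension GT Gpos (leqnn _) EE.
pose F := col_mx Q E.
have FF : F *m (G *m F^T) = 1%:M.
  by rewrite mulmxA; exact: orthonormal_col_mx.
have FF' := mulmx1C FF.
exists (G *m F^T); first by have [] := mulmx1_unit FF.
split.
  move=> u v; rewrite dotvE trmx_mul trmx_mul trmxK GT /g.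
  have -> : u *m (G *m F^T) *m (F *m G *m v^T) = u *m (G *m F^T *m F) *m G *m v^T.
    by rewrite !mulmxA.
  by rewrite FF' mulmx1.
move=> u; rewrite /F tr_col_mx !mul_mx_row row_mxKr /E !trmx_mul GiT SiT.
by rewrite !mulmxA -(mulmxA u) mulmxV// mulmx1 mulmxKV.
Qed.

Lemma tangent_isometric : isometric (ICone g T)
  (osum (whole_space R k) (euclidean_cone (pos_hull (fun i => 1 *: row i (invmx S))))).
Proof.
have [X Xu [Xg XS]] := cone_frame.
have Siu : invmx S \in unitmx by rewrite unitmx_inv.
(* The minus sign turns the inequalities <= 0 defining T into the >= 0 of a positive hull. *)
apply: (@isometric_mulmx _ (ICone g T) (osum (whole_space R k) (euclidean_cone _)) (- X)) => /=.
- move=> u v _ _; rewrite -dotv_row_mx !hsubmxK -Xg !mulmxN.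
  by rewrite /dotv; apply: eq_bigr => i _; rewrite !mxE mulrNN.
- move=> u Tu; split => //; apply/pos_hull_rows => // j.
  by rewrite invmxK mulmxN linearN /= mulNmx XS mxE oppr_ge0; exact: Tu.
- move=> y [_ /pos_hull_rows yS]; exists (- (y *m invmx X)).
    move=> i; rewrite -XS mulNmx mulmxKV// linearN /= mulNmx mxE oppr_le0.
    by have := yS Siu i; rewrite invmxK.
  by rewrite mulmxN mulNmx opprK mulmxKV.
Qed.

(** The same isometry with both summands merged into one Euclidean space, the form for which the
    solid angle is available. *)
Lemma tangent_isometric_last_cone : isometric (ICone g T) (euclidean_cone (@last_cone R k m S)).
Proof.
have [X Xu [Xg XS]] := cone_frame.
apply: (@isometric_mulmx _ (ICone g T) (euclidean_cone _) (- X)) => /=.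
- move=> u v _ _; rewrite -Xg !mulmxN.
  by rewrite /dotv; apply: eq_bigr => i _; rewrite !mxE mulrNN.
- move=> u Tu j.
  by rewrite mulmxN linearN /= mulNmx XS mxE oppr_ge0; exact: Tu.
- move=> y yS; exists (- (y *m invmx X)).
    by move=> i; rewrite -XS mulNmx mulmxKV// linearN /= mulNmx mxE oppr_le0; exact: yS.
  by rewrite mulmxN mulNmx opprK mulmxKV.
Qed.

(** Testing against the lineality space of T kills the first k coordinates of v; testing against the
    remaining generators of T, the negated rows of [invmx S], gives the sign conditions. *)
Let normal_coordinates X : X \in unitmx ->
  (forall u v : 'rV[R]_(k + m), dotv (u *m X) (v *m X) = g u v) ->
  (forall u : 'rV[R]_(k + m), rsubmx (u *m X) *m S = u *m H^T) ->
  forall v : 'rV[R]_(k + m), N v <-> lsubmx (v *m X) = 0 /\ forall j, 0 <= (rsubmx (v *m X) *m invmx S) 0 j.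
Proof.
move=> Xu Xg XS v.
have gE u : g v u = dotv (lsubmx (v *m X)) (lsubmx (u *m X)) +
                    dotv (rsubmx (v *m X)) (rsubmx (u *m X)).
  by rewrite -dotv_row_mx !hsubmxK Xg.
split=> [Nv|[v0 vS] u Tu]; last first.
  rewrite gE v0 dotv0l add0r dotvE.
  have -> : rsubmx (v *m X) *m (rsubmx (u *m X))^T =
      (rsubmx (v *m X) *m invmx S) *m (u *m H^T)^T.
    by rewrite -XS trmx_mul ST !mulmxA mulmxKV.
  rewrite mxE; apply: sumr_le0 => i _; rewrite [(_^T) _ _]mxE.
  by rewrite mulr_ge0_le0// Tu.
split.
  pose u := row_mx (lsubmx (v *m X)) 0 *m invmx X.
  have uX : u *m X = row_mx (lsubmx (v *m X)) 0 by rewrite /u mulmxKV.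
  have Tu : T u by move=> i; rewrite -XS uX row_mxKr mul0mx mxE.
  have := Nv _ Tu; rewrite gE uX row_mxKl row_mxKr.
  have -> : dotv (rsubmx (v *m X)) 0 = 0 by rewrite dotvE trmx0 mulmx0 mxE.
  by rewrite addr0 => h; apply: dotv_eq0; apply/eqP; rewrite eq_le h dotv_ge0.
move=> j.
pose u : 'rV_(k + m) := row_mx 0 (- (delta_mx 0 j *m invmx S)) *m invmx X.
have uX : u *m X = row_mx 0 (- (delta_mx 0 j *m invmx S)) by rewrite /u mulmxKV.
have Tu : T u.
  move=> i; rewrite -XS uX row_mxKr mulNmx mulmxKV// !mxE oppr_le0.
  by case: (_ && _).
have := Nv _ Tu; rewrite gE uX row_mxKl row_mxKr.
have -> : dotv (lsubmx (v *m X)) 0 = 0 by rewrite dotvE trmx0 mulmx0 mxE.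
by rewrite add0r dotvE linearN /= mulmxN mxE oppr_le0 trmx_mul SiT mulmxA trmx_delta -colE mxE.
Qed.

Lemma normal_isometric : isometric (ICone g N)
  (euclidean_cone (pos_hull (fun i => 1 *: row i S))).
Proof.
have [X Xu [Xg XS]] := cone_frame.
have NP := normal_coordinates Xu Xg XS.
pose P : 'M[R]_(k + m, m) := col_mx 0 1%:M.
have PE (x : 'rV[R]_(k + m)) : x *m P = rsubmx x.
  by rewrite -{1}[x]hsubmxK mul_row_col mulmx0 mulmx1 add0r.
apply: (@isometric_mulmx _ (ICone g N) (euclidean_cone _) (X *m P)) => /=.
- move=> u v Lu Lv.
  (* Dropping the first k coordinates preserves the form only on the linear hull of N, where they
     vanish. *)
  have L0 w : lin_hull N w -> lsubmx (w *m X) = 0.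
    move=> [q [c [s [sN ->]]]]; rewrite mulmx_suml linear_sum big1// => i _.
    by have [si _] := (NP (s i)).1 (sN i); rewrite -scalemxAl linearZ /= si scaler0.
  rewrite !mulmxA !PE -Xg -[X in _ = dotv X _]hsubmxK -[X in _ = dotv _ X]hsubmxK.
  by rewrite dotv_row_mx !L0// dotv0l add0r.
- by move=> u /NP[_ uS]; apply/pos_hull_rows => // j; rewrite mulmxA PE.
- move=> y /pos_hull_rows yS; exists (row_mx 0 y *m invmx X).
    by apply/NP; rewrite mulmxKV// row_mxKl row_mxKr; split => //; exact: yS.
  by rewrite mulmxA PE mulmxKV// row_mxKr.
Qed.

End dual_pair_of_cones.

(** * Faces of polytopes in the Klein model *)

Section inner_product.
Variables (R : realType) (n : nat).
Implicit Types u v w : 'rV[R]_n.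

Lemma dotvC u v : dotv u v = dotv v u.
Proof. by apply: eq_bigr => i _; rewrite mulrC. Qed.

Lemma dotvDl u v w : dotv (u + v) w = dotv u w + dotv v w.
Proof. by rewrite !dotvE mulmxDl mxE. Qed.

Lemma dotvDr u v w : dotv w (u + v) = dotv w u + dotv w v.
Proof. by rewrite dotvC dotvDl !(dotvC w). Qed.

Lemma dotvZl (a : R) u v : dotv (a *: u) v = a * dotv u v.
Proof. by rewrite !dotvE -scalemxAl mxE. Qed.

Lemma dotvZr (a : R) u v : dotv v (a *: u) = a * dotv v u.
Proof. by rewrite dotvC dotvZl dotvC. Qed.

Lemma dotvNl u v : dotv (- u) v = - dotv u v.
Proof. by rewrite -scaleN1r dotvZl mulN1r. Qed.

Lemma dotvNr u v : dotv v (- u) = - dotv v u.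
Proof. by rewrite dotvC dotvNl dotvC. Qed.

Definition dotvE2 := (dotvDl, dotvDr, dotvZl, dotvZr, dotvNl, dotvNr).

Lemma dotv_suml m (f : 'I_m -> 'rV[R]_n) v : dotv (\sum_i f i) v = \sum_i dotv (f i) v.
Proof. by rewrite dotvE mulmx_suml summxE; apply: eq_bigr => i _; rewrite dotvE. Qed.

Lemma dotv_gt0 u : u != 0 -> 0 < dotv u u.
Proof.
by move=> u0; rewrite lt_neqAle dotv_ge0 andbT; apply: contra_neq u0 => /esym/dotv_eq0.
Qed.

Lemma dotv_cauchy_schwarz u v : dotv u v ^+ 2 <= dotv u u * dotv v v.
Proof.
have [->|/dotv_gt0 v0] := eqVneq v 0.
  by rewrite (dotvC u) !dotv0l expr0n mulr0.
have := dotv_ge0 (dotv v v *: u - dotv u v *: v).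
rewrite !dotvE2 (dotvC v u).
rewrite (_ : _ + (_ - _) = dotv v v * (dotv u u * dotv v v - dotv u v ^+ 2)); last by ring.
by rewrite pmulr_rge0// subr_ge0.
Qed.

Lemma norm2Z (a : R) u : 0 <= a -> norm2 (a *: u) = a * norm2 u.
Proof. by move=> a0; rewrite /norm2 dotvZ sqrtrM ?sqr_ge0// sqrtr_sqr ger0_norm. Qed.

Lemma aff_hull_line (F : set 'rV[R]_n) u v (t : R) : F u -> F v ->
  aff_hull F (u + t *: (u - v)).
Proof.
move=> Fu Fv; exists 2%N, (fun i => if i == ord0 then 1 + t else - t),
  (fun i => if i == ord0 then u else v); split.
- by move=> i; case: ifP.
- by rewrite !big_ord_recl big_ord0 /= addr0 addrK.
- rewrite !big_ord_recl big_ord0 /= addr0 scalerDl scale1r scaleNr -addrA.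
  by rewrite -scalerBr.
Qed.

Lemma relint_extend (F : set 'rV[R]_n) u v : relint F u -> F v ->
  exists2 t : R, 0 < t & F (u + t *: (u - v)).
Proof.
move=> [Fu [e e0 eF]] Fv; have n0 : 0 <= norm2 (u - v) by exact: sqrtr_ge0.
have n1 : 0 < 1 + norm2 (u - v) by rewrite ltr_pwDl.
exists (e / (1 + norm2 (u - v))); first by rewrite divr_gt0.
apply: eF; first exact: aff_hull_line.
rewrite addrC addKr norm2Z ?divr_ge0 ?ltW//.
by rewrite mulrAC ltr_pdivrMr// ltr_pM2l// ltrDr.
Qed.

(** A point slightly beyond u on the line from v still lies in F; strict inequality at v would
    violate the bound there. *)
Lemma relint_tight (F : set 'rV[R]_n) (a : 'rV[R]_n) (b : R) u v :
  (forall y, F y -> dotv a y <= b) -> relint F u -> dotv a u = b -> F v -> dotv a v = b.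
Proof.
move=> Fa Fu au Fv; apply/eqP; rewrite eq_le Fa//=.
have [t t0 /Fa] := relint_extend Fu Fv.
by rewrite !dotvE2 au gerDl pmulr_rle0// subr_le0.
Qed.

Lemma feasible_directions (J : finType) (h : J -> 'rV[R]_n) (c : J -> R) u :
  (forall j, dotv (h j) u <= c j) -> forall v,
  (forall j, dotv (h j) u = c j -> dotv (h j) v <= 0) <->
  exists2 e : R, 0 < e & forall j, dotv (h j) (u + e *: v) <= c j.
Proof.
move=> hu v; split=> [hv|[e e0 he] j hj]; last first.
  by have := he j; rewrite !dotvE2 hj gerDl pmulr_rle0.
(* A constraint with slack limits the step to slack over growth; summing the reciprocals yields one
   step for all of them. Tight constraints contribute 0, as division by 0 gives 0. *)
pose s := \sum_j `|dotv (h j) v| / (c j - dotv (h j) u).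
have t0 j : 0 <= `|dotv (h j) v| / (c j - dotv (h j) u).
  by rewrite divr_ge0// subr_ge0.
have s0 : 0 <= s by exact: sumr_ge0.
have s1 : 0 < 1 + s by rewrite ltr_pwDl.
exists (1 + s)^-1; first by rewrite invr_gt0.
move=> j; rewrite !dotvE2 -lerBrDl.
have [hj|hj] := eqVneq (dotv (h j) u) (c j).
  by rewrite hj subrr mulr_ge0_le0 ?hv// invr_ge0 ltW.
have cj : 0 < c j - dotv (h j) u by rewrite subr_gt0 lt_neqAle hj hu.
apply: (le_trans (ler_wpM2l _ (ler_norm _))); first by rewrite invr_ge0 ltW.
rewrite mulrC ler_pdivrMr// mulrC -ler_pdivrMr//.
apply: (@le_trans _ _ s); last by rewrite lerDr.
by rewrite /s (bigD1 j)//= lerDl sumr_ge0.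
Qed.

Lemma aff_hull_range_sub k (p : 'I_k.+1 -> 'rV[R]_n) u : aff_hull (range p) u ->
  (u - p ord0 <= \matrix_(i < k) (p (lift ord0 i) - p ord0))%MS.
Proof.
move=> [q [c [s [sp c1 ->]]]].
rewrite (_ : _ - _ = \sum_i c i *: (s i - p ord0)); last first.
  rewrite -[p ord0 in LHS]scale1r -c1 scaler_suml -sumrB.
  by apply: eq_bigr => i _; rewrite scalerBr.
apply: summx_sub => i _; apply: scalemx_sub; have [l _ <-] := sp i.
have [l' ->|->] := unliftP ord0 l; last by rewrite subrr sub0mx.
rewrite -[X in (X <= _)%MS](rowK (fun i => p (lift ord0 i) - p ord0)).
exact: row_sub.
Qed.

Lemma aff_indep_row_free k (p : 'I_k.+1 -> 'rV[R]_n) : aff_indep p ->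
  row_free (\matrix_(i < k) (p (lift ord0 i) - p ord0)).
Proof.
move=> pind; apply/inj_row_free => v.
rewrite mulmx_sum_row (eq_bigr (fun i => v 0 i *: p (lift ord0 i) - v 0 i *: p ord0)); last first.
  by move=> i _; rewrite rowK scalerBr.
rewrite sumrB -scaler_suml => vp.
pose c i := oapp (v 0) (- \sum_i v 0 i) (unlift ord0 i).
have cl i : c (lift ord0 i) = v 0 i by rewrite /c liftK.
have c0 : c ord0 = - \sum_i v 0 i by rewrite /c unlift_none.
have cs (V : lmodType R) (f : 'I_k.+1 -> V) :
    \sum_i c i *: f i = - (\sum_i v 0 i) *: f ord0 + \sum_i v 0 i *: f (lift ord0 i).
  by rewrite big_ord_recl c0; congr (_ + _); apply: eq_bigr => i _; rewrite cl.
apply/rowP => i; rewrite mxE -cl; apply: pind.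
  by rewrite big_ord_recl c0 [X in _ + X](eq_bigr (fun l => v 0 l)) ?addNr// => l _; rewrite cl.
by rewrite cs scaleNr addrC.
Qed.

End inner_product.

(** * Dimension and tangent cone of a face *)

Section face_dimension.
Variables (R : realType) (n k : nat) (P F : set 'rV[R]_n) (x : 'rV[R]_n).
Hypotheses (FP : proper_face P F) (Fk : has_dim F k) (Fx : relint F x).

Lemma proper_face_sub : F `<=` P.
Proof. by have [[c [beta [_ ->]]] _ _] := FP => y []. Qed.

(* The lineality space of the tangent cone is the direction space of the face. *)
Lemma face_dimension (J : finType) (h : J -> 'rV[R]_n) (c : J -> R) m (H : 'M[R]_(m, n)) :
  P = [set y | forall j, dotv (h j) y <= c j] -> row_free H ->
  (forall u : 'rV[R]_n, u *m H^T = 0 <-> forall j, dotv (h j) x = c j -> dotv (h j) u = 0) ->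
  (k + m)%N = n.
Proof.
move=> PE Hfree HE.
have Px : P x by apply: proper_face_sub; case: Fx.
have hx j : dotv (h j) x <= c j by move: Px; rewrite PE; exact.
have [p [pind pF Fp]] := Fk.
set M := \matrix_(i < k) (p (lift ord0 i) - p ord0).
suff kerM : (kermx H^T :=: M)%MS.
  have := mxrank_ker H^T; rewrite kerM mxrank_tr (eqP Hfree).
  rewrite (eqP (aff_indep_row_free pind)) => ->.
  by rewrite subnK// -(eqP Hfree) rank_leq_col.
apply/eqmxP/andP; split; last first.
  apply/row_subP => i; apply/sub_kermxP; apply/HE => j hj; rewrite rowK dotvDr dotvNr.
  have tight y : F y -> dotv (h j) y = c j.
    move=> Fy; apply: (relint_tight _ Fx hj Fy) => z /proper_face_sub.
    by rewrite PE; exact.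
  by rewrite !tight ?subrr.
apply/row_subP => i; set u := row i _.
have : u *m H^T = 0 by apply/sub_kermxP; exact: row_sub.
move=> /HE hu.
have [e e0 eP] : exists2 e : R, 0 < e & forall j, dotv (h j) (x + e *: u) <= c j.
  by apply/(feasible_directions hx) => j hj; rewrite hu.
have [e' e'0 e'P] : exists2 e : R, 0 < e & forall j, dotv (h j) (x + e *: - u) <= c j.
  by apply/(feasible_directions hx) => j hj; rewrite dotvNr hu// oppr0.
(* Both u and - u are feasible at x, so the supporting functional w is constant along u and x + e u
   stays in F. *)
have [[w [beta [wP FE]]] _ _] := FP.
have wx : dotv w x = beta by have [] := Fx; rewrite FE => -[].
have : P (x + e *: u) by rewrite PE.
move=> Pxe; have := wP _ Pxe; rewrite !dotvE2 wx gerDl pmulr_rle0// => wu.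
have : P (x + e' *: - u) by rewrite PE.
move=> /wP; rewrite !dotvE2 wx gerDl pmulr_rle0// oppr_le0 => wu'.
have wu0 : dotv w u = 0 by apply/eqP; rewrite eq_le wu wu'.
have Fxe : F (x + e *: u) by rewrite FE; split => //=; rewrite !dotvE2 wx wu0 mulr0 addr0.
have xM := aff_hull_range_sub (Fp _ (proj1 Fx)).
have xeM := aff_hull_range_sub (Fp _ Fxe).
have -> : u = e^-1 *: ((x + e *: u - p ord0) - (x - p ord0)).
  rewrite (_ : _ - _ = e *: u) ?scalerA ?mulVf ?scale1r ?gt_eqF//.
  by rewrite opprB addrA subrK addrAC subrr add0r.
by apply: scalemx_sub; rewrite addmx_sub// eqmx_opp.
Qed.

(** Both sides are the cone of feasible directions of P at x, which depends on P alone. The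
    arbitrary description [a], [b] can thus be exchanged for the convenient one [h], [c]. *)
Lemma tangent_coneE q (a : 'I_q -> 'rV[R]_n) (b : 'I_q -> R)
    (J : finType) (h : J -> 'rV[R]_n) (c : J -> R) :
  P = [set y | forall r, dotv (a r) y <= b r] ->
  P = [set y | forall j, dotv (h j) y <= c j] ->
  tangent_cone a b F = [set u | forall j, dotv (h j) x = c j -> dotv (h j) u <= 0].
Proof.
move=> Pa Ph.
have Px : P x by apply: proper_face_sub; case: Fx.
have ax j : dotv (a j) x <= b j by move: Px; rewrite Pa; exact.
have hx j : dotv (h j) x <= c j by move: Px; rewrite Ph; exact.
have act r : active a b F r <-> dotv (a r) x = b r.
  split=> [|ar y Fy]; first by apply; case: Fx.
  apply: (relint_tight _ Fx ar Fy) => z /proper_face_sub.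
  by rewrite Pa; exact.
have feas u e : (forall r, dotv (a r) (x + e *: u) <= b r) <->
                (forall j, dotv (h j) (x + e *: u) <= c j).
  have -> : (forall r, dotv (a r) (x + e *: u) <= b r) = P (x + e *: u) by rewrite Pa.
  by rewrite Ph.
apply/seteqP; split => u uT.
  apply/(feasible_directions hx).
  have [|e e0 /feas ?] := (feasible_directions ax u).1; last by exists e.
  by move=> r /act; exact: uT.
move=> r /act; move: r; apply/(feasible_directions ax).
by have [e e0 /feas ?] := (feasible_directions hx u).1 uT; exists e.
Qed.

End face_dimension.

(** * The Klein metric and its inverse *)

Section klein_matrix.
Variables (R : realType) (n : nat) (kappa : R) (x : 'rV[R]_n).
Let nu : R := 1 + kappa * dotv x x.
Hypothesis nu_gt0 : 0 < nu.

Definition klein_mx : 'M[R]_n := nu^-1 *: 1%:M - (kappa / nu ^+ 2) *: (x^T *m x).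

Lemma klein_mxE u v : klein_metric kappa x u v = (u *m klein_mx *m v^T) 0 0.
Proof.
rewrite /klein_mx mulmxBr mulmxBl -!scalemxAr -!scalemxAl mulmx1 !mulmxA.
rewrite -[X in _ - _ *: X]mulmxA [u *m x^T]mx11_scalar mul_scalar_mx.
rewrite mxE [X in X + _]mxE [X in _ + X]mxE [X in _ - X]mxE [X in _ - _ * X]mxE -!dotvE (dotvC u x).
by rewrite /klein_metric -/nu; ring.
Qed.

Lemma klein_mx_sym : klein_mx^T = klein_mx.
Proof. by rewrite /klein_mx linearB /= !linearZ /= trmx1 trmx_mul trmxK. Qed.

Lemma klein_metric_gt0 u : u != 0 -> 0 < klein_metric kappa x u u.
Proof.
move=> /dotv_gt0 u0; rewrite /klein_metric -/nu.
have -> : dotv u u / nu - kappa * dotv x u * dotv x u / nu ^+ 2 =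
    (nu * dotv u u - kappa * dotv x u ^+ 2) / nu ^+ 2.
  by field; rewrite gt_eqF.
rewrite divr_gt0 ?exprn_gt0//.
have [k0|k0] := leP 0 kappa; last first.
  by rewrite ltr_wpDr ?mulr_gt0// -mulNr mulr_ge0 ?sqr_ge0// oppr_ge0 ltW.
have := ler_wpM2l k0 (dotv_cauchy_schwarz x u).
rewrite subr_gt0 /nu mulrDl mul1r -mulrA => /le_lt_trans; apply.
by rewrite ltrDr.
Qed.

(** Sherman-Morrison: the metric is a rank-one perturbation of a multiple of the identity. *)
Lemma invmx_klein : invmx klein_mx = nu *: (1%:M + kappa *: (x^T *m x)).
Proof.
have nu0 : nu != 0 by rewrite gt_eqF.
have XX : (x^T *m x) *m (x^T *m x) = dotv x x *: (x^T *m x).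
  by rewrite mulmxA -(mulmxA _ x) [x *m x^T]mx11_scalar -dotvE mul_mx_scalar -scalemxAl.
have KI : klein_mx *m (nu *: (1%:M + kappa *: (x^T *m x))) = 1%:M.
  rewrite /klein_mx -scalemxAr mulmxBl !mulmxDr !mulmx1 -!scalemxAl mul1mx.
  rewrite -!scalemxAr XX !scalerA !scalerDr !scalerN !scalerDr !scalerA mulfV// scale1r -addrA.
  rewrite -[RHS]addr0; congr (_ + _).
  rewrite -!scalerDl -scalerBl (_ : _ - _ = 0) ?scale0r//.
  by rewrite /nu in nu0 *; field.
have [Ku _] := mulmx1_unit KI.
by rewrite -[RHS](mulKmx Ku) KI mulmx1.
Qed.

(** For normals u, v of facets through x the products with x are the facet constants, so x enters
    only through the positive prefactor: the cones look alike along a face. *)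
Lemma klein_dual (u v : 'rV[R]_n) : (u *m invmx klein_mx *m v^T) 0 0 =
  nu * (dotv u v + kappa * dotv u x * dotv v x).
Proof.
rewrite invmx_klein -scalemxAr -scalemxAl mxE mulmxDr mulmxDl mxE mulmx1 -dotvE.
rewrite -scalemxAr -scalemxAl mulmxA -(mulmxA _ x) mxE [u *m x^T]mx11_scalar mul_scalar_mx.
by rewrite mxE -!dotvE (dotvC x v) mulrA.
Qed.

End klein_matrix.

(* The dual Gram matrix of the active facet normals in the Klein metric at [x] is
   [(1 + kappa |x|^2) * (<h i, h j> + kappa c i c j)]; up to positive scaling of the
   normals it is the identity minus [b] times the all-ones matrix. *)
Definition facet_gram (R : realType) n (kappa b : R) (P : set 'rV[R]_n) : Prop :=
  exists (J : finType) (h : J -> 'rV[R]_n) (c rho : J -> R),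
  [/\ P = [set y | forall j, dotv (h j) y <= c j],
      forall j, 0 < rho j,
      forall x, P x -> (#|[set j | dotv (h j) x == c j]%SET| <= n)%N &
      forall x i j, P x -> dotv (h i) x = c i -> dotv (h j) x = c j ->
        dotv (h i) (h j) + kappa * c i * c j = rho i * rho j * ((i == j)%:R - b)].

Section cones_at_face.
Variables (R : realType) (n : nat) (kappa b : R) (x : 'rV[R]_n).
Variables (J : finType) (h : J -> 'rV[R]_n) (c rho : J -> R) (q : nat) (f : 'I_q -> J).
Hypotheses (nu0 : 0 < 1 + kappa * dotv x x) (rho0 : forall j, 0 < rho j)
  (fI : injective f) (factive : forall j, dotv (h j) x = c j <-> exists i, f i = j)
  (gram : forall i j, dotv (h i) x = c i -> dotv (h j) x = c j ->
     dotv (h i) (h j) + kappa * c i * c j = rho i * rho j * ((i == j)%:R - b)).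

(** Normalises the facet normals: [rho] comes from the Gram data, the square root from the prefactor
    in [klein_dual]. *)
Let s j := (Num.sqrt (1 + kappa * dotv x x) * rho j)^-1.
Definition facet_mx : 'M[R]_(q, n) := \matrix_(i < q) (s (f i) *: h (f i)).

Let s0 j : 0 < s j. Proof. by rewrite invr_gt0 mulr_gt0 ?sqrtr_gt0. Qed.

Lemma mul_facet_mx u i : (u *m facet_mx^T) 0 i = s (f i) * dotv (h (f i)) u.
Proof. by rewrite mulmx_tr_dotv row_id rowK dotvC dotvZl. Qed.

Lemma facet_mx_gram : facet_mx *m invmx (klein_mx kappa x) *m facet_mx^T =
  1%:M + (- b) *: const_mx 1.
Proof.
apply/matrixP => i j; rewrite mulmx_tr_dotv row_mul dotvE klein_dual// !rowK !dotvE2.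
have hi l : dotv (h (f l)) x = c (f l) by apply/factive; exists l.
rewrite !hi !mxE mulr1 -(inj_eq fI).
transitivity (s (f i) * s (f j) * (1 + kappa * dotv x x) *
   (dotv (h (f i)) (h (f j)) + kappa * c (f i) * c (f j))); first by ring.
rewrite gram//.
have r2 : (1 + kappa * dotv x x) = Num.sqrt (1 + kappa * dotv x x) ^+ 2.
  by rewrite sqr_sqrtr// ltW.
rewrite [X in _ * X * _]r2 /s; field.
by rewrite !gt_eqF ?sqrtr_gt0.
Qed.

(** The rows have dual Gram matrix I - b J, invertible under this inequality. *)
Lemma facet_mx_free : 0 < 1 - q%:R * b -> row_free facet_mx.
Proof.
rewrite -mulrN => /rank_one_sqrt[S [_ SS Su]].
apply/inj_row_free => v vH.
have : v *m (S *m S) = 0 by rewrite SS -facet_mx_gram !mulmxA vH !mul0mx.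
by move=> vS; rewrite -[v](mulmxK Su) -[v *m S](mulmxK Su) -(mulmxA v) vS !mul0mx.
Qed.

Lemma facet_mx_ker u :
  u *m facet_mx^T = 0 <-> forall j, dotv (h j) x = c j -> dotv (h j) u = 0.
Proof.
split=> [/rowP u0 j /factive[i <-]|hu].
  by have := u0 i; rewrite mul_facet_mx mxE => /eqP; rewrite mulf_eq0 gt_eqF//= => /eqP.
by apply/rowP => i; rewrite mul_facet_mx hu ?mulr0 ?mxE//; apply/factive; exists i.
Qed.

Lemma facet_mx_cone : [set u | forall j, dotv (h j) x = c j -> dotv (h j) u <= 0] =
  [set u | forall i, (u *m facet_mx^T) 0 i <= 0].
Proof.
apply/seteqP; split => u uT.
  by move=> i; rewrite mul_facet_mx pmulr_rle0//; apply: uT; apply/factive; exists i.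
by move=> j /factive[i <-]; have := uT i; rewrite mul_facet_mx pmulr_rle0.
Qed.

End cones_at_face.

Lemma klein_ball_gt0 (R : realType) n (kappa : R) (x : 'rV[R]_n) :
  klein_ball kappa x -> 0 < 1 + kappa * dotv x x.
Proof.
have [k0 _|k0 /(_ k0)] := leP 0 kappa; first by rewrite ltr_pwDl// mulr_ge0// dotv_ge0.
have k1 : 0 < - kappa by rewrite oppr_gt0.
rewrite /norm2 => xk; rewrite -[kappa]opprK mulNr subr_gt0 mulrC -ltr_pdivlMr// div1r.
have : Num.sqrt (dotv x x) ^+ 2 < (Num.sqrt (- kappa))^-1 ^+ 2.
  by rewrite ltr_pXn2r// nnegrE ?invr_ge0 sqrtr_ge0.
by rewrite exprVn !sqr_sqrtr ?dotv_ge0// ltW.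
Qed.

Lemma face_cones_normal_form (R : realType) k m (kappa b : R) (P F : set 'rV[R]_(k + m)) x
    q (a : 'I_q -> 'rV[R]_(k + m)) (beta : 'I_q -> R) :
  P `<=` klein_ball kappa -> facet_gram kappa b P ->
  (forall l, (l <= k + m)%N -> 0 < 1 - l%:R * b) ->
  irredundant_hrep P a beta -> proper_face P F -> has_dim F k -> relint F x ->
  exists (G : 'M[R]_(k + m)) (H : 'M[R]_(m, k + m)),
  [/\ G^T = G,
      forall u : 'rV[R]_(k + m), u != 0 -> 0 < (u *m G *m u^T) 0 0,
      klein_metric kappa x = (fun u v => (u *m G *m v^T) 0 0),
      tangent_cone a beta F = [set u | forall i, (u *m H^T) 0 i <= 0] &
      H *m invmx G *m H^T = 1%:M + (- b) *: const_mx 1].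
Proof.
move=> PB [J [h [c [rho [PE rho0 few gram]]]]] bq [_ Pa _ _] FP Fk Fx.
have Px : P x by apply: (proper_face_sub FP); case: Fx.
have nu0 := klein_ball_gt0 (PB _ Px).
have gramx i j := gram x i j Px.
set A := [set j | dotv (h j) x == c j]%SET.
have Aact j : dotv (h j) x = c j <-> exists i, @enum_val _ (mem A) i = j.
  split=> [hj|[i <-]]; last by have := enum_valP i; rewrite inE => /eqP.
  have jA : j \in A by rewrite inE hj.
  by exists (enum_rank_in jA j); rewrite enum_rankK_in.
(* The number of active facets is not known beforehand: the bound [few] yields positivity, hence
   independent normals, and the dimension of the face then fixes the number. *)
have cardA : m = #|A|.
  apply/(@addnI k)/esym; apply: (face_dimension FP Fk Fx PE).
    exact: (facet_mx_free nu0 rho0 (@enum_val_inj _ _) Aact gramx (bq _ (few _ Px))).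
  exact: (facet_mx_ker nu0 rho0 Aact).
pose f i := @enum_val _ (mem A) (cast_ord cardA i).
have fI : injective f by move=> i j /enum_val_inj/cast_ord_inj.
have fact j : dotv (h j) x = c j <-> exists i, f i = j.
  rewrite Aact; split=> -[i <-]; last by exists (cast_ord cardA i).
  by exists (cast_ord (esym cardA) i); rewrite /f cast_ordKV.
exists (klein_mx kappa x), (facet_mx kappa x h rho f); split.
- exact: klein_mx_sym.
- by move=> u u0; rewrite -klein_mxE; exact: klein_metric_gt0.
- by apply/funext => u; apply/funext => v; rewrite klein_mxE.
- by rewrite (tangent_coneE FP Fx Pa PE) (facet_mx_cone nu0 rho0 fact).
- exact: (facet_mx_gram nu0 rho0 fI fact gramx).
Qed.

(** * Regular cubes and simplices *)

Section klein_distance.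
Variables (R : realType) (n : nat).
Implicit Types (kappa l : R) (x y : 'rV[R]_n).

Lemma cosh_ge1 (t : R) : 1 <= cosh t.
Proof.
rewrite /cosh ler_pdivlMr// mul1r expRN.
have e0 := expR_gt0 t; rewrite -subr_ge0.
have -> : expR t + (expR t)^-1 - 2 = (expR t - 1) ^+ 2 / expR t by field; rewrite gt_eqF.
by rewrite divr_ge0 ?sqr_ge0// ltW.
Qed.

Lemma cosh_arcosh (q : R) : 1 <= q -> cosh (arcosh q) = q.
Proof.
move=> q1; have q2 : 0 <= q ^+ 2 - 1 by rewrite subr_ge0 expr_ge1// (le_trans ler01).
rewrite /cosh /arcosh; set r := Num.sqrt _.
have r0 : 0 <= r by exact: sqrtr_ge0.
have r2 : r ^+ 2 = q ^+ 2 - 1 by rewrite sqr_sqrtr.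
have s0 : 0 < q + r by rewrite ltr_pwDl// (lt_le_trans ltr01).
rewrite expRN lnK ?posrE//.
have -> : (q + r)^-1 = q - r.
  apply: (mulfI (lt0r_neq0 s0)); rewrite mulfV ?gt_eqF// mulrC -subr_sqr.
  by rewrite r2 opprB addrC subrK.
by field.
Qed.

Lemma klein_cos_le kappa x y : 0 < kappa ->
  (1 + kappa * dotv x y) ^+ 2 <= (1 + kappa * dotv x x) * (1 + kappa * dotv y y).
Proof.
move=> k0; rewrite -subr_ge0.
have -> : (1 + kappa * dotv x x) * (1 + kappa * dotv y y) - (1 + kappa * dotv x y) ^+ 2 =
    kappa * dotv (x - y) (x - y) + kappa ^+ 2 * (dotv x x * dotv y y - dotv x y ^+ 2).
  by rewrite !dotvE2 (dotvC y x); ring.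
by rewrite addr_ge0 ?mulr_ge0 ?sqr_ge0 ?dotv_ge0 ?subr_ge0 ?dotv_cauchy_schwarz// ltW.
Qed.

(** Reversed Cauchy-Schwarz inequality for a Lorentzian form: the difference is written as a sum of
    two nonnegative terms. *)
Lemma klein_cosh_ge kappa x y : kappa < 0 ->
  0 < 1 + kappa * dotv x x -> 0 < 1 + kappa * dotv y y ->
  0 <= 1 + kappa * dotv x y /\
  (1 + kappa * dotv x x) * (1 + kappa * dotv y y) <= (1 + kappa * dotv x y) ^+ 2.
Proof.
move=> k0 Nx Ny; have xy := dotv_ge0 (x - y); split.
  move: xy; rewrite !dotvE2 (dotvC y x) => xy.
  have : 0 <= - kappa * (dotv x x + - dotv x y + (- dotv x y - - dotv y y)).
    by rewrite mulr_ge0// oppr_ge0 ltW.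
  by lra.
rewrite -subr_ge0.
have -> : (1 + kappa * dotv x y) ^+ 2 - (1 + kappa * dotv x x) * (1 + kappa * dotv y y) =
    - kappa * dotv (x - y) (x - y) * (1 + kappa * dotv y y) + (kappa * dotv (x - y) y) ^+ 2.
  by rewrite !dotvE2 (dotvC y x); ring.
by rewrite addr_ge0 ?sqr_ge0// !mulr_ge0 ?oppr_ge0// ltW.
Qed.

(** The preceding inequalities put the quotient where [acos] or [arcosh] is inverted. For kappa = 0
    the value of [Ccurv] forgets the length, hence separate flat cases below. *)
Lemma Ccurv_klein_dist kappa x y : kappa != 0 -> klein_ball kappa x -> klein_ball kappa y ->
  Ccurv kappa (klein_dist kappa x y) =
  (1 + kappa * dotv x y) / Num.sqrt ((1 + kappa * dotv x x) * (1 + kappa * dotv y y)).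
Proof.
move=> k0 /klein_ball_gt0 Nx /klein_ball_gt0 Ny.
rewrite /Ccurv /klein_dist (negbTE k0); set q := _ / _.
have NN : 0 < (1 + kappa * dotv x x) * (1 + kappa * dotv y y) by rewrite mulr_gt0.
have sN : 0 < Num.sqrt ((1 + kappa * dotv x x) * (1 + kappa * dotv y y)) by rewrite sqrtr_gt0.
case: (ltrgtP kappa 0) k0 => // kappa0 _.
- have k1 : Num.sqrt (- kappa) != 0 by rewrite gt_eqF// sqrtr_gt0 oppr_gt0.
  rewrite mulVKf// cosh_arcosh//.
  have [p0 pq] := klein_cosh_ge kappa0 Nx Ny.
  rewrite ler_pdivlMr// mul1r -[leRHS]ger0_norm// -sqrtr_sqr.
  by rewrite ler_sqrt// sqr_ge0.
- have k1 : Num.sqrt kappa != 0 by rewrite gt_eqF// sqrtr_gt0.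
  rewrite mulVKf// acosK// in_itv /= -ler_norml normf_div (gtr0_norm sN).
  rewrite ler_pdivrMr// mul1r -sqrtr_sqr ler_sqrt ?klein_cos_le//.
  by rewrite ltW.
Qed.

End klein_distance.

(** * Facets of the regular cube *)

Section cube.
Variables (R : realType) (n : nat) (kappa l : R) (P : set 'rV[R]_n).
Hypotheses (n2 : (2 <= n)%N) (Pcube : regular_cube kappa l P).

Lemma dotv_deltal i (y : 'rV[R]_n) : dotv (delta_mx 0 i) y = y 0 i.
Proof. by rewrite dotvC dotvE trmx_delta -colE mxE. Qed.

Lemma cube_facet_gram (C : R) : Ccurv kappa l = 1 + 2 * C ->
  0 < 1 + n%:R * C /\ facet_gram kappa (C / (1 + n%:R * C)) P.
Proof.
have [PB [tau [tau0 PE dist]]] := Pcube => Cl.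
pose i0 : 'I_n := Ordinal (ltnW n2).
pose s : {ffun 'I_n -> bool} := [ffun=> true].
pose s' : {ffun 'I_n -> bool} := [ffun i => i != i0].
have vP (u : {ffun 'I_n -> bool}) : P (cube_vertex tau u).
  rewrite PE => i; rewrite mxE; case: ifP => _; rewrite lexx ?andbT.
    by rewrite (le_trans _ (ltW tau0))// oppr_le0 ltW.
  by rewrite (le_trans _ (ltW tau0))// oppr_le0 ltW.
have vv (u : {ffun 'I_n -> bool}) : dotv (cube_vertex tau u) (cube_vertex tau u) = n%:R * tau ^+ 2.
  rewrite /dotv (eq_bigr (fun=> tau ^+ 2)) ?sumr_const ?card_ord ?mulr_natl//.
  by move=> i _; rewrite !mxE; case: ifP => _; rewrite ?mulrNN.
have vv' : dotv (cube_vertex tau s) (cube_vertex tau s') = (n%:R - 2) * tau ^+ 2.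
  rewrite /dotv (bigD1 i0)//= !mxE !ffunE eqxx /=.
  rewrite (eq_bigr (fun=> tau ^+ 2)); last by move=> i ii0; rewrite !mxE !ffunE ii0.
  rewrite sumr_const cardC1 card_ord -subn1 mulrnBr ?(ltnW n2)//.
  by rewrite -mulr_natl; ring.
pose t := kappa * tau ^+ 2.
have N0 : 0 < 1 + n%:R * t.
  by have := klein_ball_gt0 (PB _ (vP s)); rewrite vv /t mulrCA.
have CE : C = - t / (1 + n%:R * t).
  (* For kappa = 0 the hypothesis reads 1 = 1 + 2 C, and t = 0. *)
  have [k0|k0] := eqVneq kappa 0.
    move: Cl; rewrite /t k0 mul0r oppr0 mul0r /Ccurv ltxx eqxx => /eqP.
    by rewrite -subr_eq0 opprD addrA subrr add0r oppr_eq0 mulf_eq0 pnatr_eq0/= => /eqP.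
  have ss' : #|[set i | s i != s' i]%SET| = 1%N.
    rewrite (_ : [set i | _]%SET = [set i0]%SET) ?cards1//.
    by apply/setP => i; rewrite !inE !ffunE; case: (i == i0).
  move: Cl; rewrite -(dist _ _ ss') Ccurv_klein_dist//; [|exact: PB|exact: PB].
  rewrite !vv vv' -expr2 sqrtr_sqr.
  have -> : kappa * (n%:R * tau ^+ 2) = n%:R * t by rewrite /t mulrCA.
  rewrite (gtr0_norm N0) => Cl.
  apply: (@mulfI _ 2) => //.
  apply: (@addrI _ 1); rewrite -Cl /t; field.
  by rewrite -/t in N0 *; rewrite /t in N0; rewrite gt_eqF.
have C1 : 1 + n%:R * C = (1 + n%:R * t)^-1 by rewrite CE; field; rewrite gt_eqF.
split; first by rewrite C1 invr_gt0.
have -> : C / (1 + n%:R * C) = - t by rewrite C1 invrK CE divfK// gt_eqF.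
(* Facets are indexed by coordinate and sign, [true] being the negative side. Opposite facets are
   disjoint as tau > 0, so the facets through a point have distinct coordinates. *)
pose h (p : 'I_n * bool) : 'rV[R]_n := (-1) ^+ p.2 *: delta_mx 0 p.1.
have hE p y : dotv (h p) y = (-1) ^+ p.2 * y 0 p.1 by rewrite dotvZl dotv_deltal.
have opp y i u v : dotv (h (i, u)) y = tau -> dotv (h (i, v)) y = tau -> u = v.
  rewrite !hE; case: u; case: v => //=; rewrite ?expr1 ?expr0 ?mulN1r ?mul1r => yt yt'.
    by exfalso; move: tau0; lra.
  by exfalso; move: tau0; lra.
exists ('I_n * bool)%type, h, (fun=> tau), (fun=> 1); split => //.
- rewrite PE; apply/seteqP; split => y yP.
    move=> [i []]; rewrite hE /= ?expr1 ?expr0 ?mulN1r ?mul1r.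
      by have /andP[y1 _] := yP i; rewrite lerNl.
    by have /andP[] := yP i.
  move=> i; have := yP (i, true); have := yP (i, false); rewrite !hE /= expr1 expr0 mulN1r mul1r.
  by move=> -> y2; rewrite lerNl y2.
- move=> y _; rewrite -[X in (_ <= X)%N]card_ord -(@card_in_imset _ _ fst); first exact: max_card.
  move=> [i u] [j v]; rewrite !inE => /eqP iy /eqP jy /= ij; move: ij jy => <- jy.
  by rewrite (opp _ _ _ _ iy jy).
- move=> y [i u] [j v] _ iy jy; rewrite !mul1r opprK hE /= !mxE eqxx /=.
  rewrite -mulrA -expr2 -/t; congr (_ + _); rewrite xpair_eqE.
  have [ij|] := eqVneq i j; last by rewrite !mulr0.
  by move: ij jy => <- jy; rewrite (opp _ _ _ _ iy jy) !eqxx mulr1 -expr2 sqrr_sign.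
Qed.

End cube.

(** * Facets of the regular simplex *)

Section simplex.
Variables (R : realType) (n : nat).

(** The affine functions c j - <h j, y> are the barycentric coordinates of y, read off the inverse
    of the matrix with rows (1, w i). *)
Lemma barycentric_coordinates (w : 'I_n.+1 -> 'rV[R]_n) : aff_indep w ->
  exists (h : 'I_n.+1 -> 'rV[R]_n) (c : 'I_n.+1 -> R),
    (forall i j, c j - dotv (h j) (w i) = (i == j)%:R) /\
    forall y, \sum_j (c j - dotv (h j) y) = 1 /\ \sum_j (c j - dotv (h j) y) *: w j = y.
Proof.
move=> wind.
pose ext (y : 'rV[R]_n) : 'rV[R]_n.+1 := \row_j oapp (y 0) 1 (unlift ord0 j).
pose W : 'M[R]_n.+1 := \matrix_i ext (w i).
have ext0 y : ext y 0 ord0 = 1 by rewrite mxE unlift_none.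
have extS y j : ext y 0 (lift ord0 j) = y 0 j by rewrite mxE liftK.
have W0 (v : 'rV[R]_n.+1) : (v *m W) 0 ord0 = \sum_i v 0 i.
  by rewrite mxE; apply: eq_bigr => i _; rewrite mxE ext0 mulr1.
have WS (v : 'rV[R]_n.+1) j : (v *m W) 0 (lift ord0 j) = (\sum_i v 0 i *: w i) 0 j.
  by rewrite mxE summxE; apply: eq_bigr => i _; rewrite mxE extS mxE.
have Wu : W \in unitmx.
  rewrite -row_free_unit; apply/inj_row_free => v vW; apply/rowP => i; rewrite mxE.
  apply: wind; first by rewrite -W0 vW mxE.
  by apply/rowP => j; rewrite -WS vW !mxE.
pose M := invmx W.
pose h j : 'rV[R]_n := \row_l - M (lift ord0 l) j.
have extM y j : (ext y *m M) 0 j = M ord0 j - dotv (h j) y.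
  rewrite mxE big_ord_recl ext0 mul1r; congr (_ + _).
  rewrite /dotv -sumrN; apply: eq_bigr => l _.
  by rewrite extS mxE mulNr opprK mulrC.
exists h, (fun j => M ord0 j); split=> [i j|y].
  rewrite -extM -(rowK (fun i => ext (w i)) i) -/W -row_mul mulmxV//.
  by rewrite !mxE.
have eW : ext y *m M *m W = ext y by rewrite mulmxKV.
split.
  by rewrite -[RHS](ext0 y) -eW W0; apply: eq_bigr => j _; rewrite extM.
apply/rowP => j; rewrite -[RHS]extS -eW WS; congr (fun_of_matrix _ _ _).
by apply: eq_bigr => i _; rewrite extM.
Qed.

Variables (w h : 'I_n.+1 -> 'rV[R]_n) (c : 'I_n.+1 -> R).
Hypotheses (cw : forall i j, c j - dotv (h j) (w i) = (i == j)%:R)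
  (sumc : forall y, \sum_j (c j - dotv (h j) y) = 1)
  (sumw : forall y, \sum_j (c j - dotv (h j) y) *: w j = y).

Lemma conv_hull_barycentric : conv_hull w = [set y | forall j, dotv (h j) y <= c j].
Proof.
apply/seteqP; split => y yP.
  move=> j; have [a [a0 a1 ->]] := yP.
  rewrite -subr_ge0 -[c j]mul1r -a1 mulr_suml dotvC dotv_suml -sumrB.
  rewrite sumr_ge0// => i _; rewrite dotvZl dotvC -mulrBr cw mulr_ge0//.
exists (fun j => c j - dotv (h j) y); split => // j.
by rewrite subr_ge0; exact: yP.
Qed.

(** If all n + 1 barycentric coordinates vanished, their sum could not be 1. *)
Lemma conv_hull_few_tight y : (#|[set j | dotv (h j) y == c j]%SET| <= n)%N.
Proof.
rewrite -ltnS -[X in (_ < X)%N]card_ord ltnNge; apply/negP => A_full.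
have : [set j | dotv (h j) y == c j]%SET = [set: 'I_n.+1]%SET.
  by apply/eqP; rewrite eqEcard finset.subsetT cardsT.
move=> /setP A; have := sumc y; rewrite big1 => [/esym/eqP|j _]; first by rewrite oner_eq0.
by have := A j; rewrite !inE => /eqP ->; rewrite subrr.
Qed.

Let sum_c : \sum_j c j = 1.
Proof.
by rewrite -[RHS](sumc 0); apply: eq_bigr => j _; rewrite dotvC dotv0l subr0.
Qed.

Let sum_cw : \sum_j c j *: w j = 0.
Proof.
by rewrite -[RHS](sumw 0); apply: eq_bigr => j _; rewrite dotvC dotv0l subr0.
Qed.

Let sum_h v : \sum_j dotv (h j) v = 0.
Proof.
have := sumc v; rewrite sumrB sum_c => /eqP.
by rewrite subr_eq addrC -subr_eq subrr eq_sym => /eqP.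
Qed.

Let sum_hw v : \sum_j dotv (h j) v *: w j = - v.
Proof.
apply/esym; rewrite -[in LHS](sumw v) -sumrN.
rewrite (eq_bigr (fun j => dotv (h j) v *: w j - c j *: w j)); last first.
  by move=> j _; rewrite scalerBl opprB.
by rewrite sumrB sum_cw subr0.
Qed.

Variable kappa : R.
Let gam i j := dotv (h i) (h j) + kappa * c i * c j.

(* Up to the factor [kappa], the dual Gram matrix inverts the one of the lifted vertices. *)
Lemma gram_inverse i m : \sum_j gam i j * (1 + kappa * dotv (w j) (w m)) = kappa * (i == m)%:R.
Proof.
have -> : \sum_j gam i j * (1 + kappa * dotv (w j) (w m)) =
    \sum_j dotv (h j) (h i) + kappa * dotv (\sum_j dotv (h j) (h i) *: w j) (w m)
    + kappa * c i * (\sum_j c j + kappa * dotv (\sum_j c j *: w j) (w m)).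
  rewrite !dotv_suml !mulr_sumr -!big_split mulr_sumr -big_split /=.
  apply: eq_bigr => j _; rewrite !dotvZl /gam (dotvC (h i)); ring.
rewrite sum_h sum_hw sum_c sum_cw dotvNl dotv0l mulr0 addr0 mulr1 add0r.
by rewrite eq_sym -(cw m i); ring.
Qed.

Lemma gram_row_sum i : kappa = 0 -> \sum_j gam i j = 0.
Proof.
move=> k0; rewrite -[RHS](sum_h (h i)); apply: eq_bigr => j _.
by rewrite /gam k0 !mul0r addr0 dotvC.
Qed.

(** For kappa = 0 the right-hand side of [gram_inverse] vanishes and determines nothing. Instead <w
    j, w l> is polarised in terms of s; the zero row sums remove the terms that do not depend on j,
    and the leftover constant g is found by summing over l. *)
Lemma gram_flat (s : R) i m : kappa = 0 -> s != 0 ->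
  (forall i j, i != j -> dotv (w i - w j) (w i - w j) = s) ->
  gam i m = 2 / s * ((i == m)%:R - (1 + n%:R)^-1).
Proof.
move=> k0 s0 ws.
have n0 : 1 + n%:R != 0 :> R by rewrite nat1r pnatr_eq0.
have wE j l : dotv (w j) (w l) = (dotv (w j) (w j) + dotv (w l) (w l) - s * (1 - (j == l)%:R)) / 2.
  have [->|/ws <-] := eqVneq j l; first by rewrite /=; field.
  by rewrite /= !dotvE2 (dotvC (w l) (w j)); field.
pose g := c i + (\sum_j gam i j * dotv (w j) (w j)) / 2.
have eqg l : s / 2 * gam i l = (i == l)%:R - g.
  have : \sum_j dotv (h j) (h i) * dotv (w j) (w l) = (i == l)%:R - c i.
    have -> : \sum_j dotv (h j) (h i) * dotv (w j) (w l) =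
        dotv (\sum_j dotv (h j) (h i) *: w j) (w l).
      by rewrite dotv_suml; apply: eq_bigr => j _; rewrite dotvZl.
    by rewrite sum_hw dotvNl eq_sym -(cw l i); ring.
  rewrite (eq_bigr (fun j => gam i j * dotv (w j) (w j) / 2
     + gam i j * (dotv (w l) (w l) - s) / 2 + s / 2 * (gam i j * (j == l)%:R))); last first.
    by move=> j _; rewrite wE /gam k0 !mul0r addr0 (dotvC (h j)); field.
  rewrite !big_split /= -!mulr_suml gram_row_sum// !mul0r addr0 -mulr_sumr.
  have -> : \sum_j gam i j * (j == l)%:R = gam i l.
    rewrite (bigD1 l)//= eqxx mulr1 big1 ?addr0// => j jl.
    by rewrite (negbTE jl) mulr0.
  move=> E; rewrite /g; move: E; lra.
have gE : g = (1 + n%:R)^-1.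
  apply: (mulfI n0); rewrite mulfV//.
  have : \sum_l s / 2 * gam i l = \sum_l ((i == l)%:R - g) by apply: eq_bigr => l _; exact: eqg.
  rewrite -mulr_sumr gram_row_sum// mulr0 sumrB sumr_const card_ord.
  rewrite -[_ *+ n.+1]mulr_natl -[n.+1%:R]nat1r.
  rewrite (bigD1 i)//= eqxx big1 ?addr0 => [|j ji]; last by rewrite eq_sym (negbTE ji).
  by move/esym/eqP; rewrite subr_eq0 => /eqP.
apply: (@mulfI _ (s / 2)); first by rewrite mulf_neq0 ?invr_neq0 ?pnatr_eq0.
by rewrite eqg gE; field; rewrite n0.
Qed.

(** The equations of [gram_inverse] contain, besides the entry gam i m, only the unknown sum Y i,
    which is found by summing over m. That 1 - C and 1 + n C are nonzero follows from the same
    equations. *)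
Lemma gram_curved (s : 'I_n.+1 -> R) (C : R) : (0 < n)%N -> kappa != 0 -> (forall i, s i != 0) ->
  (forall i j, 1 + kappa * dotv (w i) (w j) = s i * s j * ((1 - C) * (i == j)%:R + C)) ->
  [/\ 1 - C != 0, 1 + n%:R * C != 0 &
   forall i m, gam i m = kappa / (1 - C) / (s i * s m) * ((i == m)%:R - C / (1 + n%:R * C))].
Proof.
move=> n0 k0 s0 Q.
pose Y i := \sum_j gam i j * s j.
have E i m : (1 - C) * (gam i m * s m) + C * Y i = kappa * (i == m)%:R / s m.
  rewrite -gram_inverse (eq_bigr (fun j => (gam i j * s j * ((1 - C) * (j == m)%:R + C)) * s m)); last first.
    by move=> j _; rewrite Q; ring.
  rewrite -mulr_suml mulfK// (eq_bigr (fun j => (1 - C) * (gam i j * s j * (j == m)%:R) + C * (gam i j * s j))); last first.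
    by move=> j _; ring.
  rewrite big_split /= -!mulr_sumr (bigD1 m)//= big1 ?addr0 => [|j jm]; last by rewrite (negbTE jm) mulr0.
  by rewrite eqxx mulr1.
have C1 : 1 - C != 0.
  (* If C = 1, the left-hand side C Y i is the same for all columns, but the right-hand side is
     nonzero only on the diagonal; two different indices are needed. *)
  apply/eqP => C0; pose i0 : 'I_n.+1 := ord0; pose i1 : 'I_n.+1 := Ordinal (n0 : (1 < n.+1)%N).
  have := E i0 i0; have := E i0 i1; rewrite C0 !mul0r !add0r => ->.
  by rewrite mulr0 mul0r eqxx mulr1 => /esym/eqP; rewrite mulf_eq0 invr_eq0 (negbTE k0) (negbTE (s0 _)).
have EY i : (1 + n%:R * C) * Y i = kappa / s i.
  have -> : kappa / s i = \sum_m kappa * (i == m)%:R / s m.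
    rewrite (bigD1 i)//= eqxx mulr1 big1 ?addr0// => j ji.
    by rewrite eq_sym (negbTE ji) mulr0 mul0r.
  rewrite -(eq_bigr _ (fun m _ => E i m)) big_split /= -mulr_sumr sumr_const card_ord.
  by rewrite -[_ *+ n.+1]mulr_natl -[n.+1%:R]nat1r -/(Y i); ring.
have C2 : 1 + n%:R * C != 0.
  apply/eqP => C0; have := EY ord0; rewrite C0 mul0r => /esym/eqP.
  by rewrite mulf_eq0 invr_eq0 (negbTE k0) (negbTE (s0 _)).
split => // i m; apply: (mulIf (s0 m)); apply: (mulfI C1).
have -> : (1 - C) * (gam i m * s m) = kappa * (i == m)%:R / s m - C * Y i.
  by rewrite -E addrK.
have -> : Y i = kappa / s i / (1 + n%:R * C) by rewrite -EY mulrC mulKf.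
have [->|im] := eqVneq i m; rewrite /=; field; rewrite ?C1 ?C2 ?s0//.
Qed.

End simplex.

Lemma simplex_facet_gram (R : realType) n (kappa l : R) (P : set 'rV[R]_n) :
  (0 < n)%N -> regular_simplex kappa l P ->
  0 < 1 + n%:R * Ccurv kappa l /\
  facet_gram kappa (Ccurv kappa l / (1 + n%:R * Ccurv kappa l)) P.
Proof.
move=> n0 [PB [w [wind PE dist]]].
have [h [c [cw sumcw]]] := barycentric_coordinates wind.
have sumc y := (sumcw y).1; have sumw y := (sumcw y).2.
have wP i : P (w i).
  rewrite PE; exists (fun j => (j == i)%:R); split=> [j| |]; first exact: ler0n.
    by rewrite (bigD1 i)//= eqxx big1 ?addr0// => j /negbTE ->.
  rewrite (bigD1 i)//= eqxx scale1r big1 ?addr0// => j /negbTE ->.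
  by rewrite scale0r.
pose i1 : 'I_n.+1 := Ordinal (n0 : (1 < n.+1)%N).
have w01 : w ord0 - w i1 != 0.
  rewrite subr_eq0; apply/eqP => w01.
  by have := cw i1 ord0; rewrite -w01 cw => /eqP; rewrite oner_eq0.
have nR0 : 0 < 1 + n%:R :> R by rewrite ltr_pwDl.
have [k0|k0] := eqVneq kappa 0.
  have ws i j : i != j -> dotv (w i - w j) (w i - w j) = l ^+ 2.
    by move=> /dist; rewrite /klein_dist k0 eqxx => <-; rewrite sqr_sqrtr// dotv_ge0.
  have l0 : 0 < l ^+ 2 by rewrite -(ws ord0 i1)// dotv_gt0.
  rewrite /Ccurv k0 ltxx eqxx mulr1; split => //.
  exists 'I_n.+1, h, c, (fun=> Num.sqrt (2 / l ^+ 2)); split => //.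
  - by rewrite PE (conv_hull_barycentric cw sumc sumw).
  - by move=> j; rewrite sqrtr_gt0 divr_gt0.
  - by move=> y _; exact: conv_hull_few_tight.
  - move=> y i j _ _ _; rewrite (gram_flat cw sumc sumw _ _ _ (lt0r_neq0 l0) ws)//.
    by rewrite -expr2 sqr_sqrtr ?div1r// divr_ge0// ltW.
have N0 i := klein_ball_gt0 (PB _ (wP i)).
(* The length of the lifted vertex for the form 1 + kappa <x, y>; after division by it the Gram
   matrix is (1 - C) I + C J. *)
pose s i := Num.sqrt (1 + kappa * dotv (w i) (w i)).
have s0 i : 0 < s i by rewrite sqrtr_gt0.
set C := Ccurv kappa l.
have Q i j : 1 + kappa * dotv (w i) (w j) = s i * s j * ((1 - C) * (i == j)%:R + C).
  have [->|ij] := eqVneq i j; first by rewrite /= mulr1 subrK mulr1 -expr2 sqr_sqrtr// ltW.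
  rewrite /= mulr0 add0r /C -(dist _ _ ij) Ccurv_klein_dist//; [|exact: PB|exact: PB].
  by rewrite sqrtrM ?(ltW (N0 _))// -/(s i) -/(s j) [RHS]mulrC divfK// mulf_neq0 ?gt_eqF.
have sn0 i : s i != 0 by rewrite gt_eqF.
have [C1 C2 gramE] := gram_curved cw sumc sumw n0 k0 sn0 Q.
(* cosh >= 1 and cos <= 1 give 1 - C the sign of kappa, which makes the scaling of the normals
   real. *)
have [Cpos kC] : 0 < 1 + n%:R * C /\ 0 < kappa / (1 - C).
  case: (ltrgtP kappa 0) k0 => // kappa0 _.
    have Cge : 1 <= C by rewrite /C /Ccurv kappa0 cosh_ge1.
    split; first by rewrite ltr_pwDl// mulr_ge0// (le_trans ler01).
    by rewrite nmulr_rgt0// invr_lt0 lt_neqAle C1/= subr_le0.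
  have Cle : C <= 1 by rewrite /C /Ccurv (lt_gtF kappa0) (gt_eqF kappa0) cos_le1.
  split; last by rewrite divr_gt0// lt_neqAle eq_sym C1/= subr_ge0.
  (* For kappa > 0 the form is positive definite, and (1 + n) (1 + n C) is the squared length of the
     sum of the normalised lifted vertices. *)
  rewrite lt_neqAle eq_sym C2 /= -(pmulr_rge0 _ nR0).
  have -> : (1 + n%:R) * (1 + n%:R * C) = (\sum_i (s i)^-1) ^+ 2 +
      kappa * dotv (\sum_i (s i)^-1 *: w i) (\sum_i (s i)^-1 *: w i).
    rewrite dotv_suml expr2 mulr_suml mulr_sumr -big_split /=.
    rewrite (eq_bigr (fun=> 1 + n%:R * C)); first by rewrite sumr_const card_ord -[RHS]mulr_natl -[n.+1%:R]nat1r.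
    move=> i _; rewrite dotvC dotv_suml !mulr_sumr -big_split /=.
    rewrite (eq_bigr (fun j => (1 - C) * (j == i)%:R + C)).
      rewrite big_split /= -mulr_sumr sumr_const card_ord -[_ *+ n.+1]mulr_natl -[n.+1%:R]nat1r.
      rewrite (bigD1 i)//= eqxx big1 ?addr0 => [|j /negbTE -> //].
      by rewrite /=; ring.
    move=> j _; rewrite dotvZl dotvZr.
    transitivity ((s i)^-1 * (s j)^-1 * (1 + kappa * dotv (w j) (w i))); first by ring.
    by rewrite Q; field; rewrite !sn0.
  by rewrite addr_ge0 ?sqr_ge0// mulr_ge0 ?dotv_ge0// ltW.
split => //; exists 'I_n.+1, h, c, (fun i => Num.sqrt (kappa / (1 - C)) / s i); split => //.
- by rewrite PE (conv_hull_barycentric cw sumc sumw).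
- by move=> j; rewrite divr_gt0// sqrtr_gt0.
- by move=> y _; exact: conv_hull_few_tight.
- move=> y i j _ _ _; rewrite gramE; congr (_ * _).
  have {1}-> : kappa / (1 - C) = Num.sqrt (kappa / (1 - C)) ^+ 2 by rewrite sqr_sqrtr// ltW.
  by field; rewrite !sn0.
Qed.

(** * Angles of regular polytopes *)

Section simplicial_cones.
Variables (R : realType) (k m : nat).

Lemma lin_hull_last_cone (S : 'M[R]_m) : S \in unitmx -> lin_hull (@last_cone R k m S) = setT.
Proof.
move=> Su; apply/seteqP; split => // y _.
(* Positive part minus negative part in the coordinates given by S. *)
pose r := rsubmx y *m S; pose p : 'rV[R]_m := \row_j Num.max (r 0 j) 0.
have -> : y = row_mx (lsubmx y) (p *m invmx S) - row_mx 0 ((p - r) *m invmx S).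
  rewrite opp_row_mx add_row_mx oppr0 addr0 -mulmxBl opprB addrC subrK.
  by rewrite mulmxK// hsubmxK.
apply: lin_hullB; apply: sub_lin_hull => j; rewrite row_mxKr mulmxKV//.
  by rewrite mxE le_max lexx orbT.
by rewrite !mxE subr_ge0 le_max lexx.
Qed.

(** For k = 0 the types ['rV_m] and ['rV_(0 + m)] agree by conversion; only the projection to the
    last block has to be removed. *)
Lemma pos_hull_last_cone (S : 'M[R]_m) : S \in unitmx ->
  pos_hull (fun i => 1 *: row i S) = @last_cone R 0 m (invmx S).
Proof.
move=> Su; apply/seteqP; split => y.
  move=> /(pos_hull_rows _ Su) yS j; have := yS j.
  by congr (0 <= fun_of_matrix (_ *m _) _ _); apply/rowP => i; rewrite mxE; congr (y _ _); apply: val_inj.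
move=> yS; apply/(pos_hull_rows _ Su) => j; have := yS j.
by congr (0 <= fun_of_matrix (_ *m _) _ _); apply/rowP => i; rewrite mxE; congr (y _ _); apply: val_inj.
Qed.

Lemma pos_hull_orthant : euclidean_cone (pos_hull (fun i => 1 *: row i (1%:M : 'M[R]_m))) = orthant R m.
Proof.
congr euclidean_cone; apply/seteqP; split => y yP.
  by move=> i; move/(pos_hull_rows _ (unitmx1 _ _)) : yP => /(_ i); rewrite invmx1 mulmx1.
by apply/(pos_hull_rows _ (unitmx1 _ _)) => i; rewrite invmx1 mulmx1; exact: yP.
Qed.

Lemma solid_angle_last_cone (K : icone R) (S : 'M[R]_m) (c : R) :
  0 < 1 + m%:R * c -> S^T = S -> S *m S = 1%:M + c *: const_mx 1 -> S \in unitmx ->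
  (forall u, cform K u u = 0 -> u = 0) ->
  isometric K (euclidean_cone (@last_cone R k m S)) ->
  ((solid_angle K)%:C)%C = angle_integral c m.
Proof.
move=> c1 ST SS Su Kdef isoK; have [B0 Boo <-] := cone_solid_angle k c1 ST SS.
congr (_%:C)%C; apply: (solid_angle_isometric Kdef _ _ B0 Boo isoK).
  exact: lin_hull_last_cone.
exact: measurable_last_cone.
Qed.

End simplicial_cones.

Section regular_polytope_cones.
Variables (R : realType) (k m : nat) (kappa C : R) (P : set 'rV[R]_(k + m)).
Local Notation n := (k + m)%N.
Hypotheses (C0 : 0 < 1 + n%:R * C) (PB : P `<=` klein_ball kappa)
  (Pgram : facet_gram kappa (C / (1 + n%:R * C)) P).

Let b := C / (1 + n%:R * C).
Let a := C / (1 + k%:R * C).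

(** The expression is affine in l and positive at l = 0 and l = n. *)
Lemma partial_curv_gt0 l : (l <= n)%N -> 0 < 1 + l%:R * C.
Proof.
move=> ln; have [c0|c0] := leP 0 C; first by rewrite ltr_pwDl// mulr_ge0.
apply: (lt_le_trans C0); rewrite lerD2l ler_nM2r// ler_nat//.
Qed.

Let k0 : 0 < 1 + k%:R * C. Proof. by apply: partial_curv_gt0; exact: leq_addr. Qed.

Let bq l : (l <= n)%N -> 0 < 1 - l%:R * b.
Proof.
move=> ln; have -> : 1 - l%:R * b = (1 + (n - l)%:R * C) / (1 + n%:R * C).
  by rewrite natrB// /b; field; rewrite -natrD gt_eqF.
by rewrite divr_gt0// partial_curv_gt0// leq_subr.
Qed.

Let ab : - b + a + m%:R * - b * a = 0.
Proof. by rewrite /a /b natrD; field; rewrite -natrD !gt_eqF. Qed.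

Let mb : 0 < 1 + m%:R * - b.
Proof. by rewrite mulrN bq// leq_addl. Qed.

Let ma : 0 < 1 + m%:R * a.
Proof.
have -> : 1 + m%:R * a = (1 + n%:R * C) / (1 + k%:R * C).
  by rewrite /a natrD; field; rewrite gt_eqF.
by rewrite divr_gt0.
Qed.

(** The orthocentric parameter is - 1 / b. At C = 0, where b = 0, no finite parameter exists and the
    cone is an orthant. *)
Let normal_param : (- n%:R - C^-1)^-1 = - b \/ C = 0.
Proof.
have [->|c0] := eqVneq C 0; [by right|left].
rewrite /b; field; rewrite -natrD c0 gt_eqF//=.
by rewrite mulNr -opprD oppr_eq0 addrC gt_eqF.
Qed.

Lemma riem_normal_cones_facet_gram K : riem_normal_cones kappa P k K ->
  [/\ C != 0 -> exists2 O, is_orthocentric_cone (- n%:R - C^-1)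
                 (fun _ : 'I_m => 1) (fun _ => 1) O & isometric K O,
      C = 0 -> isometric K (orthant R m) &
      ((solid_angle K)%:C)%C = angle_integral a m].
Proof.
move=> [q [h [c [F [x [hrep FP Fk Fx ->]]]]]].
have [G [H [GT Gpos gE TE HGH]]] := face_cones_normal_form PB Pgram bq hrep FP Fk Fx.
rewrite /normal_cone gE TE.
have [S [ST SS Su]] := rank_one_sqrt mb.
have HGS : H *m invmx G *m H^T = S *m S by rewrite HGH SS.
have isoS := normal_isometric GT Gpos ST Su HGS.
have iSS := inv_rank_one_sqrt Su SS ab.
split.
- move=> c0; exists (euclidean_cone (pos_hull (fun i => 1 *: row i S))) => //.
  apply: orthocentric_rows => //; last first.
    by rewrite ST SS; case: normal_param => [->//|cE]; rewrite cE eqxx in c0.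
  rewrite -opprD oppr_eq0 -(mulIr_eq0 _ (mulIf c0)) mulrDl mulVf// addrC.
  by rewrite gt_eqF.
- move=> c0; have b0 : b = 0 by rewrite /b c0 mul0r.
  have HG1 : H *m invmx G *m H^T = 1%:M *m 1%:M.
    by rewrite HGH -/b b0 oppr0 scale0r addr0 mulmx1.
  rewrite -pos_hull_orthant.
  exact: (normal_isometric GT Gpos (trmx1 _ _) (unitmx1 _ _) HG1).
(* The normal cone spans only m dimensions, so there are no free coordinates; it is cut out by S^-1,
   whose square is I + a J. *)
- apply: (solid_angle_last_cone (k := 0) ma _ iSS); last first.
  + by rewrite -pos_hull_last_cone.
  + move=> u /= gu; apply/eqP; apply: contraTT isT => /Gpos.
    by rewrite gu ltxx.
  + by rewrite unitmx_inv.
  + by rewrite trmx_inv ST.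
Qed.

Lemma riem_tangent_cones_facet_gram K : riem_tangent_cones kappa P k K ->
  [/\ C != 0 -> exists2 O, is_orthocentric_cone (k%:R + C^-1)
                 (fun _ : 'I_m => 1) (fun _ => 1) O &
                 isometric K (osum (whole_space R k) O),
      C = 0 -> isometric K (osum (whole_space R k) (orthant R m)) &
      ((solid_angle K)%:C)%C = angle_integral (- b) m].
Proof.
move=> [q [h [c [F [x [hrep FP Fk Fx ->]]]]]].
have [G [H [GT Gpos gE TE HGH]]] := face_cones_normal_form PB Pgram bq hrep FP Fk Fx.
rewrite gE TE.
have [S [ST SS Su]] := rank_one_sqrt mb.
have HGS : H *m invmx G *m H^T = S *m S by rewrite HGH SS.
have isoS := tangent_isometric GT Gpos ST Su HGS.
have iSS := inv_rank_one_sqrt Su SS ab.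
split.
- move=> c0; exists (euclidean_cone (pos_hull (fun i => 1 *: row i (invmx S)))) => //.
  have kc : k%:R * C + 1 != 0 by rewrite addrC gt_eqF.
  apply: orthocentric_rows; last first.
  + rewrite trmx_inv ST iSS; congr (_ + _ *: _); rewrite /a; field.
    by rewrite c0 kc.
  + by rewrite unitmx_inv.
  + by rewrite -(mulIr_eq0 _ (mulIf c0)) mulrDl mulVf.
- move=> c0; have b0 : b = 0 by rewrite /b c0 mul0r.
  have HG1 : H *m invmx G *m H^T = 1%:M *m 1%:M.
    by rewrite HGH -/b b0 oppr0 scale0r addr0 mulmx1.
  rewrite -pos_hull_orthant.
  by have := tangent_isometric GT Gpos (trmx1 _ _) (unitmx1 _ _) HG1; rewrite invmx1.
(* The tangent cone fills the ambient space; its k free coordinates stay, and it is cut out by S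
   with S^2 = I - b J. *)
- apply: (solid_angle_last_cone (k := k) mb ST SS Su).
  + move=> u /= gu; apply/eqP; apply: contraTT isT => /Gpos.
    by rewrite gu ltxx.
  + exact: (tangent_isometric_last_cone GT Gpos ST Su HGS).
Qed.

(** [cintegral] has a value for every integrand, so convergence is asserted alongside the formulas
    for the angles. *)
Lemma cintegrable_angle_integrands :
  cintegrable setT (angle_integrand a m) /\ cintegrable setT (angle_integrand (- b) m).
Proof. by split; [have [] := weighted_orthant 0 ma|have [] := weighted_orthant 0 mb]. Qed.

End regular_polytope_cones.

Local Open Scope complex_scope.

Theorem proposition5p1 (R : realType) (d : nat) (kD kB lD lB : R)
    (Delta Box : set 'rV[R]_d)
    (d_ge2 : (2 <= d)%N)
    (Delta_regular : regular_simplex kD lD Delta)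
    (Box_regular : regular_cube kB lB Box)
    (curv_eq : Ccurv kB lB = 1 + 2 * Ccurv kD lD)
    (k : nat) (k_lt_d : (k < d)%N) :
  let C := Ccurv kD lD in
  let normalD := riem_normal_cones kD Delta k in
  let normalB := riem_normal_cones kB Box k in
  let tangentD := riem_tangent_cones kD Delta k in
  let tangentB := riem_tangent_cones kB Box k in
  [/\ (* (a) *)
      forall K, (normalD `|` normalB) K ->
        (C != 0 ->
           exists2 O, is_orthocentric_cone (- d%:R - C^-1)
                        (fun _ : 'I_(d - k) => 1) (fun _ => 1) O &
             isometric K O) /\
        (C = 0 -> isometric K (orthant R (d - k))),
      (* (b) *)
      forall K, (tangentD `|` tangentB) K ->
        (C != 0 ->
           exists2 O, is_orthocentric_cone (k%:R + C^-1)
                        (fun _ : 'I_(d - k) => 1) (fun _ => 1) O &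
             isometric K (osum (whole_space R k) O)) /\
        (C = 0 -> isometric K (osum (whole_space R k) (orthant R (d - k)))) &
      (* (c) *)
      [/\ forall K K', normalD K -> normalB K' ->
            solid_angle K = solid_angle K',
          forall K K', tangentD K -> tangentB K' ->
            solid_angle K = solid_angle K',
          cintegrable [set: R] (angle_integrand (C / (1 + k%:R * C)) (d - k)) /\
          (forall K, (normalD `|` normalB) K ->
             (solid_angle K)%:C = angle_integral (C / (1 + k%:R * C)) (d - k)) &
          cintegrable [set: R]
            (angle_integrand (- (C / (1 + d%:R * C))) (d - k)) /\
          (forall K, (tangentD `|` tangentB) K ->
             (solid_angle K)%:C =
             angle_integral (- (C / (1 + d%:R * C))) (d - k))]].
Proof.
(* With d replaced by k + m, rows split into blocks of lengths k and m without casts. *)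
move=> C; have [m dE] : exists m, d = (k + m)%N by exists (d - k)%N; rewrite subnKC// ltnW.
move: Delta Box Delta_regular Box_regular d_ge2; rewrite dE addKn => {dE k_lt_d}.
move=> Delta Box DR BR n2 normalD normalB tangentD tangentB.
have [C0 Dgram] := simplex_facet_gram (ltnW n2) DR.
have [_ Bgram] := cube_facet_gram n2 BR curv_eq.
rewrite -/C in C0 Dgram Bgram.
have normalP K : (normalD `|` normalB) K ->
  [/\ C != 0 -> exists2 O, is_orthocentric_cone (- (k + m)%:R - C^-1)
                 (fun _ : 'I_m => 1) (fun _ => 1) O & isometric K O,
      C = 0 -> isometric K (orthant R m) &
      (solid_angle K)%:C = angle_integral (C / (1 + k%:R * C)) m].
  case; first exact: (riem_normal_cones_facet_gram C0 DR.1 Dgram).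
  exact: (riem_normal_cones_facet_gram C0 BR.1 Bgram).
have tangentP K : (tangentD `|` tangentB) K ->
  [/\ C != 0 -> exists2 O, is_orthocentric_cone (k%:R + C^-1)
                 (fun _ : 'I_m => 1) (fun _ => 1) O &
                 isometric K (osum (whole_space R k) O),
      C = 0 -> isometric K (osum (whole_space R k) (orthant R m)) &
      (solid_angle K)%:C = angle_integral (- (C / (1 + (k + m)%:R * C))) m].
  case; first exact: (riem_tangent_cones_facet_gram C0 DR.1 Dgram).
  exact: (riem_tangent_cones_facet_gram C0 BR.1 Bgram).
have [inta intb] := cintegrable_angle_integrands C0.
split.
- by move=> K /normalP[].
- by move=> K /tangentP[].
- split.
  + move=> K K' nK nK'; have [_ _ aE] := normalP K (or_introl nK).
    by have [_ _] := normalP K' (or_intror nK'); rewrite -aE => -[].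
  + move=> K K' tK tK'; have [_ _ aE] := tangentP K (or_introl tK).
    by have [_ _] := tangentP K' (or_intror tK'); rewrite -aE => -[].
  + by split=> // K /normalP[].
  + by split=> // K /tangentP[].
Qed.
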